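(* Let $\mathfrak g$ be a seven-dimensional real Lie algebra which admits a codimension one Abelian ideal $\mathfrak u$. Let $e_7\in\mathfrak g\setminus\mathfrak u$, let $V_2$ be a two-dimensional subspace of $\mathfrak u$ and $V_4$ a four-dimensional subspace of $\mathfrak u$ such that $\mathfrak u=V_2\oplus V_4$, and let $\omega\in\Lambda^2V_4^*$ be a non-degenerate two-form on $V_4$. Let $\lambda_1,\dots,\lambda_6$ be the diagonal elements of a fixed complex Jordan normal form of $\mathrm{ad}(e_7)|_{\mathfrak u}$, numbered from the upper left to the lower right, and for $i=1,\dots,6$ let $\mathrm{JB}(i)$ be the number of the Jordan block containing the $i$-th diagonal element. Then the following are equivalent: (a) $\mathfrak g$ admits a cocalibrated $\mathrm G_2^*$-structure. (b) $\mathrm{ad}(e_7)|_{\mathfrak u}\in\mathfrak{gl}(\mathfrak u)$ is similar under $\mathrm{GL}(\mathfrak u)$ to an element of $$\Big\{f\in\mathfrak{gl}(\mathfrak u)\ \Big|\ f|_{V_2}=f_2+h,\ f_2\in\mathfrak{gl}(V_2),\ h\in\mathrm{Hom}(V_2,V_4),\ f|_{V_4}=-\tfrac{\mathrm{tr}(f_2)}{2}\mathrm{id}_{V_4}+f_4,\ f_4\in\mathfrak{sp}(V_4,\omega)\Big\}.$$ (c) There exists a partition of $\{1,\dots,6\}$ into three subsets $I_1,I_2,I_3$, each of cardinality two, such that the following is true: (i) $\sum_{i\in I_1}\lambda_i=\sum_{i\in I_2}\lambda_i=-\sum_{i\in I_3}\lambda_i$. (ii) If there are $i_1\in I_1$,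 $i_2\in I_2$ such that $\mathrm{JB}(i_1)=\mathrm{JB}(i_2)$, then $\lambda_{i_1}=\lambda_{i_2}=-\frac{\sum_{i\in I_3}\lambda_i}{2}$ or $\mathrm{JB}(j_1)=\mathrm{JB}(j_2)$ for the uniquely determined $j_k\in I_k$ such that $\{i_k,j_k\}=I_k$, $k=1,2$. (iii) If there exists $i_2\in I_2$ such that $\mathrm{JB}(j)=\mathrm{JB}(i_2)$ for all $j\in I_1$, or if there exists $i_1\in I_1$ such that $\mathrm{JB}(j)=\mathrm{JB}(i_1)$ for all $j\in I_2$, then $\lambda_j=-\frac{\sum_{i\in I_3}\lambda_i}{2}$ for all $j\in I_1\cup I_2$ and $\mathrm{JB}(j)=\mathrm{JB}(k)$ for all $j,k\in I_1\cup I_2$.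
   Context: Write $e^{ijk}=e^i\wedge e^j\wedge e^k$ etc. Let $V$ be a seven-dimensional real vector space. A $\mathrm G_2^*$-structure on $V$ is a three-form $\varphi\in\Lambda^3V^*$ such that there is a basis $e_1,\dots,e_7$ of $V$ (an adapted basis) with dual basis $e^1,\dots,e^7$ and $\varphi=-e^{127}-e^{347}+e^{567}+e^{135}-e^{146}-e^{236}-e^{245}$. It induces uniquely a pseudo-Euclidean metric $g$ and a metric volume form $\mathrm{vol}$ on $V$ by $g(v,w)\,\mathrm{vol}=\frac16(v\lrcorner\varphi)\wedge(w\lrcorner\varphi)\wedge\varphi$, such that each adapted basis is an oriented orthonormal basis, with $g(e_i,e_i)=-1$ for $i=1,2,3,4$ and $g(e_j,e_j)=1$ for $j=5,6,7$. The Hodge star $\star_\varphi:\Lambda^kV^*\to\Lambda^{7-k}V^*$ is defined by $\psi\wedge\phi=g(\star_\varphi\psi,\phi)\,\mathrm{vol}$ for all $\phi\in\Lambda^{7-k}V^*$. In an adapted basis, $\star_\varphi\varphi=-e^{1256}-e^{3456}+e^{1234}-e^{2467}+e^{2357}+e^{1457}+e^{1367}$. On a Lie algebra $\mathfrak g$, $d$ is the exterior derivative on $\Lambda^*\mathfrak g^*$ determined by $(d\alpha)(X,Y)=-\alpha([X,Y])$ for $\alpha\in\mathfrak g^*$. A cocalibrated $\mathrm G_2^*$-structure on a seven-dimensional real Lie algebra $\mathfrak g$ is a $\mathrm G_2^*$-structure $\varphi\in\Lambda^3\mathfrak g^*$ with $d\star_\varphi\varphi=0$. The Jordan blocks of the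 fixed complex Jordan normal form are numbered consecutively $1,\dots,m$ from the upper left to the lower right. $\mathfrak{sp}(V_4,\omega)=\{f\in\mathfrak{gl}(V_4):\omega(f v,w)+\omega(v,f w)=0\ \forall v,w\in V_4\}$. ''Similar under $\mathrm{GL}(\mathfrak u)$'' means conjugate by an element of $\mathrm{GL}(\mathfrak u)$. *)

(* Defs.v *)
From HB Require Import structures.
From mathcomp Require Import all_boot all_order all_fingroup all_algebra.
From mathcomp Require Import reals complex.

Set Implicit Arguments.
Unset Strict Implicit.
Unset Printing Implicit Defensive.

Import Order.TTheory GRing.Theory Num.Theory.
Local Open Scope ring_scope.

Section ExteriorForms.
Variables (R : realType) (V : vectType R).
Implicit Types k p q : nat.

Definition kform k : Type := {ffun 'I_k -> V} -> R.

Definition subst_at k (v : {ffun 'I_k -> V}) (i : 'I_k) (x : V) :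
  {ffun 'I_k -> V} := [ffun j => if j == i then x else v j].

Definition multilinear k (a : kform k) : Prop :=
  forall (v : {ffun 'I_k -> V}) (i : 'I_k) (c : R) (x y : V),
    a (subst_at v i (c *: x + y)) = c * a (subst_at v i x) + a (subst_at v i y).

Definition alternating k (a : kform k) : Prop :=
  forall (v : {ffun 'I_k -> V}) (i j : 'I_k), i != j -> v i = v j -> a v = 0.

Definition alt_form k (a : kform k) : Prop := multilinear a /\ alternating a.

Definition pair_arg (x y : V) : {ffun 'I_2 -> V} :=
  [ffun i => if i == ord0 then x else y].

Definition nondegenerate2 (g : V -> V -> R) : Prop :=
  forall x, (forall y, g x y = 0) -> x = 0.

(* Normalised so that a1 ^ ... ^ ak evaluates to the determinant of the
   matrix (ai (vj)) on 1-forms a1, ..., ak. *)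
Definition wedge p q (a : kform p) (b : kform q) : kform (p + q) :=
  fun v => ((p`! * q`!)%N%:R)^-1 *
    \sum_(s : 'S_(p + q)) (-1) ^+ s *
      (a [ffun i => v (s (lshift q i))] * b [ffun i => v (s (rshift p i))]).

Definition contract k (x : V) (a : kform k.+1) : kform k :=
  fun v => a [ffun i => oapp v x (unlift ord0 i)].

(* The inner product induced by g on k-forms,
     1/k! * \sum g^(i_1 j_1) ... g^(i_k j_k) a_(i_1 ... i_k) b_(j_1 ... j_k),
   computed in the basis vbasis {:V}; its value on alternating forms does not
   depend on the basis, and the k-fold wedge products of a g-orthonormal
   coframe are orthogonal of square +1 or -1. *)
Definition gram_inv (g : V -> V -> R) : 'M[R]_(\dim {:V}) :=
  invmx (\matrix_(i, j) g (vbasis {:V})`_i (vbasis {:V})`_j).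

Definition form_metric (g : V -> V -> R) k (a b : kform k) : R :=
  (k`!%:R)^-1 *
  \sum_(I : {ffun 'I_k -> 'I_(\dim {:V})})
  \sum_(J : {ffun 'I_k -> 'I_(\dim {:V})})
    (\prod_(t < k) gram_inv g (I t) (J t)) *
    a [ffun t => (vbasis {:V})`_(I t)] * b [ffun t => (vbasis {:V})`_(J t)].

Definition is_hodge_star (g : V -> V -> R) k l (vol : kform (k + l))
    (psi : kform k) (star_psi : kform l) : Prop :=
  alt_form star_psi /\
  forall phi : kform l, alt_form phi ->
    forall v, wedge psi phi v = form_metric g star_psi phi * vol v.

(* cov e i is e^i, with indices i = 1, ..., 7. *)
Definition cov (e : 7.-tuple V) (i : nat) : kform 1 :=
  fun v => coord e (inord i.-1) (v ord0).

Definition cov3 (e : 7.-tuple V) (i j k : nat) : kform 3 :=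
  wedge (wedge (cov e i) (cov e j)) (cov e k).

Definition adapted_basis (phi : kform 3) (e : 7.-tuple V) : Prop :=
  basis_of {:V} e /\
  forall v, phi v =
    - cov3 e 1 2 7 v - cov3 e 3 4 7 v + cov3 e 5 6 7 v + cov3 e 1 3 5 v
    - cov3 e 1 4 6 v - cov3 e 2 3 6 v - cov3 e 2 4 5 v.

Definition G2star_structure (phi : kform 3) : Prop :=
  exists e : 7.-tuple V, adapted_basis phi e.

Definition pseudo_metric (g : V -> V -> R) : Prop :=
  [/\ bilinear_for *%R *%R g, forall x y, g x y = g y x & nondegenerate2 g].

(* The metric and the volume form which phi determines.  The equation alone
   leaves the choice between (g, vol) and (-g, -vol), which the last clause
   settles. *)
Definition G2star_metric (phi : kform 3) (g : V -> V -> R) (vol : kform 7) :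
    Prop :=
  [/\ pseudo_metric g,
      alt_form vol,
      forall x y v,
        g x y * vol v =
        6^-1 * wedge (wedge (contract x phi) (contract y phi)) phi v &
      forall e, adapted_basis phi e ->
        (forall i j : 'I_7, g e`_i e`_j =
           if i == j then (if (i < 4)%N then -1 else 1) else 0)
        /\ vol [ffun i : 'I_7 => e`_i] = 1].

End ExteriorForms.

Section LieAlgebra.
Variables (R : realType) (g : vectType R) (br : g -> g -> g).

Definition lie_bracket : Prop :=
  [/\ bilinear_for *:%R *:%R br,
      forall x, br x x = 0 &
      forall x y z, br x (br y z) + br y (br z x) + br z (br x y) = 0].

Definition abelian_ideal (u : {vspace g}) : Prop :=
  (forall x y, y \in u -> br x y \in u) /\
  (forall x y, x \in u -> y \in u -> br x y = 0).

(* Chevalley-Eilenberg differential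
     (d a)(x_0, ..., x_k) =
       \sum_(i < j) (-1)^(i+j) a([x_i, x_j], x_0, .., ^x_i, .., ^x_j, .., x_k),
   the antiderivation with (d a)(x, y) = - a [x, y] on 1-forms; bump j (bump i s)
   is the s-th index different from i and j. *)
Definition ext_deriv k (a : kform g k) : kform g k.+1 :=
  fun v => \sum_(i < k.+1) \sum_(j < k.+1 | (i < j)%N) (-1) ^+ (i + j) *
    a [ffun t : 'I_k => if t == 0%N :> nat then br (v i) (v j)
                        else v (inord (bump j (bump i t.-1)))].

Definition cocalibrated (phi : kform g 3) : Prop :=
  G2star_structure phi /\
  exists (h : g -> g -> R) (vol : kform g 7) (star_phi : kform g 4),
    [/\ G2star_metric phi h vol,
        @is_hodge_star R g h 3 4 vol phi star_phi &
        forall v, ext_deriv star_phi v = 0].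

Definition ad_on (u : {vspace g}) (x : g) : 'End(subvs_of u) :=
  linfun (fun y : subvs_of u => vsproj u (br x (vsval y))).

End LieAlgebra.

Section Endomorphisms.
Variables (R : realType) (V : vectType R).

(* The j-th column holds the coordinates of f e_j. *)
Definition end_mx n (e : n.-tuple V) (f : 'End(V)) : 'M[R]_n :=
  \matrix_(i, j) coord e i (f e`_j).

Definition end_trace (f : 'End(V)) : R := \tr (end_mx (vbasis {:V}) f).

Definition GL_similar (f f' : 'End(V)) : Prop :=
  exists P : 'End(V), lker P == 0%VS /\ f' = (P \o f \o P^-1)%VF.

Definition in_sp (omega : kform V 2) (f : 'End(V)) : Prop :=
  forall v w, omega (pair_arg (f v) w) + omega (pair_arg v (f w)) = 0.

End Endomorphisms.

Definition in_split_class (R : realType) (U : vectType R) (V2 V4 : {vspace U})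
    (omega : kform (subvs_of V4) 2) (f : 'End(U)) : Prop :=
  exists (f2 : 'End(subvs_of V2)) (h : 'Hom(subvs_of V2, subvs_of V4))
         (f4 : 'End(subvs_of V4)),
    [/\ in_sp omega f4,
        forall x : subvs_of V2, f (vsval x) = vsval (f2 x) + vsval (h x) &
        forall x : subvs_of V4,
          f (vsval x) = - (end_trace f2 / 2) *: vsval x + vsval (f4 x)].

(* A Jordan normal form is encoded by its diagonal lam and the block numbers jb:
   the blocks are the maximal intervals of indices on which jb is constant,
   numbered 1, 2, ... from the upper left. *)
Definition jordan_data (K : Type) n (lam : 'I_n -> K) (jb : 'I_n -> nat) : Prop :=
  [/\ forall i : 'I_n, val i = 0%N -> jb i = 1%N,
      forall i j : 'I_n, val j = (val i).+1 -> jb j = jb i \/ jb j = (jb i).+1 &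
      forall i j : 'I_n, jb i = jb j -> lam i = lam j].

Definition jordan_mx (K : nzRingType) n (lam : 'I_n -> K) (jb : 'I_n -> nat) :
    'M[K]_n :=
  \matrix_(i, j) if i == j then lam i
                 else ((val j == (val i).+1) && (jb i == jb j))%:R.

Definition complex_jordan_form (R : realType) (V : vectType R) n (f : 'End(V))
    (lam : 'I_n -> R[i]) (jb : 'I_n -> nat) : Prop :=
  jordan_data lam jb /\
  exists (e : n.-tuple V) (P : 'M[R[i]]_n),
    [/\ basis_of {:V} e, P \in unitmx &
        map_mx (real_complex R) (end_mx e f) *m P = P *m jordan_mx lam jb].

Definition jordan_partition (K : fieldType) (lam : 'I_6 -> K) (JB : 'I_6 -> nat)
    (I1 I2 I3 : {set 'I_6}) : Prop :=
  [/\ (\sum_(i in I1) lam i = \sum_(i in I2) lam i /\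
       \sum_(i in I2) lam i = - \sum_(i in I3) lam i),
      (forall i1 i2, i1 \in I1 -> i2 \in I2 -> JB i1 = JB i2 ->
         (lam i1 = lam i2 /\ lam i2 = - ((\sum_(i in I3) lam i) / 2)) \/
         (forall j1 j2, [set i1; j1] = I1 -> [set i2; j2] = I2 ->
            JB j1 = JB j2)) &
      ((exists2 i2, i2 \in I2 & forall j, j \in I1 -> JB j = JB i2) \/
       (exists2 i1, i1 \in I1 & forall j, j \in I2 -> JB j = JB i1) ->
       (forall j, j \in I1 :|: I2 -> lam j = - ((\sum_(i in I3) lam i) / 2)) /\
       (forall j k, j \in I1 :|: I2 -> k \in I1 :|: I2 -> JB j = JB k))].

(* Main.v *)
Require Import Defs.
From HB Require Import structures.
From mathcomp Require Import all_boot all_order all_fingroup all_algebra.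
From mathcomp Require Import reals complex.
From mathcomp Require Import zify ring lra.

Set Implicit Arguments.
Unset Strict Implicit.
Unset Printing Implicit Defensive.

Import Order.TTheory GRing.Theory Num.Theory.
Local Open Scope ring_scope.

(** Let F be the matrix of ad(e7) on the six-dimensional ideal u.  Interior
    multiplication with a volume form identifies four-forms on u with bivectors
    B in the second exterior power of u, that is, with skew matrices, and
    ad(e7) annihilates the four-form exactly when
      F B + B F^T = tr(F) B                                              (1)
    ([invariant_biv]).  The theorem is a statement about the solutions B of (1).

    Condition (a).  As u is Abelian, a four-form on the Lie algebra is closed
    exactly when ad(e7) annihilates its restriction to u ([closed_restrict],
    [restrict_closed]).  The Hodge dual of a G2*-form is known explicitly in an
    adapted basis ([hodge_star_unique]), and whatever hyperplane it is restricted
    to, the resulting bivector has rank at least four ([rank_hyperplane]).  So (a)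
    gives a real solution of (1) of rank at least four
    ([cocalibrated_bivector]).  Conversely let B be a real solution of rank
    exactly four, so that B = x1 ^ x2 + x3 ^ x4 in a basis of u.  This is the
    bivector that arises on a degenerate hyperplane, and an explicit adapted basis
    restricts the Hodge dual to it ([normal_form_cocalibrated]).

    Condition (b).  Put on V4 the bivector inverse to omega.  The
    endomorphisms of the class in (b) are exactly those for which this bivector of
    rank four solves (1) ([in_split_classP]); hence (b) says that (1) has a real
    solution of rank exactly four.

    Condition (c).  In a Jordan basis (1) becomes a recursion for the entries of
    B: an entry at (a, b) can be nonzero only if lam a + lam b is the trace, and
    nonzero entries move along antidiagonals of the rectangle belonging to two
    Jordan blocks ([invariant_jordan_eigen], [invariant_jordan_shift]).  Hence a
    solution of rank at least four forces one of four patterns of blocks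
    ([rank_ge4_pattern]).  Each pattern carries an obvious complex solution of
    rank exactly four ([pattern_rank4]), and the patterns amount to the partition
    condition (c) ([jordan_partition_pattern]).

    It remains to pass from complex to real solutions of rank exactly four
    ([real_rank4]).  Write a complex solution as B + i C.  The Pfaffian of
    s B + t C is a real cubic form in (s, t) which vanishes at (1, i) and hence at
    (1, -i), so it equals (s^2 + t^2) (s p + t q) with p and q the Pfaffians of B
    and C.  If p and q are not both zero, the real zero (q, -p) is simple, and a
    simple zero of the Pfaffian is a form of rank four.  If both vanish, no real
    member of the pencil has rank six, and a generic one has rank four.  In this
    way solutions of rank six, which (a) also allows, never need separate
    treatment. *)

(** * Bivectors as skew matrices *)

Section Bivectors.
Variables (K : fieldType) (n : nat).
Implicit Types (C : 'M[K]_n) (p q : 'cV[K]_n).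

(** The diagonal is required to vanish so that the notion makes sense in every
    characteristic. *)
Definition alt_mx C : Prop := (forall i, C i i = 0) /\ (forall i j, C j i = - C i j).

(** The Pfaffian of the principal submatrix on the indices i, j, k, l. *)
Definition pf4 C i j k l : K := C i j * C k l - C i k * C j l + C i l * C j k.

(** The rank of a skew matrix is even, so it is at least four as soon as one
    sub-Pfaffian of size four does not vanish.  This form of the condition is
    polynomial in the entries, which is what extension of scalars and the pencil
    argument need. *)
Definition rank_ge4 C : bool :=
  [exists i, [exists j, [exists k, [exists l, pf4 C i j k l != 0]]]].

(** The decomposable bivector p ^ q. *)
Definition biv p q : 'M[K]_n := p *m q^T - q *m p^T.

Lemma rank_ge4P C :
  reflect (exists i j k l, pf4 C i j k l != 0) (rank_ge4 C).
Proof.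
apply: (iffP existsP) => [[i /existsP[j /existsP[k /existsP[l h]]]]|].
  by exists i, j, k, l.
move=> [i [j [k [l h]]]]; exists i; apply/existsP; exists j.
by apply/existsP; exists k; apply/existsP; exists l.
Qed.

Lemma rank_lt4P C i j k l : ~~ rank_ge4 C -> pf4 C i j k l = 0.
Proof.
by move=> h; apply/eqP; apply: contraNT h => h; apply/rank_ge4P; exists i, j, k, l.
Qed.

Lemma bivE p q i j : biv p q i j = p i 0 * q j 0 - q i 0 * p j 0.
Proof. by rewrite !mxE !big_ord1 !mxE. Qed.

Lemma alt_biv p q : alt_mx (biv p q).
Proof. by split=> [i|i j]; rewrite !bivE; ring. Qed.

Lemma alt_add C D : alt_mx C -> alt_mx D -> alt_mx (C + D).
Proof.
move=> [c1 c2] [d1 d2]; split=> [i|i j]; rewrite !mxE; first by rewrite c1 d1 addr0.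
by rewrite c2 d2 opprD.
Qed.

Lemma alt_scale a C : alt_mx C -> alt_mx (a *: C).
Proof.
move=> [c1 c2]; split=> [i|i j]; rewrite !mxE; first by rewrite c1 mulr0.
by rewrite c2 mulrN.
Qed.

Lemma pf4_biv p q i j k l : pf4 (biv p q) i j k l = 0.
Proof. by rewrite /pf4 !bivE; ring. Qed.

(** One step of symplectic Gram-Schmidt orthogonalisation: the last summand is the
    Schur complement of the block on the indices a, b. *)
Lemma alt_mx_split C a b : C a b != 0 ->
  C = biv ((C a b)^-1 *: (row a C)^T) (row b C)^T
      + \matrix_(i, j) ((C a b)^-1 * pf4 C a b i j).
Proof.
move=> ab0; apply/matrixP=> i j; rewrite mxE bivE !mxE /pf4.
by field.
Qed.

(** If all sub-Pfaffians vanish then so does the Schur complement of any nonzero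
    entry. *)
Lemma rank_lt4_biv C : alt_mx C -> ~~ rank_ge4 C -> exists p q, C = biv p q.
Proof.
move=> altC h; case: (boolP [exists a, [exists b, C a b != 0]]).
  move=> /existsP[a /existsP[b ab0]]; do 2 eexists.
  rewrite {1}(alt_mx_split ab0) [X in _ + X](_ : _ = 0) ?addr0 //.
  by apply/matrixP=> i j; rewrite !mxE (rank_lt4P _ _ _ _ h) mulr0.
rewrite negb_exists => /forallP h0; exists 0, 0.
rewrite /biv mul0mx subr0; apply/matrixP=> i j; rewrite mxE.
by move: (h0 i); rewrite negb_exists => /forallP/(_ j); rewrite negbK => /eqP.
Qed.

End Bivectors.

Section Congruence.
Variables (K : fieldType) (m n : nat).

Lemma congr_biv (P : 'M[K]_(m, n)) p q :
  P *m biv p q *m P^T = biv (P *m p) (P *m q).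
Proof. by rewrite /biv mulmxBr mulmxBl !trmx_mul !mulmxA. Qed.

Lemma mul_congrE (P : 'M[K]_(m, n)) C i j :
  (P *m C *m P^T) i j = \sum_k \sum_l P i k * P j l * C k l.
Proof.
rewrite mxE exchange_big /=; apply: eq_bigr => l _.
by rewrite !mxE mulr_suml; apply: eq_bigr => k _; ring.
Qed.

(** Since the characteristic may be two, the vanishing of the diagonal does not
    follow from skewness: the terms of the double sum are paired off by exchanging
    the two indices. *)
Lemma alt_congr (P : 'M[K]_(m, n)) C : alt_mx C -> alt_mx (P *m C *m P^T).
Proof.
move=> [c1 c2].
have skew i j : (P *m C *m P^T) j i = - (P *m C *m P^T) i j.
  rewrite !mul_congrE exchange_big -sumrN; apply: eq_bigr => k _.
  by rewrite -sumrN; apply: eq_bigr => l _ /=; rewrite (c2 k l); ring.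
split=> // i; rewrite mul_congrE.
have pairE : \sum_k \sum_l P i k * P i l * C k l =
  \sum_(x : 'I_n * 'I_n) P i x.1 * P i x.2 * C x.1 x.2.
  by rewrite pair_bigA.
rewrite pairE (bigID (fun x : 'I_n * 'I_n => (x.1 < x.2)%N)) /=.
rewrite [X in _ + X](bigID (fun x : 'I_n * 'I_n => x.1 == x.2)) /=.
rewrite [X in _ + (X + _)]big1 ?add0r; last first.
  by move=> [x y] /= /andP[_ /eqP->]; rewrite c1 mulr0.
rewrite [X in _ + X](reindex_inj (h := fun x : 'I_n * 'I_n => (x.2, x.1))) /=; last first.
  by move=> [x y] [x' y'] [-> ->].
rewrite [X in _ + X](eq_bigl (fun x : 'I_n * 'I_n => (x.1 < x.2)%N)); last first.
  move=> [x y] /=; rewrite -leqNgt -(inj_eq val_inj) /=.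
  by rewrite [RHS]ltn_neqAle [RHS]andbC eq_sym.
rewrite -big_split big1 //= => -[x y] _ /=; rewrite (c2 x y); ring.
Qed.

End Congruence.

(** A skew matrix with vanishing sub-Pfaffians is decomposable, and decomposability
    is visibly preserved by congruence. *)
Lemma rank_ge4_congr (K : fieldType) n (P : 'M[K]_n) C : P \in unitmx -> alt_mx C ->
  rank_ge4 C -> rank_ge4 (P *m C *m P^T).
Proof.
move=> uP altC hC; case: (boolP (rank_ge4 _)) => // h.
have [p [q E]] := rank_lt4_biv (alt_congr P altC) h.
have : C = biv (invmx P *m p) (invmx P *m q).
  rewrite -congr_biv -E !mulmxA mulVmx // mul1mx -mulmxA.
  by rewrite -trmx_mul mulVmx // trmx1 mulmx1.
move=> CE; case/rank_ge4P: hC => i [j [k [l]]].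
by rewrite CE pf4_biv eqxx.
Qed.

(** With rho the contraction of a volume form with B, the derivation induced by F
    sends rho to the contraction with tr(F) B - F B - B F^T, up to sign; this is the
    condition that F annihilates rho. *)
Definition invariant_biv (K : fieldType) n (F B : 'M[K]_n) : Prop :=
  F *m B + B *m F^T = \tr F *: B.

(** F and F' are the matrices of one endomorphism in two bases, and the columns of P
    express the second basis in the first. *)
Lemma invariant_biv_congr (K : fieldType) n (P F F' B : 'M[K]_n) : P \in unitmx ->
  F *m P = P *m F' -> invariant_biv F' B -> invariant_biv F (P *m B *m P^T).
Proof.
move=> uP FP h; rewrite /invariant_biv.
have -> : \tr F = \tr F'.
  by rewrite -[F](mulmxK uP) FP mxtrace_mulC !mulmxA mulVmx // mul1mx.
have FP' : P^T *m F^T = F'^T *m P^T by rewrite -!trmx_mul FP.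
rewrite !mulmxA FP -(mulmxA _ P^T) FP' !mulmxA -mulmxDl -!mulmxA -mulmxDr !mulmxA.
by rewrite h -scalemxAr -scalemxAl.
Qed.

(** * Invariant bivectors of a Jordan matrix *)

Section JordanBlocks.
Variables (K : fieldType) (n : nat) (lam : 'I_n -> K) (jb : 'I_n -> nat).
Hypothesis jd : jordan_data lam jb.

(** The pairs of indices at which the Jordan matrix has an off-diagonal entry
    one. *)
Definition next_in_block (a b : 'I_n) : bool :=
  (val b == (val a).+1) && (jb b == jb a).

Lemma next_uniq a b c : next_in_block a b -> next_in_block a c -> b = c.
Proof.
by move=> /andP[/eqP h _] /andP[/eqP h' _]; apply: val_inj; rewrite h h'.
Qed.

Lemma jb_mono (a b : 'I_n) : (a <= b)%N -> (jb a <= jb b)%N.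
Proof.
case: jd => _ step _.
move: {2}(b - a)%N (erefl (b - a)%N) => d; elim: d b => [|d IH] b hd ab.
  by rewrite (_ : a = b) //; apply: val_inj => /=; lia.
have hb : (b.-1 < n)%N by have := ltn_ord b; lia.
have := step (Ordinal hb) b; rewrite /= => /(_ ltac:(lia)) h.
have := IH (Ordinal hb) ltac:(rewrite /=; lia) ltac:(rewrite /=; lia).
by case: h => ->; lia.
Qed.

Lemma jb_between (a b c : 'I_n) : (a <= c)%N -> (c <= b)%N -> jb a = jb b ->
  jb c = jb a.
Proof. by move=> /jb_mono h1 /jb_mono h2 h; lia. Qed.

Lemma jordan_mxE (a k : 'I_n) : jordan_mx lam jb a k =
  lam a * (k == a)%:R + (next_in_block a k)%:R.
Proof.
rewrite mxE eq_sym; case: eqP => [->|_]; rewrite /next_in_block.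
  by rewrite (_ : (_ == _.+1) = false) ?mulr1 ?addr0 //; apply/eqP; lia.
by rewrite mulr0 add0r [in RHS]eq_sym [X in _ && X]eq_sym [in RHS]eq_sym.
Qed.

Lemma jordan_mulE m (C : 'M[K]_(n, m)) (a : 'I_n) (j : 'I_m) :
  (jordan_mx lam jb *m C) a j =
  lam a * C a j + \sum_(k | next_in_block a k) C k j.
Proof.
rewrite mxE (eq_bigr (fun k => lam a * ((k == a)%:R * C k j) +
    (if next_in_block a k then C k j else 0))); last first.
  by move=> k _; rewrite jordan_mxE; case: next_in_block => /=; ring.
rewrite big_split -mulr_sumr -big_mkcond /=; congr (_ * _ + _).
rewrite (bigD1 a) //= eqxx mul1r big1 ?addr0 // => k /negbTE->.
by rewrite mul0r.
Qed.

Lemma sum_next (a b : 'I_n) (F : 'I_n -> K) : next_in_block a b ->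
  \sum_(k | next_in_block a k) F k = F b.
Proof.
move=> ab; rewrite (bigD1 b) //= big1 ?addr0 // => k /andP[ak].
by rewrite (next_uniq ak ab) eqxx.
Qed.

Lemma tr_jordan : \tr (jordan_mx lam jb) = \sum_i lam i.
Proof. by apply: eq_bigr => i _; rewrite mxE eqxx. Qed.

Let tau := \sum_i lam i.

Section Invariant.
Variable C : 'M[K]_n.
Hypothesis Cinv : invariant_biv (jordan_mx lam jb) C.

(** Each of the two sums has at most one term: the entry of C that follows in its
    Jordan block in the row or in the column direction. *)
Lemma invariant_jordanE (a b : 'I_n) : (lam a + lam b - tau) * C a b
  + \sum_(k | next_in_block a k) C k b + \sum_(k | next_in_block b k) C a k = 0.
Proof.
have := congr1 (fun M : 'M_n => M a b) Cinv.
rewrite mxE tr_jordan -/tau jordan_mulE [X in _ = X]mxE.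
have -> : (C *m (jordan_mx lam jb)^T) a b = (jordan_mx lam jb *m C^T) b a.
  by rewrite !mxE; apply: eq_bigr => k _; rewrite !mxE mulrC.
rewrite jordan_mulE mxE.
under [X in _ + (_ + X) = _ -> _]eq_bigr do rewrite mxE.
by move=> h; apply/eqP; rewrite -subr_eq0 -[X in _ == X](subrr (tau * C a b)) -{1}h; apply/eqP; ring.
Qed.

(** Downward induction from the last entry of the rectangle of a pair of blocks:
    there the two sums are empty, and inside the rectangle they vanish by
    induction. *)
Lemma invariant_jordan_eigen (a b : 'I_n) : C a b != 0 -> lam a + lam b = tau.
Proof.
move=> Cab; apply/eqP; apply: contraNT Cab => ne0.
have jlam : forall i j, next_in_block i j -> lam j = lam i.
  by move=> i j /andP[_ /eqP]; case: jd => _ _; apply.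
move: {2}(2 * n - a - b)%N (leqnn (2 * n - a - b)) => d.
elim: d a b ne0 => [|d IH] a b ne0 hd.
  by have := ltn_ord a; have := ltn_ord b; lia.
have := invariant_jordanE a b; rewrite !big1 ?addr0.
- by move/eqP; rewrite mulf_eq0 subr_eq0 (negbTE ne0).
- move=> k bk; apply/eqP/IH; first by rewrite (jlam _ _ bk).
  by move: bk => /andP[/eqP /= h _]; have := ltn_ord k; lia.
- move=> k bk; apply/eqP/IH; first by rewrite (jlam _ _ bk).
  by move: bk => /andP[/eqP /= h _]; have := ltn_ord k; lia.
Qed.

(** Once the eigenvalues add up to the trace the recursion says that moving one step
    up and one step right changes only the sign, and that an entry which cannot move
    to the right is zero below the first row. *)
Lemma invariant_jordan_shift (a a' b : 'I_n) : next_in_block a a' -> C a' b != 0 ->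
  exists2 b', next_in_block b b' & C a b' != 0.
Proof.
move=> aa' Cab.
have e : lam a + lam b = tau.
  rewrite -(invariant_jordan_eigen Cab); congr (_ + _).
  by case: jd => _ _; apply; move: aa' => /andP[_ /eqP].
have := invariant_jordanE a b; rewrite e subrr mul0r add0r (sum_next _ aa').
case: (pickP (next_in_block b)) => [b' bb'|nob].
  rewrite (sum_next _ bb') => /eqP; rewrite addr_eq0 => /eqP h.
  by exists b' => //; apply: contraNneq Cab => h'; rewrite h h' oppr0.
by rewrite big_pred0 // addr0 => /eqP; rewrite (negbTE Cab).
Qed.

End Invariant.

Definition four_blocks := exists a b c d : 'I_n,
  [/\ uniq [:: jb a; jb b; jb c; jb d], lam a + lam b = tau & lam c + lam d = tau].

Definition two_long_blocks := exists a a' b b' : 'I_n,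
  [/\ next_in_block a a', next_in_block b b', jb a != jb b & lam a + lam b = tau].

Definition long_and_two_blocks := exists a a' c d : 'I_n,
  [/\ next_in_block a a', uniq [:: jb a; jb c; jb d], lam a + lam a = tau
    & lam c + lam d = tau].

Definition long4_block := exists a1 a2 a3 a4 : 'I_n,
  [/\ next_in_block a1 a2, next_in_block a2 a3, next_in_block a3 a4
    & lam a1 + lam a1 = tau].

(** These are the ways in which four-dimensional symplectic Jordan types fit into
    the given one: relative to half the trace, pairs of blocks have opposite
    eigenvalues, and a single block that is used twice has eigenvalue zero. *)
Definition block_pattern :=
  [\/ four_blocks, two_long_blocks, long_and_two_blocks | long4_block].

(** Two indices of one block whose distance is two give a zero entry by a shift onto
    the diagonal; at distance three or more the block has four elements. *)
Lemma nonzero_entry C (a b : 'I_n) : alt_mx C -> invariant_biv (jordan_mx lam jb) C ->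
  C a b != 0 -> (a < b)%N ->
  [\/ block_pattern, jb a != jb b | next_in_block a b].
Proof.
move=> [C0 Cskew] inv Cab ab; have e := invariant_jordan_eigen inv Cab.
case: (eqVneq (jb a) (jb b)) => [jab|]; last by constructor 2.
have la : lam a = lam b by case: jd => _ _; apply.
have nxt (x y : 'I_n) : (a <= x)%N -> (y <= b)%N -> y = x.+1 :> nat ->
    next_in_block x y.
  move=> ax yb yx; apply/andP; split; first by apply/eqP.
  apply/eqP; have xb : (x <= b)%N by move: yb; rewrite yx; lia.
  by rewrite (jb_between (a := a) (b := b)) ?(jb_between (a := a) (b := b) (c := x)) // yx; lia.
case: (ltnP b a.+2) => ab2.
  by constructor 3; apply: nxt => //; lia.
constructor 1; constructor 4.
have h1 : (a.+1 < n)%N by have := ltn_ord b; lia.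
pose a1 := Ordinal h1; have aa1 : next_in_block a a1 by apply: nxt.
have h2 : (a.+2 < n)%N by have := ltn_ord b; lia.
pose a2 := Ordinal h2; have a12 : next_in_block a1 a2 by apply: nxt.
have nab : C b a != 0 by rewrite Cskew oppr_eq0.
case: (ltnP b a.+3) => ab3; last first.
  have h3 : (a.+3 < n)%N by have := ltn_ord b; lia.
  exists a, a1, a2, (Ordinal h3); split => //; first by apply: nxt => //=; lia.
  by rewrite {2}la.
have ba2 : b = a2 by apply: val_inj => /=; lia.
have := invariant_jordan_shift (b := a) inv a12; rewrite -ba2 => /(_ nab) [x ax].
by rewrite (next_uniq ax aa1) C0 eqxx.
Qed.

(** A nonzero entry which is not in the first row of its block can be shifted up and
    right.  The two positions together give two long blocks, or a block of length
    four if both indices lie in the same block. *)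
Lemma entry_first C (a b : 'I_n) : alt_mx C -> invariant_biv (jordan_mx lam jb) C ->
  C a b != 0 -> jb a != jb b \/ next_in_block a b ->
  block_pattern \/ forall p, ~~ next_in_block p a.
Proof.
move=> altC inv Cab hab; have e := invariant_jordan_eigen inv Cab.
case: (pickP (next_in_block^~ a)) => [p pa|h]; last first.
  by right=> p; rewrite h.
left; have [b' bb' _] := invariant_jordan_shift inv pa Cab.
have jpa : jb p = jb a by move: pa => /andP[_ /eqP].
have lpa : lam p = lam a by case: jd => _ _; apply.
case: hab => [jab|ab].
  by constructor 2; exists p, a, b, b'; rewrite jpa lpa.
constructor 4; exists p, a, b, b'; split=> //.
rewrite {1}lpa -e; congr (_ + _); case: jd => _ _; apply.
by rewrite jpa; move: ab => /andP[_ /eqP].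
Qed.

Lemma first_eq (a c : 'I_n) : (forall p, ~~ next_in_block p a) ->
  (forall p, ~~ next_in_block p c) -> jb a = jb c -> a = c.
Proof.
move=> fa fc; wlog ac : a c fa fc / (a < c)%N.
  move=> W jac; apply: val_inj; case: (ltngtP a c) => // h.
    by rewrite (W a c fa fc h jac).
  by rewrite (W c a fc fa h (esym jac)).
move=> jac; have h1 : (c.-1 < n)%N by have := ltn_ord c; lia.
have /negP[] := fc (Ordinal h1); rewrite /next_in_block /=.
rewrite (jb_between (a := a) (b := c) (c := Ordinal h1)) //=; [|lia|lia].
by rewrite jac eqxx andbT; apply/eqP; lia.
Qed.

Lemma pf4_entries (C : 'M[K]_n) i j k l : alt_mx C -> pf4 C i j k l != 0 ->
  exists a b c d : 'I_n, [/\ uniq [:: a; b; c; d], C a b != 0, C c d != 0,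
    (a < b)%N & (c < d)%N].
Proof.
move=> [C0 Cs] h.
have u : uniq [:: i; j; k; l].
  rewrite /= !inE !negb_or !andbT.
  repeat (apply/andP; split); apply: contraNneq h => ->; rewrite /pf4 ?C0;
  apply/eqP.
  - by ring.
  - by rewrite (Cs l k) ?(Cs j l) ?(Cs j k) ; rewrite (Cs k j); ring.
  - by rewrite (Cs k l) (Cs l j); ring.
  - by ring.
  - by rewrite (Cs k l); ring.
  - by ring.
(* Each of the three products of entries in the Pfaffian involves all four
   indices. *)
have gen a b c d : uniq [:: a; b; c; d] -> C a b * C c d != 0 ->
  exists a b c d : 'I_n, [/\ uniq [:: a; b; c; d], C a b != 0, C c d != 0,
    (a < b)%N & (c < d)%N].
  rewrite mulf_eq0 negb_or => U /andP[ab cd].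
  have {ab} : exists a' b' : 'I_n, [/\ (a' < b')%N, C a' b' != 0 & perm_eq [:: a'; b'] [:: a; b]].
    case: (ltngtP a b) => e; first by exists a, b.
      by exists b, a; split=> //; [rewrite Cs oppr_eq0 | rewrite (perm_catC [:: b] [:: a])].
    by move: U; rewrite /= (val_inj e) inE eqxx.
  have {cd} : exists a' b' : 'I_n, [/\ (a' < b')%N, C a' b' != 0 & perm_eq [:: a'; b'] [:: c; d]].
    case: (ltngtP c d) => e; first by exists c, d.
      by exists d, c; split=> //; [rewrite Cs oppr_eq0 | rewrite (perm_catC [:: d] [:: c])].
    by move: U; rewrite /= (val_inj e) !inE eqxx !andbF.
  move=> [c' [d' [cd' Cc pc]]] [a' [b' [ab' Ca pa]]].
  exists a', b', c', d'; split=> //.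
  by rewrite (perm_uniq (perm_cat pa pc)).
move: h; rewrite /pf4; case: (eqVneq (C i j * C k l) 0) => [->|]; last by move=> h _; apply: gen h.
case: (eqVneq (C i k * C j l) 0) => [->|]; last first.
  move=> h _; apply: gen h; move: u; rewrite /= !inE !negb_or (eq_sym k j);
  by move: (i == j) (i == k) (i == l) (j == k) (j == l) (k == l) => [] [] [] [] [] [].
rewrite subr0 add0r; apply: gen; move: u; rewrite /= !inE !negb_or (eq_sym l j) (eq_sym l k).
by move: (i == j) (i == k) (i == l) (j == k) (j == l) (k == l) => [] [] [] [] [] [].
Qed.

(** Induction on the first index: as long as an element precedes the chain, that
    element is added in front and the last one is dropped. *)
Lemma first_chain (a : 'I_n) r : path next_in_block a r ->
  exists a' r', [/\ path next_in_block a' r', size r' = size r, jb a' = jb a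
    & forall p, ~~ next_in_block p a'].
Proof.
move: {2}(nat_of_ord a) (erefl (nat_of_ord a)) => m.
elim/ltn_ind: m a r => m IH a r am ar.
case: (pickP (next_in_block^~ a)) => [p pa|h]; last first.
  by exists a, r; split=> // p; rewrite h.
have pm : (p < m)%N by move: pa => /andP[/eqP /=]; lia.
have pth : path next_in_block p (belast a r).
  elim: r a {am} p ar pa {IH pm} => [|x r IHr] a p //= /andP[ax xr] pa.
  by rewrite pa; apply: IHr.
have [a' [r' [h1 h2 h3 h4]]] := IH p pm p (belast a r) erefl pth.
exists a', r'; split=> //; first by rewrite h2 size_belast.
by rewrite h3; move: pa => /andP[_ /eqP].
Qed.

Definition ecol (a : 'I_n) : 'cV[K]_n := delta_mx a 0.

Lemma jordan_ecol_first (a : 'I_n) : (forall p, ~~ next_in_block p a) ->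
  jordan_mx lam jb *m ecol a = lam a *: ecol a.
Proof.
move=> fa; apply/matrixP=> i j; rewrite jordan_mulE !mxE [j]ord1 eqxx andbT.
rewrite big1 ?addr0; first by case: eqP => [->|]; rewrite ?mulr0.
by move=> k ik; rewrite mxE; case: eqP => // ka; move: (fa i); rewrite -ka ik.
Qed.

Lemma jordan_ecol_next (a b : 'I_n) : next_in_block a b ->
  jordan_mx lam jb *m ecol b = lam b *: ecol b + ecol a.
Proof.
move=> ab; apply/matrixP=> i j; rewrite jordan_mulE !mxE [j]ord1 !eqxx !andbT.
congr (_ + _); first by case: eqP => [->|]; rewrite ?mulr0.
case: eqP => [->|ia]; first by rewrite (sum_next _ ab) mxE !eqxx.
rewrite big1 // => k ik; rewrite mxE; case: eqP => // kb; case: ia.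
move: ik ab; rewrite kb => /andP[/eqP /= h _] /andP[/eqP /= h' _].
by apply: val_inj => /=; lia.
Qed.

Lemma mul_biv (F : 'M[K]_n) p q :
  F *m biv p q + biv p q *m F^T = biv (F *m p) q + biv p (F *m q).
Proof.
rewrite /biv mulmxBr mulmxBl !trmx_mul !mulmxA.
by rewrite addrACA [RHS]addrACA; congr (_ + _); rewrite addrC.
Qed.

Lemma biv_scalel a p q : biv (a *: p) q = a *: biv p q :> 'M[K]_n.
Proof. by rewrite /biv linearZ /= -!scalemxAr -!scalemxAl scalerBr. Qed.

Lemma biv_scaler a p q : biv p (a *: q) = a *: biv p q :> 'M[K]_n.
Proof. by rewrite /biv linearZ /= -!scalemxAr -!scalemxAl scalerBr. Qed.

Lemma biv_addr p q q' : biv p (q + q') = biv p q + biv p q' :> 'M[K]_n.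
Proof. by apply/matrixP=> i j; rewrite [RHS]mxE !bivE !mxE; ring. Qed.

Lemma invariant_bivD F (B C : 'M[K]_n) : invariant_biv F B -> invariant_biv F C -> invariant_biv F (B + C).
Proof.
by move=> hB hC; rewrite /invariant_biv mulmxDr mulmxDl addrACA hB hC scalerDr.
Qed.

Let Jm := jordan_mx lam jb.

(** Both columns are eigenvectors, so the derivation only multiplies their product
    by the sum of the eigenvalues.  In the next lemmas the nilpotent part
    contributes terms that cancel. *)
Lemma invariant_biv_first (a b : 'I_n) : (forall p, ~~ next_in_block p a) ->
  (forall p, ~~ next_in_block p b) -> lam a + lam b = tau ->
  invariant_biv Jm (biv (ecol a) (ecol b)).
Proof.
move=> fa fb e; rewrite /invariant_biv mul_biv tr_jordan -/tau.
by rewrite (jordan_ecol_first fa) (jordan_ecol_first fb) biv_scalel biv_scaler -scalerDl e.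
Qed.

Lemma invariant_biv_next (a b : 'I_n) : (forall p, ~~ next_in_block p a) ->
  next_in_block a b -> lam a + lam b = tau ->
  invariant_biv Jm (biv (ecol a) (ecol b)).
Proof.
move=> fa ab e; rewrite /invariant_biv mul_biv tr_jordan -/tau.
rewrite (jordan_ecol_first fa) (jordan_ecol_next ab) biv_scalel biv_addr biv_scaler.
by rewrite [X in _ + (_ + X)](_ : _ = 0) ?addr0 -?scalerDl ?e // /biv subrr.
Qed.

Lemma invariant_biv_cross (a a' b b' : 'I_n) : (forall p, ~~ next_in_block p a) ->
  (forall p, ~~ next_in_block p b) -> next_in_block a a' -> next_in_block b b' ->
  lam a + lam b = tau ->
  invariant_biv Jm (biv (ecol a) (ecol b') + biv (ecol b) (ecol a')).
Proof.
move=> fa fb aa bb e.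
have la : lam a' = lam a by case: jd => _ _; apply; move: aa => /andP[_ /eqP].
have lb : lam b' = lam b by case: jd => _ _; apply; move: bb => /andP[_ /eqP].
rewrite /invariant_biv mulmxDr mulmxDl addrACA !mul_biv tr_jordan -/tau.
rewrite (jordan_ecol_first fa) (jordan_ecol_first fb) (jordan_ecol_next aa) (jordan_ecol_next bb).
rewrite la lb -e; apply/matrixP=> i j; rewrite !mxE /= !big_ord1 !mxE.
by ring.
Qed.

Lemma invariant_biv_four (a1 a2 a3 a4 : 'I_n) : (forall p, ~~ next_in_block p a1) ->
  next_in_block a1 a2 -> next_in_block a2 a3 -> next_in_block a3 a4 ->
  lam a1 + lam a1 = tau ->
  invariant_biv Jm (biv (ecol a1) (ecol a4) + biv (ecol a3) (ecol a2)).
Proof.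
move=> fa a12 a23 a34 e.
have ln a b : next_in_block a b -> lam b = lam a.
  by move=> /andP[_ /eqP]; case: jd => _ _; apply.
rewrite /invariant_biv mulmxDr mulmxDl addrACA !mul_biv tr_jordan -/tau.
rewrite (jordan_ecol_first fa) (jordan_ecol_next a12) (jordan_ecol_next a23).
rewrite (jordan_ecol_next a34) (ln _ _ a34) (ln _ _ a23) (ln _ _ a12) -e.
apply/matrixP=> i j; rewrite !mxE /= !big_ord1 !mxE.
by ring.
Qed.

Definition two_biv (B : 'M[K]_n) : Prop := exists p1 q1 p2 q2, B = biv p1 q1 + biv p2 q2.

(** The sub-Pfaffian of this sum on a, b, c, d is one. *)
Lemma two_ecol (a b c d : 'I_n) : uniq [:: a; b; c; d] ->
  invariant_biv Jm (biv (ecol a) (ecol b) + biv (ecol c) (ecol d)) ->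
  exists2 C, two_biv C & invariant_biv Jm C /\ rank_ge4 C.
Proof.
rewrite /= !inE !negb_or => /and4P[/and3P[nab nac nad] /andP[nbc nbd] ncd _] h.
exists (biv (ecol a) (ecol b) + biv (ecol c) (ecol d)); first by exists (ecol a), (ecol b), (ecol c), (ecol d).
split=> //; apply/rank_ge4P; exists a, b, c, d.
rewrite /pf4 !mxE !big_ord1 !mxE !eqxx /= !andbT.
rewrite !(eq_sym b a, eq_sym c a, eq_sym d a, eq_sym c b, eq_sym d b, eq_sym d c).
rewrite !(negbTE nab, negbTE nac, negbTE nad, negbTE nbc, negbTE nbd, negbTE ncd).
by rewrite [X in X != 0](_ : _ = 1) ?oner_eq0 //= ; ring.
Qed.

(** The solutions are products of vectors at the beginning of the blocks: with e, f,
    h, k standing for the basis vectors of distinct blocks, e1 ^ f1 + h1 ^ k1, then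
    e1 ^ f2 + f1 ^ e2, then e1 ^ e2 + f1 ^ h1, and e1 ^ e4 + e3 ^ e2 inside one
    block. *)
Lemma pattern_rank4 : block_pattern ->
  exists2 C, two_biv C & invariant_biv Jm C /\ rank_ge4 C.
Proof.
have ln x y : next_in_block x y -> lam y = lam x.
  by move=> /andP[_ /eqP]; case: jd => _ _; apply.
have ja a b : jb a = jb b -> lam a = lam b by case: jd => _ _; apply.
have first1 a : exists a', jb a' = jb a /\ forall p, ~~ next_in_block p a'.
  by have [//|a' [r [_ _ h1 h2]]] := @first_chain a [::]; exists a'.
have first2 a b : next_in_block a b -> exists a' b', [/\ next_in_block a' b',
    jb a' = jb a & forall p, ~~ next_in_block p a'].
  move=> ab; have ar : path next_in_block a [:: b] by rewrite /= ab.
  have [a' [r [+ + h2 h3]]] := first_chain ar.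
  case: r => [|b' [|? ?]] //=; rewrite andbT => h1 _.
  by exists a', b'.
have nneq a b : next_in_block a b -> a != b.
  by move=> /andP[/eqP h _]; apply/eqP => e; move: h; rewrite e /=; lia.
have jne a b : jb a != jb b -> a != b by apply: contraNneq => ->.
have jnx a b : next_in_block a b -> jb b = jb a by move=> /andP[_ /eqP].
case.
- move=> [a [b [c [d [U e1 e2]]]]].
  have [a' [ha fa]] := first1 a; have [b' [hb fb]] := first1 b.
  have [c' [hc fc]] := first1 c; have [d' [hd fd]] := first1 d.
  apply: (@two_ecol a' b' c' d').
    move: U; rewrite -ha -hb -hc -hd; apply: (@map_uniq _ _ jb [:: _; _; _; _]).
  by apply: invariant_bivD; apply: invariant_biv_first => //; rewrite (ja _ _ ha, ja _ _ hc) (ja _ _ hb, ja _ _ hd).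
- move=> [a [a1 [b [b1 [/first2[a' [a1' [aa ha fa]]] /first2[b' [b1' [bb hb fb]]] jab e]]]]].
  apply: (@two_ecol a' b1' b' a1'); last first.
    by apply: invariant_biv_cross => //; rewrite (ja _ _ ha) (ja _ _ hb).
  have hja : jb a' != jb b' by rewrite ha hb.
  have hjb : jb b' != jb a' by rewrite eq_sym.
  rewrite /= !inE !negb_or (nneq _ _ aa) (eq_sym b1') (nneq _ _ bb) !jne //;
    by rewrite ?(jnx _ _ aa) ?(jnx _ _ bb).
- move=> [a [a1 [c [d [/first2[a' [a1' [aa ha fa]]] U e1 e2]]]]].
  have [c' [hc fc]] := first1 c; have [d' [hd fd]] := first1 d.
  move: U; rewrite -ha -hc -hd /= !inE !negb_or => /and3P[/andP[h1 h2] h3 _].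
  apply: (@two_ecol a' a1' c' d').
    by rewrite /= !inE !negb_or (nneq _ _ aa) !jne // (jnx _ _ aa).
  apply: invariant_bivD; first by apply: invariant_biv_next => //; rewrite (ln _ _ aa) (ja _ _ ha).
  by apply: invariant_biv_first => //; rewrite (ja _ _ hc) (ja _ _ hd).
move=> [a1 [a2 [a3 [a4 [h1 h2 h3 e]]]]].
have ar : path next_in_block a1 [:: a2; a3; a4] by rewrite /= h1 h2 h3.
have [b1 [r [+ + hj fb]]] := first_chain ar.
case: r => [|b2 [|b3 [|b4 [|? ?]]]] //= /and4P[k1 k2 k3 _] _.
apply: (@two_ecol b1 b4 b3 b2); last first.
  by apply: invariant_biv_four => //; rewrite (ja _ _ hj).
move: k1 k2 k3 => /andP[/eqP /= v1 _] /andP[/eqP /= v2 _] /andP[/eqP /= v3 _].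
rewrite /= !inE !negb_or -!(inj_eq val_inj) /=; lia.
Qed.

Hypothesis two_neq0 : (2%:R : K) != 0.

(** A nonvanishing sub-Pfaffian gives two disjoint nonzero entries.  Outside the
    patterns each of them joins the first elements of two blocks, or the first two
    elements of one block, so the two entries together form a pattern. *)
Lemma rank_ge4_pattern C : alt_mx C -> invariant_biv (jordan_mx lam jb) C ->
  rank_ge4 C -> block_pattern.
Proof.
move=> altC inv /rank_ge4P[i [j [k [l h]]]].
have [a [b [c [d [U Cab Ccd ab cd]]]]] := pf4_entries altC h.
have [C0 Cs] := altC.
have Cba : C b a != 0 by rewrite Cs oppr_eq0.
have Cdc : C d c != 0 by rewrite Cs oppr_eq0.
have eab := invariant_jordan_eigen inv Cab; have ecd := invariant_jordan_eigen inv Ccd.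
have lamE x y : next_in_block x y -> lam y = lam x.
  by move=> /andP[_ /eqP]; case: jd => _ _; apply.
move: U; rewrite /= !inE !negb_or => /and4P[/and3P[nab nac nad] /andP[nbc nbd] ncd _].
have neq x y : (forall p, ~~ next_in_block p x) ->
  (forall p, ~~ next_in_block p y) -> x != y -> jb x != jb y.
  by move=> fx fy; apply: contraNneq => /(first_eq fx fy)->.
have [//|jab|sab] := nonzero_entry altC inv Cab ab;
have [//|jcd|scd] := nonzero_entry altC inv Ccd cd.
- have jba : jb b != jb a by rewrite eq_sym.
  have jdc : jb d != jb c by rewrite eq_sym.
  have [//|fa] := entry_first altC inv Cab (or_introl jab).
  have [//|fb] := entry_first altC inv Cba (or_introl jba).
  have [//|fc] := entry_first altC inv Ccd (or_introl jcd).
  have [//|fd] := entry_first altC inv Cdc (or_introl jdc).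
  constructor 1; exists a, b, c, d; split=> //.
  by rewrite /= !inE !negb_or !neq ?andbT //.
- have jba : jb b != jb a by rewrite eq_sym.
  have [//|fa] := entry_first altC inv Cab (or_introl jab).
  have [//|fb] := entry_first altC inv Cba (or_introl jba).
  have [//|fc] := entry_first altC inv Ccd (or_intror scd).
  constructor 3; exists c, d, a, b; split=> //.
    by rewrite /= !inE !negb_or !neq // eq_sym.
  by rewrite -{2}(lamE _ _ scd).
- have jdc : jb d != jb c by rewrite eq_sym.
  have [//|fa] := entry_first altC inv Cab (or_intror sab).
  have [//|fc] := entry_first altC inv Ccd (or_introl jcd).
  have [//|fd] := entry_first altC inv Cdc (or_introl jdc).
  constructor 3; exists a, b, c, d; split=> //.
    by rewrite /= !inE !negb_or !neq ?andbT //.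
  by rewrite -{2}(lamE _ _ sab).
have [//|fa] := entry_first altC inv Cab (or_intror sab).
have [//|fc] := entry_first altC inv Ccd (or_intror scd).
constructor 2; exists a, b, c, d; split; rewrite ?neq //.
move: eab ecd; rewrite (lamE _ _ sab) (lamE _ _ scd) => e1 e2.
have dbl x : lam x + lam x = 2%:R * lam x by ring.
by apply: (mulfI two_neq0); rewrite mulrDr -!dbl e1 e2; ring.
Qed.

End JordanBlocks.

(** * Block patterns and partitions of the eigenvalues *)

Section Partition.
Variables (K : fieldType) (lam : 'I_6 -> K) (jb : 'I_6 -> nat).
Hypothesis jd : jordan_data lam jb.
Hypothesis two_neq0 : (2%:R : K) != 0.

Let tau := \sum_i lam i.

(** The partition condition for the sets {a, b} and {c, d}.  As all eigenvalues sum
    to tau, the sum over the third set is - tau, and its negative half is tau / 2.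
    The equalities of eigenvalues in the third condition follow from those of the
    block numbers. *)
Record good_pairs (a b c d : 'I_6) : Prop := GoodPairs {
  good_uniq : uniq [:: a; b; c; d];
  good_ab : lam a + lam b = tau;
  good_cd : lam c + lam d = tau;
  good_cross : forall x x' y y', [set x; x'] = [set a; b] ->
    [set y; y'] = [set c; d] -> jb x = jb y ->
    lam x + lam x = tau \/ jb x' = jb y';
  good_three : jb a = jb b /\ (jb c = jb a \/ jb d = jb a) \/
               jb c = jb d /\ (jb a = jb c \/ jb b = jb c) ->
    jb a = jb b /\ jb b = jb c /\ jb c = jb d }.

Lemma pattern_good : block_pattern lam jb -> exists a b c d, good_pairs a b c d.
Proof.
have lamE x y : jb x = jb y -> lam x = lam y by case: jd => _ _; apply.
have nx x y : next_in_block jb x y -> jb y = jb x /\ x != y.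
  by move=> /andP[/eqP h1 /eqP h2]; split=> //; apply/eqP => e; move: h1; rewrite e /=; lia.
have jne x y : jb x != jb y -> x != y by apply: contraNneq => ->.
have set2E (x x' y y' : 'I_6) : [set x; x'] = [set y; y'] ->
    (x = y \/ x = y') /\ (x' = y \/ x' = y') /\ (y = x \/ y = x') /\ (y' = x \/ y' = x').
  move=> /setP h; do ?split.
  - by move: (h x); rewrite !inE eqxx => /esym/orP[/eqP|/eqP]; auto.
  - by move: (h x'); rewrite !inE eqxx orbT => /esym/orP[/eqP|/eqP]; auto.
  - by move: (h y); rewrite !inE eqxx => /orP[/eqP|/eqP]; auto.
  - by move: (h y'); rewrite !inE eqxx orbT => /orP[/eqP|/eqP]; auto.
case.
- move=> [a [b [c [d [U e1 e2]]]]]; exists a, b, c, d.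
  have U' := U; move: U'; rewrite /= !inE !negb_or => /and4P[/and3P[]/eqP h1/eqP h2/eqP h3 /andP[/eqP h4 /eqP h5] /eqP h6 _].
  split=> //.
  + exact: (@map_uniq _ _ jb [:: _; _; _; _]).
  + by move=> x x' y y' /set2E[[->|->] _] /set2E[[->|->] _].
  + by move=> [[]|[]].
- move=> [a [a' [b [b' [/nx[ja na] /nx[jb' nb] jab e]]]]]; exists a, b, a', b'.
  have jba : jb b != jb a by rewrite eq_sym.
  split=> //.
  + by rewrite /= !inE !negb_or na nb !jne ?ja ?jb'.
  + by rewrite (lamE _ _ ja) (lamE _ _ jb').
  + move: jab => /eqP jab x x' y y' /set2E[X1 [X2 [X3 X4]]] /set2E[Y1 [Y2 [Y3 Y4]]] h.
    right; case: X1 => ?; subst x; case: Y1 => ?; subst y; try congruence;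
    case: X4 X3 => ? [] ?; case: Y4 Y3 => ? [] ?; subst; congruence.
  + by move: jab => /eqP jab [[]|[]]; congruence.
- move=> [a [a' [c [d [/nx[ja na] U e1 e2]]]]]; exists a, a', c, d.
  move: U; rewrite /= !inE !negb_or => /and3P[/andP[h1 h2] h3 _].
  split=> //.
  + by rewrite /= !inE !negb_or na !jne ?ja.
  + by rewrite (lamE _ _ ja).
  + by move: h1 h2 => /eqP h1 /eqP h2 x x' y y' /set2E[[->|->] _] /set2E[[->|->] _]; congruence.
  + by move: h1 h2 h3 => /eqP h1 /eqP h2 /eqP h3 [[? []]|[]]; congruence.
move=> [a [b [c [d [ab bc cd e]]]]].
have U : uniq [:: a; b; c; d].
  move: ab bc cd => /andP[/eqP /= v1 _] /andP[/eqP /= v2 _] /andP[/eqP /= v3 _].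
  by rewrite /= !inE !negb_or -!(inj_eq val_inj) /=; lia.
move: ab bc cd => /nx[jab _] /nx[jbc _] /nx[jcd _].
have jall x : x \in [:: a; b; c; d] -> jb x = jb a.
  by rewrite !inE => /or4P[] /eqP->; congruence.
exists a, b, c, d; split=> //.
- by rewrite (lamE b a).
- by rewrite (lamE c a) ?(lamE d a) //; congruence.
- by move=> x x' y y' /set2E[_ [X _]] /set2E[_ [Y _]] _; right; case: X => ->; case: Y => ->; congruence.
Qed.

Lemma block_pair (a b : 'I_6) : a != b -> jb a = jb b ->
  exists a1 a2, next_in_block jb a1 a2 /\ jb a1 = jb a.
Proof.
wlog : a b / (a < b)%N.
  move=> W ab e; case: (ltngtP a b) => h; first exact: (W a b h).
    have [|a1 [a2 [h1 h2]]] := W b a h _ (esym e); first by rewrite eq_sym.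
    by exists a1, a2; rewrite e.
  by rewrite (val_inj h) eqxx in ab.
move=> ab _ e; have h1 : (a.+1 < 6)%N by have := ltn_ord b; lia.
exists a, (Ordinal h1); split=> //; rewrite /next_in_block eqxx /=.
by apply/eqP; apply: (jb_between jd (b := b)) => //=; lia.
Qed.

(** Four distinct elements of a Jordan block, which is an interval, include two at
    distance at least three. *)
Lemma block_quad (a b c d : 'I_6) : uniq [:: a; b; c; d] -> jb b = jb a ->
  jb c = jb a -> jb d = jb a -> lam a + lam a = tau -> long4_block lam jb.
Proof.
move=> U jb1 jc jd1 e.
have [x [y [xy jx jy]]] : exists x y : 'I_6, [/\ (x + 3 <= y)%N, jb x = jb a & jb y = jb a].
  move: U; rewrite /= !inE !negb_or -!(inj_eq val_inj) /= => U.
  have : [|| a + 3 <= b, b + 3 <= a, a + 3 <= c, c + 3 <= a, a + 3 <= d, d + 3 <= a,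
     b + 3 <= c, c + 3 <= b, b + 3 <= d, d + 3 <= b, c + 3 <= d | d + 3 <= c]%N by lia.
  case/or4P => [h|h|h|]; [by exists a, b|by exists b, a|by exists a, c|].
  case/or4P => [h|h|h|]; [by exists c, a|by exists a, d|by exists d, a|].
  case/or4P => [h|h|h|]; [by exists b, c; rewrite jb1|by exists c, b; rewrite jc|by exists b, d; rewrite jb1|].
  by case/or3P => [h|h|h]; [exists d, b; rewrite jd1|exists c, d; rewrite jc|exists d, c; rewrite jd1].
have hy := ltn_ord y.
have h1 : (x.+1 < 6)%N by lia.
have h2 : (x.+2 < 6)%N by lia.
have h3 : (x.+3 < 6)%N by lia.
have btw (z : 'I_6) : (x <= z)%N -> (z <= y)%N -> jb z = jb x.
  by move=> ? ?; apply: (jb_between jd (b := y)) => //; rewrite jx jy.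
have b1 := btw (Ordinal h1) ltac:(rewrite /=; lia) ltac:(rewrite /=; lia).
have b2 := btw (Ordinal h2) ltac:(rewrite /=; lia) ltac:(rewrite /=; lia).
have b3 := btw (Ordinal h3) ltac:(rewrite /=; lia) ltac:(rewrite /=; lia).
exists x, (Ordinal h1), (Ordinal h2), (Ordinal h3).
rewrite /next_in_block b1 b2 b3 !eqxx; split=> //.
by rewrite -/tau -e; congr (_ + _); case: jd => _ _; apply.
Qed.

(** If neither pair lies in one block, the pattern is decided by a single
    coincidence of blocks between the two pairs, treated once for all four
    choices. *)
Lemma good_pattern a b c d : good_pairs a b c d -> block_pattern lam jb.
Proof.
move=> [U e1 e2 cross three].
have lamE x y : jb x = jb y -> lam x = lam y by case: jd => _ _; apply.
have dbl x y : lam x + lam x = tau -> lam y + lam y = tau -> lam x = lam y.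
  move=> h1 h2; apply: (mulfI two_neq0).
  have D z : 2%:R * lam z = lam z + lam z by ring.
  by rewrite !D h1 h2.
have dbl2 x y : lam x = lam y -> lam x + lam y = tau -> lam x + lam x = tau by move=> h; rewrite -h.
have U' := U; move: U'; rewrite /= !inE !negb_or.
move=> /and4P[/and3P[nab nac nad] /andP[nbc nbd] ncd _].
case: (eqVneq (jb a) (jb b)) => [jab|jab].
  have la : lam a + lam a = tau by apply: (dbl2 _ b) => //; apply: lamE.
  case: (eqVneq (jb a) (jb c)) => [jac|jac].
    have [//|_ [jbc jcd]] := three; first by left; split=> //; left.
    by constructor 4; apply: (block_quad (a := a) (b := b) (c := c) (d := d)) => //; congruence.
  case: (eqVneq (jb a) (jb d)) => [jad|jad].
    have [//|_ [jbc jcd]] := three; first by left; split=> //; right.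
    by rewrite jab jbc eqxx in jac.
  case: (eqVneq (jb c) (jb d)) => [jcd|jcd].
    have lc : lam c + lam c = tau by apply: (dbl2 _ d) => //; apply: lamE.
    have [a1 [a2 [h1 h2]]] := block_pair nab jab.
    have [c1 [c2 [h3 h4]]] := block_pair ncd jcd.
    constructor 2; exists a1, a2, c1, c2; split=> //; first by rewrite h2 h4.
    by rewrite (lamE _ _ h2) (lamE _ _ h4) -(dbl a c).
  have [a1 [a2 [h1 h2]]] := block_pair nab jab.
  constructor 3; exists a1, a2, c, d; split=> //; last by rewrite (lamE _ _ h2).
  by rewrite h2 /= !inE !negb_or jac jad jcd.
case: (eqVneq (jb c) (jb d)) => [jcd|jcd].
  have lc : lam c + lam c = tau by apply: (dbl2 _ d) => //; apply: lamE.
  have jca : jb c != jb a.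
    apply/eqP => h; have [|h1 _] := three; first by right; split=> //; left.
    by rewrite h1 eqxx in jab.
  have jcb : jb c != jb b.
    apply/eqP => h; have [|h1 _] := three; first by right; split=> //; right.
    by rewrite h1 eqxx in jab.
  have [c1 [c2 [h3 h4]]] := block_pair ncd jcd.
  constructor 3; exists c1, c2, a, b; split=> //; last by rewrite (lamE _ _ h4).
  by rewrite h4 /= !inE !negb_or jca jcb jab.
(* If x and y share a block but neither pair does, then either their partners
   share a block as well, or all four eigenvalues are tau / 2. *)
have one x x' y y' : [set x; x'] = [set a; b] -> [set y; y'] = [set c; d] ->
    lam x + lam x' = tau -> lam y + lam y' = tau ->
    x != y -> x' != y' -> jb x != jb x' -> jb y != jb y' ->
    jb x = jb y -> block_pattern lam jb.
  move=> Ex Ey ex ey nx ny jx jy jxy.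
  have [a1 [a2 [h1 h2]]] := block_pair nx jxy.
  case: (eqVneq (jb x') (jb y')) => [jxy'|jxy'].
    have [b1 [b2 [h3 h4]]] := block_pair ny jxy'.
    constructor 2; exists a1, a2, b1, b2; split=> //; first by rewrite h2 h4.
    by rewrite (lamE _ _ h2) (lamE _ _ h4).
  have [lx|/eqP] := cross _ _ _ _ Ex Ey jxy; last by rewrite (negbTE jxy').
  have lx' : lam x' = lam x by apply: (addrI (lam x)); rewrite ex lx.
  have ly' : lam y' = lam x by apply: (addrI (lam y)); rewrite ey -(lamE _ _ jxy) lx.
  constructor 3; exists a1, a2, x', y'; split.
  - by [].
  - by rewrite h2 /= !inE !negb_or jx jxy' jxy jy.
  - by rewrite (lamE _ _ h2).
  - by rewrite lx' ly'.
have jba : jb b != jb a by rewrite eq_sym.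
have jdc : jb d != jb c by rewrite eq_sym.
have e1' : lam b + lam a = tau by rewrite addrC.
have e2' : lam d + lam c = tau by rewrite addrC.
have sba : [set b; a] = [set a; b] by rewrite setUC.
have sdc : [set d; c] = [set c; d] by rewrite setUC.
case: (eqVneq (jb a) (jb c)) => [h|jac]; first exact: (one a b c d).
case: (eqVneq (jb a) (jb d)) => [h|jad]; first exact: (one a b d c).
case: (eqVneq (jb b) (jb c)) => [h|jbc]; first exact: (one b a c d).
case: (eqVneq (jb b) (jb d)) => [h|jbd]; first exact: (one b a d c).
constructor 1; exists a, b, c, d; split=> //.
by rewrite /= !inE !negb_or jab jac jad jbc jbd jcd.
Qed.

End Partition.

Section PartitionPattern.
Variables (K : fieldType) (lam : 'I_6 -> K) (jb : 'I_6 -> nat).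
Hypothesis jd : jordan_data lam jb.
Hypothesis two_neq0 : (2%:R : K) != 0.

Let tau := \sum_i lam i.

Lemma cover3 (T : finType) (A B C : {set T}) : cover [set A; B; C] = A :|: B :|: C.
Proof. by rewrite /cover !bigcup_setU !big_set1. Qed.

Lemma partition3P (A B C : {set 'I_6}) : #|A| = 2%N -> #|B| = 2%N -> #|C| = 2%N ->
  partition [set A; B; C] [set: 'I_6] <-> [disjoint A & B] /\ C = ~: (A :|: B).
Proof.
move=> cA cB cC; split.
  case/and3P => /eqP; rewrite cover3 => cov _ _.
  have c6 : #|A :|: B :|: C| = 6 by rewrite cov cardsT card_ord.
  have := leq_card_setU (A :|: B) C; have := leq_card_setU A B.
  rewrite cA cB cC c6 => -[l1 /esym e1] [l2 /esym e2].
  have c4 : #|A :|: B| = 4%N by lia.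
  move: e1 e2; rewrite c4 /= => dAB dC; split; first by rewrite dAB.
  apply/eqP; rewrite eqEcard cC cardsCs setCK c4 card_ord leqnn andbT.
  by rewrite subsets_disjoint setCK disjoint_sym dC.
move=> [dAB EC]; rewrite {1}EC; apply/and3P; split.
- by rewrite cover3 setUCr eqxx.
- have dAC : [disjoint A & ~: (A :|: B)] by rewrite disjoints_subset setCK subsetUl.
  have dBC : [disjoint B & ~: (A :|: B)] by rewrite disjoints_subset setCK subsetUr.
  apply/trivIsetP => X Y; rewrite !inE => /orP[/orP[]|] /eqP-> /orP[/orP[]|] /eqP->;
  by rewrite ?eqxx // disjoint_sym.
- apply/negP; rewrite -EC !inE => /orP[/orP[]|] /eqP E.
  + by move: cA; rewrite -E cards0.
  + by move: cB; rewrite -E cards0.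
  + by move: cC; rewrite -E cards0.
Qed.

Lemma partition_sums (A B : {set 'I_6}) : [disjoint A & B] ->
  tau = \sum_(i in A) lam i + \sum_(i in B) lam i + \sum_(i in ~: (A :|: B)) lam i.
Proof.
move=> dAB; rewrite -bigU //= /tau (bigID (mem (A :|: B))) /=; congr (_ + _).
  by apply: eq_bigl => i; rewrite !inE.
by apply: eq_bigl => i; rewrite !inE.
Qed.

Lemma half_tau (x t : K) : t = - tau -> (x = - (t / 2)) <-> (x + x = tau).
Proof.
move=> ->; rewrite mulNr opprK; split=> [->|<-]; first by field.
by field.
Qed.

Lemma jordan_partition_pattern :
  (exists I1 I2 I3 : {set 'I_6},
          [/\ partition [set I1; I2; I3] [set: 'I_6],
              [/\ #|I1| = 2%N, #|I2| = 2%N & #|I3| = 2%N] &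
              jordan_partition lam jb I1 I2 I3]) <-> block_pattern lam jb.
Proof.
have lamE x y : jb x = jb y -> lam x = lam y by case: jd => _ _; apply.
split.
  move=> [I1 [I2 [I3 [P [c1 c2 c3] [[s1 s2] ii iii]]]]].
  have [d12 E3] := (partition3P c1 c2 c3).1 P.
  have st := partition_sums d12; rewrite -E3 in st.
  have t3 : \sum_(i in I3) lam i = - tau.
    by rewrite st s1 s2; ring.
  have /cards2P[a [b [nab E1]]] : #|I1| == 2%N by rewrite c1.
  have /cards2P[c [d [ncd E2]]] : #|I2| == 2%N by rewrite c2.
  have ab : lam a + lam b = tau.
    by rewrite -[tau]opprK -t3 -s2 -s1 E1 big_setU1 ?inE //= big_set1.
  have cd : lam c + lam d = tau.
    by rewrite -[tau]opprK -t3 -s2 E2 big_setU1 ?inE //= big_set1.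
  apply: (good_pattern jd two_neq0 (a := a) (b := b) (c := c) (d := d)).
  split=> //.
  - move: d12; rewrite E1 E2 disjoints_subset => /subsetP h.
    have := h a; have := h b; rewrite !inE !eqxx orbT => /(_ isT) hb /(_ isT) ha.
    by rewrite /= !inE !negb_or nab ncd -!negb_or ha hb.
  - move=> x x' y y'; rewrite -E1 -E2 => F1 F2 xy.
    have xI : x \in I1 by rewrite -F1 !inE eqxx.
    have yI : y \in I2 by rewrite -F2 !inE eqxx.
    have [[h1 h2]|h] := ii x y xI yI xy; last by right; apply: h.
    by left; apply/(half_tau _ t3); rewrite h1.
  - move=> h; have [|_ h2] := iii.
      case: h => -[h [h'|h']].
      + by left; exists c; [by rewrite E2 !inE eqxx |move=> j; rewrite E1 !inE => /orP[]/eqP->; congruence].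
      + by left; exists d; [by rewrite E2 !inE eqxx ?orbT |move=> j; rewrite E1 !inE => /orP[]/eqP->; congruence].
      + by right; exists a; [by rewrite E1 !inE eqxx |move=> j; rewrite E2 !inE => /orP[]/eqP->; congruence].
      + by right; exists b; [by rewrite E1 !inE eqxx ?orbT |move=> j; rewrite E2 !inE => /orP[]/eqP->; congruence].
    by split; [|split]; apply: h2; rewrite E1 E2 !inE eqxx ?orbT.
move=> /(pattern_good jd two_neq0)[a [b [c [d [U ab cd cross three]]]]].
move: U; rewrite /= !inE !negb_or.
move=> /and4P[/and3P[nab nac nad] /andP[nbc nbd] ncd _].
have c1 : #|[set a; b]| = 2%N by rewrite cards2 nab.
have c2 : #|[set c; d]| = 2%N by rewrite cards2 ncd.
have d12 : [disjoint [set a; b] & [set c; d]].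
  rewrite disjoints_subset; apply/subsetP => x; rewrite !inE negb_or.
  by case/orP => /eqP->; apply/andP.
have c3 : #|~: ([set a; b] :|: [set c; d])| = 2%N.
  by rewrite cardsCs setCK card_ord cardsU c1 c2 (disjoint_setI0 d12) cards0.
have st := partition_sums d12.
have s1 : \sum_(i in [set a; b]) lam i = tau by rewrite big_setU1 ?inE //= big_set1.
have s2 : \sum_(i in [set c; d]) lam i = tau by rewrite big_setU1 ?inE //= big_set1.
have t3 : \sum_(i in ~: ([set a; b] :|: [set c; d])) lam i = - tau.
  by rewrite s1 s2 in st; apply: (addrI (tau + tau)); rewrite -st; ring.
exists [set a; b], [set c; d], (~: ([set a; b] :|: [set c; d])); split=> //.
  by apply/(partition3P c1 c2 c3).
split; first by rewrite s1 s2 t3 opprK.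
- move=> x y xI yI xy.
  case: (eqVneq (lam x + lam x) tau) => h.
    by left; split; [exact: lamE|apply/(half_tau _ t3); rewrite -(lamE _ _ xy)].
  right=> j1 j2 F1 F2.
  by case: (cross _ _ _ _ F1 F2 xy) => // /eqP; rewrite (negbTE h).
- move=> h3.
  have aI : a \in [set a; b] by rewrite !inE eqxx.
  have bI : b \in [set a; b] by rewrite !inE eqxx orbT.
  have cI : c \in [set c; d] by rewrite !inE eqxx.
  have dI : d \in [set c; d] by rewrite !inE eqxx orbT.
  have [|jab [jbc jcd]] := three.
    case: h3 => -[i + h]; rewrite !inE => /orP[]/eqP E; subst i.
    + by left; rewrite (h a aI) (h b bI); split=> //; left.
    + by left; rewrite (h a aI) (h b bI); split=> //; right.
    + by right; rewrite (h c cI) (h d dI); split=> //; left.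
    + by right; rewrite (h c cI) (h d dI); split=> //; right.
  have jall j : j \in [set a; b] :|: [set c; d] -> jb j = jb a.
    by rewrite !inE => /orP[]/orP[]/eqP->; congruence.
  split=> [j hj|j k hj hk]; last by rewrite !jall.
  apply/(half_tau _ t3); transitivity (lam a + lam b); last exact: ab.
  by congr (_ + _); apply: lamE; rewrite jall.
Qed.

End PartitionPattern.

(** * Laplace expansion *)

Section LaplaceExpansion.
Variable K : comPzRingType.

(** Matrices indexed by natural numbers, so that the expansion computes by
    reduction. *)
Fixpoint laplace n (M : nat -> nat -> K) : K :=
  if n is n'.+1 then
    foldr (fun i s => (-1) ^+ i * M i 0%N * laplace n' (fun a b => M (bump i a) b.+1) + s)
      0 (iota 0 n)
  else 1.

Lemma foldr_sum (F : nat -> K) s : foldr (fun i t => F i + t) 0 s = \sum_(i <- s) F i.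
Proof. by elim: s => [|x s IH]; rewrite ?big_nil // big_cons -IH. Qed.

Lemma laplaceS n (M : nat -> nat -> K) : laplace n.+1 M =
  \sum_(i < n.+1) (-1) ^+ i * M i 0%N * laplace n (fun a b => M (bump i a) b.+1).
Proof.
rewrite -(big_mkord xpredT (fun i => (-1) ^+ i * M i 0%N * laplace n (fun a b => M (bump i a) b.+1))).
exact: foldr_sum.
Qed.

Lemma det_laplace n (M : nat -> nat -> K) : \det (\matrix_(i < n, j < n) M i j) = laplace n M.
Proof.
elim: n M => [|n IH] M; first by rewrite det_mx00.
rewrite (expand_det_col _ ord0) laplaceS; apply: eq_bigr => i _.
rewrite /cofactor addn0 mxE -IH mulrCA mulrA; congr (_ * \det _).
by apply/matrixP=> a b; rewrite !mxE.
Qed.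

End LaplaceExpansion.

(** * Pfaffians and the normal form of a bivector of rank four *)

Section Alternation.
Variables (T : eqType) (P : seq T -> Prop).
Hypothesis P_swap : forall s1 x y s2, P (s1 ++ x :: y :: s2) -> P (s1 ++ y :: x :: s2).

(** Adjacent transpositions generate all permutations. *)
Lemma swap_perm_ind s t : perm_eq s t -> P s -> P t.
Proof.
move=> st; rewrite -[s]cat0s -[t]cat0s.
elim: s t [::] st => [|x s IH] t pre st; first by rewrite (perm_nilP (_ : perm_eq t [::])) // perm_sym.
have xt : x \in t by rewrite -(perm_mem st) mem_head.
case/splitPr: xt st => t1 t2 st.
have st' : perm_eq s (t1 ++ t2).
  by rewrite -(perm_cons x); apply: perm_trans st _; rewrite (perm_catCA t1 [:: x] t2).
move=> Ps; have {}Ps : P (pre ++ x :: t1 ++ t2).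
  by have := IH _ (rcons pre x) st'; rewrite !cat_rcons; apply.
elim: t1 pre Ps {st st' IH} => [|y t1 IHt] pre //= Ps.
by have := IHt (rcons pre y); rewrite !cat_rcons; apply; apply: P_swap.
Qed.

End Alternation.

Section SixPfaffian.
Variables (K : fieldType) (n : nat).
Implicit Types (X Y B C : 'M[K]_n).

Definition pf6 X a b c d e f : K :=
  X a b * pf4 X c d e f - X a c * pf4 X b d e f + X a d * pf4 X b c e f
  - X a e * pf4 X b c d f + X a f * pf4 X b c d e.

(** The derivative of the Pfaffian at X in the direction Y. *)
Definition dpf6 X Y a b c d e f : K :=
  Y a b * pf4 X c d e f - Y a c * pf4 X b d e f + Y a d * pf4 X b c e f
  - Y a e * pf4 X b c d f + Y a f * pf4 X b c d e + Y b c * pf4 X a d e f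
  - Y b d * pf4 X a c e f + Y b e * pf4 X a c d f - Y b f * pf4 X a c d e
  + Y c d * pf4 X a b e f - Y c e * pf4 X a b d f + Y c f * pf4 X a b d e
  + Y d e * pf4 X a b c f - Y d f * pf4 X a b c e + Y e f * pf4 X a b c d.

Lemma pf4_pencil B C s t i j k l : pf4 (s *: B + t *: C) i j k l =
  s ^+ 2 * pf4 B i j k l
  + s * t * (pf4 (B + C) i j k l - pf4 B i j k l - pf4 C i j k l)
  + t ^+ 2 * pf4 C i j k l.
Proof. by rewrite /pf4 !mxE; ring. Qed.

Lemma pf6_pencil B C s t a b c d e f : pf6 (s *: B + t *: C) a b c d e f =
  s ^+ 3 * pf6 B a b c d e f + s ^+ 2 * t * dpf6 B C a b c d e f
  + s * t ^+ 2 * dpf6 C B a b c d e f + t ^+ 3 * pf6 C a b c d e f.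
Proof. by rewrite /pf6 /dpf6 /pf4 !mxE; ring. Qed.

Lemma dpf6_pencil B C s t s' t' a b c d e f :
  dpf6 (s *: B + t *: C) (s' *: B + t' *: C) a b c d e f =
  3%:R * s ^+ 2 * s' * pf6 B a b c d e f
  + (2%:R * s * s' * t + s ^+ 2 * t') * dpf6 B C a b c d e f
  + (2%:R * s * t * t' + t ^+ 2 * s') * dpf6 C B a b c d e f
  + 3%:R * t ^+ 2 * t' * pf6 C a b c d e f.
Proof. by rewrite /pf6 /dpf6 /pf4 !mxE; ring. Qed.

(** The partial derivatives of the Pfaffian are the sub-Pfaffians of size four, so
    bivectors of rank two are critical points. *)
Lemma dpf6_rank_lt4 X Y a b c d e f : ~~ rank_ge4 X -> dpf6 X Y a b c d e f = 0.
Proof. by move=> h; rewrite /dpf6 !(rank_lt4P _ _ _ _ h); ring. Qed.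

Lemma pf6_two_biv X a b c d e f : two_biv X -> pf6 X a b c d e f = 0.
Proof.
move=> [p1 [q1 [p2 [q2 ->]]]]; rewrite /pf6 /pf4.
have E i j : (biv p1 q1 + biv p2 q2) i j =
    p1 i 0 * q1 j 0 - q1 i 0 * p1 j 0 + (p2 i 0 * q2 j 0 - q2 i 0 * p2 j 0).
  by rewrite mxE !bivE.
by rewrite !E; ring.
Qed.

(** The Pfaffian analogue of the determinant formula for a Schur complement. *)
Lemma pf6_schur X a b c d i j : X a b != 0 ->
  pf4 (\matrix_(i, j) ((X a b)^-1 * pf4 X a b i j)) c d i j
  = (X a b)^-1 * pf6 X a b c d i j.
Proof. by move=> ab0; rewrite /pf6 /pf4 !mxE; field. Qed.

(** Two orthogonalisation steps; what remains is a multiple of a Pfaffian of size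
    six. *)
Lemma rank4_two_biv X : rank_ge4 X ->
  (forall a b c d e f, pf6 X a b c d e f = 0) -> two_biv X.
Proof.
move=> rX X6; have [a [b ab0]] : exists a b, X a b != 0.
  case: (pickP (fun x : 'I_n * 'I_n => X x.1 x.2 != 0)) => [[a b] /= h|h]; first by exists a, b.
  case/rank_ge4P: rX => i [j [k [l]]].
  have z x y : X x y = 0 by apply/eqP; move: (h (x, y)) => /negbFE.
  by rewrite /pf4 !z !mulr0 subrr addr0 eqxx.
have E := alt_mx_split ab0; set X' := (X in _ + X) in E.
have [c [d cd0]] : exists c d, X' c d != 0.
  case: (pickP (fun x : 'I_n * 'I_n => X' x.1 x.2 != 0)) => [[c d] /= h|h]; first by exists c, d.
  case/rank_ge4P: rX => i [j [k [l]]].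
  have z : X' = 0 by apply/matrixP=> x y; rewrite [RHS]mxE; apply/eqP; move: (h (x, y)) => /negbFE.
  by rewrite E z addr0 pf4_biv eqxx.
have E' : X' = biv ((X' c d)^-1 *: (row c X')^T) (row d X')^T.
  rewrite {1}(alt_mx_split cd0) [X in _ + X](_ : _ = 0) ?addr0 //.
  by apply/matrixP=> i j; rewrite mxE [RHS]mxE pf6_schur // X6 !mulr0.
exists ((X a b)^-1 *: (row a X)^T), (row b X)^T,
  ((X' c d)^-1 *: (row c X')^T), (row d X')^T.
by rewrite -E' -E.
Qed.

End SixPfaffian.

(** The Pfaffian is alternating in its indices.  In dimension six an index list
    without repetition is a permutation of the standard one, and a list with a
    repetition can be permuted so that the repetition comes first. *)
Lemma pf6_std (K : fieldType) (X : 'M[K]_6) : alt_mx X ->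
  pf6 X (inord 0) (inord 1) (inord 2) (inord 3) (inord 4) (inord 5) = 0 ->
  forall a b c d e f, pf6 X a b c d e f = 0.
Proof.
move=> [X0 Xs] h0 a b c d e f.
pose P (s : seq 'I_6) := if s is [:: a; b; c; d; e; f] then pf6 X a b c d e f = 0 else True.
have Psw s1 x y s2 : P (s1 ++ x :: y :: s2) -> P (s1 ++ y :: x :: s2).
  have opp0 (u v : K) : u = - v -> u = 0 -> v = 0.
    by move=> -> /eqP; rewrite oppr_eq0 => /eqP.
  case: s1 => [|x1 [|x2 [|x3 [|x4 [|x5 s1]]]]].
  - case: s2 => [|x3 [|x4 [|x5 [|x6 [|? ?]]]]] //=; apply: opp0.
    by rewrite /pf6 /pf4 (Xs x y); ring.
  - case: s2 => [|x4 [|x5 [|x6 [|? ?]]]] //=; apply: opp0.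
    by rewrite /pf6 /pf4 (Xs x y); ring.
  - case: s2 => [|x5 [|x6 [|? ?]]] //=; apply: opp0.
    by rewrite /pf6 /pf4 (Xs x y); ring.
  - case: s2 => [|x6 [|? ?]] //=; apply: opp0.
    by rewrite /pf6 /pf4 (Xs x y); ring.
  - case: s2 => [|? ?] //=; apply: opp0.
    by rewrite /pf6 /pf4 (Xs x y); ring.
  by case: s1 => [|? [|? ?]].
have [U|/negP U] := boolP (uniq [:: a; b; c; d; e; f]); last first.
  suff [x [y [z [t [v]]]]] : exists x y z t v, perm_eq [:: x; x; y; z; t; v] [:: a; b; c; d; e; f].
    move=> /(swap_perm_ind Psw); apply; rewrite /= /pf6 /pf4 X0.
    by ring.
  have dup (s : seq 'I_6) : ~ uniq s -> exists x r, perm_eq (x :: x :: r) s.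
    elim: s => [|x s IH] //=; case: (boolP (x \in s)) => /= xs.
      move=> _; exists x, (rem x s); rewrite perm_cons perm_sym; exact: perm_to_rem.
    move=> /IH [y [r h]]; exists y, (x :: r).
    rewrite -(perm_cons x) in h; apply: perm_trans h.
    by rewrite (perm_catCA [:: y; y] [:: x] r).
  have [x [r h]] := dup _ U; have := perm_size h.
  by case: r h => [|y [|z [|t [|v [|? ?]]]]] //= h _; exists x, y, z, t, v.
suff : perm_eq [:: inord 0; inord 1; inord 2; inord 3; inord 4; inord 5] [:: a; b; c; d; e; f].
  by move/(swap_perm_ind Psw); apply.
have full (s : seq 'I_6) : uniq s -> size s = 6%N -> s =i predT.
  by move=> us ss; apply/subset_cardP; rewrite ?subset_predT // (card_uniqP us) ss cardT size_enum_ord.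
apply: uniq_perm => //.
  by rewrite /= !inE -!(inj_eq val_inj) /= !inordK.
move=> x; rewrite [RHS]full // full //.
by rewrite /= !inE -!(inj_eq val_inj) /= !inordK.
Qed.

Section NormalForm.
Variable K : fieldType.

(** The bivector x1 ^ x2 + x3 ^ x4 in the standard basis. *)
Definition omega4 : 'M[K]_6 :=
  biv (ecol K (inord 0)) (ecol K (inord 1)) + biv (ecol K (inord 2)) (ecol K (inord 3)).

Lemma two_biv_det n (p1 q1 p2 q2 : 'cV[K]_n) (f : nat -> 'I_n) :
  pf4 (biv p1 q1 + biv p2 q2) (f 0) (f 1) (f 2) (f 3) =
  \det (\matrix_(i < 4, j < 4) nth 0 [:: p1; q1; p2; q2] j (f i) 0).
Proof.
rewrite (det_laplace _ (fun i j => nth 0 [:: p1; q1; p2; q2] j (f i) 0)) /=.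
have E i j : (biv p1 q1 + biv p2 q2) i j =
    p1 i 0 * q1 j 0 - q1 i 0 * p1 j 0 + (p2 i 0 * q2 j 0 - q2 i 0 * p2 j 0).
  by rewrite mxE !bivE.
by rewrite /pf4 !E; ring.
Qed.

(** The Gaussian decomposition of A^T provides the missing columns. *)
Lemma complete_cols (A : 'M[K]_(6, 4)) : row_free A^T ->
  exists2 T : 'M[K]_6, T \in unitmx & forall (j : 'I_4), col (inord j) T = col j A.
Proof.
move=> fA; have rA : \rank A^T = 4%N by apply/eqP.
pose L : 'M_(4 + 2) := block_mx (col_ebase A^T) 0 0 1%:M.
have LE : L *m (row_ebase A^T : 'M_(4 + 2)) =
    col_mx A^T (row_mx 0 1%:M *m (row_ebase A^T : 'M_(4 + 2))).
  rewrite /L block_mxEv mul_col_mx; congr col_mx.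
  rewrite -[RHS]mulmx_ebase rA; congr (_ *m _).
  have -> : (pid_mx 4 : 'M[K]_(4, 6)) = row_mx (1%:M : 'M_4) (0 : 'M_(4, 2)).
    exact: pid_mx_row.
  by apply/esym/(etrans (mul_mx_row _ _ _)); rewrite mulmx1 mulmx0.
have uL : L \in unitmx.
  rewrite unitmxE; have -> : \det L = \det (col_ebase A^T) * \det (1%:M : 'M[K]_2).
    exact: det_ublock.
  by rewrite det1 mulr1 -unitmxE col_ebase_unit.
exists (L *m row_ebase A^T)^T.
  by rewrite unitmx_tr unitmx_mul row_ebase_unit andbT.
move=> j; apply/matrixP=> i z; rewrite !mxE.
have -> : inord j = lshift 2 j :> 'I_(4 + 2).
  by apply: val_inj; rewrite /= inordK //; have := ltn_ord j; lia.
have := congr1 (fun M : 'M_(4 + 2) => M (lshift 2 j) i) LE.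
by rewrite col_mxEu [X in _ = X]mxE mxE.
Qed.

(** A nonzero sub-Pfaffian of p1 ^ q1 + p2 ^ q2 is a minor of the matrix with
    columns p1, q1, p2, q2, so that these are linearly independent. *)
Lemma two_biv_normal (X : 'M[K]_6) : two_biv X -> rank_ge4 X ->
  exists2 T : 'M[K]_6, T \in unitmx & X = T *m omega4 *m T^T.
Proof.
move=> [p1 [q1 [p2 [q2 ->]]]] /rank_ge4P[i [j [k [l]]]].
pose f m := nth i [:: i; j; k; l] m.
rewrite (two_biv_det p1 q1 p2 q2 f).
set A := (X in \det X) => dA.
pose P : 'M[K]_(6, 4) := \matrix_(i < 6, j < 4) nth 0 [:: p1; q1; p2; q2] j i 0.
have [|T uT hT] := @complete_cols P.
  have AP : A = rowsub (fun m : 'I_4 => f m) P by apply/matrixP=> a b; rewrite !mxE.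
  have uA : A \in unitmx by rewrite unitmxE unitfE.
  rewrite /row_free mxrank_tr eqn_leq rank_leq_col /=.
  by rewrite -{1}(mxrank_unit uA) AP rowsubE mxrankM_maxr.
exists T => //; rewrite /omega4 mulmxDr mulmxDl !congr_biv.
have cE (m : nat) : (m < 4)%N -> T *m ecol K (inord m) = nth 0 [:: p1; q1; p2; q2] m.
  move=> m4; rewrite /ecol -colE.
  have := hT (Ordinal m4); rewrite /= => ->.
  by apply/matrixP=> a b; rewrite !mxE [b]ord1.
by rewrite !cE.
Qed.

End NormalForm.

(** * From complex to real invariant bivectors *)

Section RealPoints.
Variable R : rcfType.
Local Notation toC := (real_complex R).

Lemma pf4_map (K L : fieldType) (f : {rmorphism K -> L}) n (X : 'M[K]_n) i j k l :
  pf4 (map_mx f X) i j k l = f (pf4 X i j k l).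
Proof. by rewrite /pf4 !mxE !(rmorphD, rmorphB, rmorphM, rmorphN). Qed.

Lemma pf6_map (K L : fieldType) (f : {rmorphism K -> L}) n (X : 'M[K]_n) a b c d e g :
  pf6 (map_mx f X) a b c d e g = f (pf6 X a b c d e g).
Proof.
by rewrite /pf6 !pf4_map !mxE !(rmorphD, rmorphB, rmorphM, rmorphN).
Qed.

Lemma dpf6_map (K L : fieldType) (f : {rmorphism K -> L}) n (X Y : 'M[K]_n) a b c d e g :
  dpf6 (map_mx f X) (map_mx f Y) a b c d e g = f (dpf6 X Y a b c d e g).
Proof.
by rewrite /dpf6 !pf4_map !mxE !(rmorphB, rmorphD, rmorphM).
Qed.

Lemma rank_ge4_map (K L : fieldType) (f : {rmorphism K -> L}) n (X : 'M[K]_n) :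
  rank_ge4 X -> rank_ge4 (map_mx f X).
Proof.
move=> /rank_ge4P[i [j [k [l h]]]]; apply/rank_ge4P; exists i, j, k, l.
by rewrite pf4_map fmorph_eq0.
Qed.

Lemma invariant_biv_map (K L : fieldType) (f : {rmorphism K -> L}) n (F X : 'M[K]_n) :
  invariant_biv F X -> invariant_biv (map_mx f F) (map_mx f X).
Proof.
move=> h; rewrite /invariant_biv map_trmx -!map_mxM -map_mxD h map_mxZ.
by rewrite trace_map_mx.
Qed.

Lemma complex_eq0 (a b : R) : toC a + 'i%C * toC b = 0 -> a = 0 /\ b = 0.
Proof. by rewrite -[LHS](complexE (Complex a b)) => -[]. Qed.

Let ReM (a : R) (z : R[i]) : complex.Re (toC a * z) = a * complex.Re z.
Proof. by case: z => x y; rewrite /= mul0r subr0. Qed.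

Let ImM (a : R) (z : R[i]) : complex.Im (toC a * z) = a * complex.Im z.
Proof. by case: z => x y; rewrite /= mul0r addr0. Qed.

Lemma invariant_biv_part (g : R[i] -> R) n (F : 'M[R]_n) X :
  g 0 = 0 -> {morph g : x y / x + y} -> (forall a z, g (toC a * z) = a * g z) ->
  invariant_biv (map_mx toC F) X -> invariant_biv F (map_mx g X).
Proof.
move=> g0 gD gM /matrixP h; apply/matrixP=> i j.
have := congr1 g (h i j); rewrite trace_map_mx !mxE gD gM => <-.
rewrite !(big_morph g gD g0); congr (_ + _); apply: eq_bigr => k _.
  by rewrite !mxE gM.
by rewrite !mxE mulrC -gM mulrC.
Qed.

(** The pencil argument for the real part B and the imaginary part C of X. *)
Lemma real_rank4 (F : 'M[R]_6) (X : 'M[R[i]]_6) : invariant_biv (map_mx toC F) X ->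
  two_biv X -> rank_ge4 X ->
  exists Y : 'M[R]_6, [/\ invariant_biv F Y, two_biv Y & rank_ge4 Y].
Proof.
move=> invX X2 rX.
have altX : alt_mx X by case: X2 => [p1 [q1 [p2 [q2 ->]]]]; apply: alt_add; apply: alt_biv.
pose B := map_mx (@complex.Re R) X; pose C := map_mx (@complex.Im R) X.
have addRe : {morph (@complex.Re R) : x y / x + y} by case=> a b [].
have addIm : {morph (@complex.Im R) : x y / x + y} by case=> a b [].
have oppRe x : complex.Re (- x) = - complex.Re x by case: x.
have oppIm x : complex.Im (- x) = - complex.Im x by case: x.
have invB : invariant_biv F B by apply: invariant_biv_part ReM invX.
have invC : invariant_biv F C by apply: invariant_biv_part ImM invX.
have altB : alt_mx B.
  by case: altX => h1 h2; split=> [i|i j]; rewrite !mxE ?h1 // h2 oppRe.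
have altC : alt_mx C.
  by case: altX => h1 h2; split=> [i|i j]; rewrite !mxE ?h1 // h2 oppIm.
have XE : X = 1 *: map_mx toC B + 'i%C *: map_mx toC C.
  by apply/matrixP=> i j; rewrite !mxE mul1r -complexE.
have ii : 'i%C * 'i%C = -1 :> R[i] by rewrite -expr2 sqr_i.
pose pf (Y : 'M[R]_6) := pf6 Y (inord 0) (inord 1) (inord 2) (inord 3) (inord 4) (inord 5).
pose dpf (Y Z : 'M[R]_6) := dpf6 Y Z (inord 0) (inord 1) (inord 2) (inord 3) (inord 4) (inord 5).
(* The real and the imaginary part of the vanishing Pfaffian at (s, t) = (1, i). *)
have [e1 e2] : pf B - dpf C B = 0 /\ dpf B C - pf C = 0.
  apply: complex_eq0; rewrite !rmorphB /= -!pf6_map -!dpf6_map.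
  rewrite -[RHS](pf6_two_biv (inord 0) (inord 1) (inord 2) (inord 3) (inord 4) (inord 5) X2).
  rewrite XE pf6_pencil; move: ii; set I := 'i%C => ii.
  by rewrite !expr1n !mul1r (_ : I ^+ 3 = - I) ?expr2 ?ii ?exprS ?expr0 ?mulr1 ?ii; ring.
have good s t : pf (s *: B + t *: C) = 0 -> rank_ge4 (s *: B + t *: C) ->
    exists Y : 'M[R]_6, [/\ invariant_biv F Y, two_biv Y & rank_ge4 Y].
  move=> h r; exists (s *: B + t *: C); split=> //.
    rewrite /invariant_biv mulmxDr mulmxDl -!scalemxAr -!scalemxAl addrACA -!scalerDr.
    by rewrite invB invC scalerDr !scalerA ![_ * \tr _]mulrC.
  apply: rank4_two_biv => //; apply: pf6_std => //.
  by apply: alt_add; apply: alt_scale.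
have pfE s t : pf (s *: B + t *: C) = (s ^+ 2 + t ^+ 2) * (s * pf B + t * pf C).
  have -> : pf (s *: B + t *: C) = s ^+ 3 * pf B + s ^+ 2 * t * dpf B C
      + s * t ^+ 2 * dpf C B + t ^+ 3 * pf C by exact: pf6_pencil.
  by rewrite (subr0_eq e2) -(subr0_eq e1); ring.
case: (eqVneq (pf B ^+ 2 + pf C ^+ 2) 0) => [h|h].
  have pB : pf B = 0.
    by apply/eqP; move/eqP: h; rewrite paddr_eq0 ?sqr_ge0 // !sqrf_eq0 => /andP[].
  have pC : pf C = 0.
    by apply/eqP; move/eqP: h; rewrite paddr_eq0 ?sqr_ge0 // !sqrf_eq0 => /andP[].
  have good' s t : rank_ge4 (s *: B + t *: C) ->
      exists Y : 'M[R]_6, [/\ invariant_biv F Y, two_biv Y & rank_ge4 Y].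
    by apply: good; rewrite pfE pB pC !mulr0 addr0 mulr0.
  (* The sub-Pfaffians of size four are quadratic in (s, t), so they would vanish on
     the whole pencil, and at X, if they vanished at (1, 0), (0, 1) and (1, 1). *)
  case: (boolP (rank_ge4 (1 *: B + 0 *: C))) => [/good'//|rB].
  case: (boolP (rank_ge4 (0 *: B + 1 *: C))) => [/good'//|rC].
  case: (boolP (rank_ge4 (1 *: B + 1 *: C))) => [/good'//|rBC].
  rewrite !(scale1r, scale0r, add0r, addr0) in rB rC rBC.
  case/rank_ge4P: rX => i [j [k [l]]].
  rewrite XE pf4_pencil -map_mxD !pf4_map !(rank_lt4P _ _ _ _ rB).
  by rewrite !(rank_lt4P _ _ _ _ rC) !(rank_lt4P _ _ _ _ rBC) rmorph0 !(mulr0, subr0, addr0) eqxx.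
have hpf : pf (pf C *: B + - pf B *: C) = 0 by rewrite pfE mulNr [pf C * _]mulrC subrr mulr0.
apply: good hpf _; apply: contraNT h => r.
(* With p and q the Pfaffians of B and C, the derivative of (s^2 + t^2) (s p + t q)
   at (q, - p) in the direction (p, q) is (p^2 + q^2)^2, whereas it would vanish at
   a point of rank two. *)
have := dpf6_pencil B C (pf C) (- pf B) (pf B) (pf C) (inord 0) (inord 1) (inord 2) (inord 3) (inord 4) (inord 5).
rewrite dpf6_rank_lt4 // -/(pf B) -/(pf C) -/(dpf B C) -/(dpf C B).
rewrite (subr0_eq e2) -(subr0_eq e1) => /esym e.
by rewrite -sqrf_eq0 -e; apply/eqP; ring.
Qed.

End RealPoints.

Section JordanReal.
Variables (R : rcfType) (F : 'M[R]_6) (lam : 'I_6 -> R[i]) (jb : 'I_6 -> nat).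
Variable P : 'M[R[i]]_6.
Hypothesis jd : jordan_data lam jb.
Hypothesis uP : P \in unitmx.
Hypothesis FP : map_mx (real_complex R) F *m P = P *m jordan_mx lam jb.

Lemma complex_two_neq0 : (2%:R : R[i]) != 0.
Proof. by rewrite pnatr_eq0. Qed.

Lemma invariant_pattern (B : 'M[R]_6) : alt_mx B -> invariant_biv F B -> rank_ge4 B ->
  block_pattern lam jb.
Proof.
move=> altB invB rB; pose X := map_mx (real_complex R) B.
have altX : alt_mx X.
  by case: altB => h1 h2; split=> [i|i j]; rewrite !mxE ?h1 // h2 rmorphN.
have uP' : invmx P \in unitmx by rewrite unitmx_inv.
apply: (rank_ge4_pattern jd (C := invmx P *m X *m (invmx P)^T) complex_two_neq0).
- exact: alt_congr.
- apply: (invariant_biv_congr (F' := map_mx (real_complex R) F)) => //; last exact: invariant_biv_map.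
  by rewrite -[jordan_mx _ _](mulKmx uP) -FP -!mulmxA mulmxV // mulmx1.
- by apply: rank_ge4_congr => //; apply: rank_ge4_map.
Qed.

(** Combines the complex solution carried by a pattern, the passage to a real one
    and the normal form of the latter. *)
Lemma pattern_normal_form : block_pattern lam jb ->
  exists2 T : 'M[R]_6, T \in unitmx & invariant_biv (invmx T *m F *m T) (omega4 R).
Proof.
move=> /(pattern_rank4 jd)[C C2 [invC rC]].
have C2' : two_biv (P *m C *m P^T).
  case: C2 => p1 [q1 [p2 [q2 ->]]].
  exists (P *m p1), (P *m q1), (P *m p2), (P *m q2).
  by rewrite mulmxDr mulmxDl (congr_biv P p1 q1) (congr_biv P p2 q2).
have altC : alt_mx C by case: C2 => [p1 [q1 [p2 [q2 ->]]]]; apply: alt_add; apply: alt_biv.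
have [Y [invY Y2 rY]] := real_rank4 (invariant_biv_congr uP FP invC) C2' (rank_ge4_congr uP altC rC).
have [T uT YT] := two_biv_normal Y2 rY.
exists T => //.
have -> : omega4 R = invmx T *m Y *m (invmx T)^T.
  by rewrite YT -!mulmxA trmx_inv mulmxV ?unitmx_tr // mulmx1 mulKmx.
apply: (invariant_biv_congr (F' := F))  => //; rewrite ?unitmx_inv //.
by rewrite -!mulmxA mulmxV // mulmx1.
Qed.

End JordanReal.

(** * Matrices of endomorphisms *)

Section Bases.
Variables (K : realType) (V : vectType K).
Implicit Types (f g : 'End(V)).

Lemma coord_eq n (e : n.-tuple V) (be : basis_of {:V} e) (i j : 'I_n) :
  coord e i e`_j = (i == j)%:R.
Proof. by rewrite (coord_free _ _ (basis_free be)) eq_sym. Qed.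

Lemma coord_decomp n (e : n.-tuple V) (be : basis_of {:V} e) v :
  v = \sum_i coord e i v *: e`_i.
Proof. by apply: (coord_basis be); apply: memvf. Qed.

Lemma coord_comb n (e : n.-tuple V) (be : basis_of {:V} e) (c : 'I_n -> K) j :
  coord e j (\sum_i c i *: e`_i) = c j.
Proof.
by rewrite -[RHS](coord_sum_free c j (basis_free be)); congr (coord _ _ _).
Qed.

Lemma basis_change n (e : n.-tuple V) (S : 'M[K]_n) : basis_of {:V} e -> S \in unitmx ->
  basis_of {:V} [tuple \sum_i S i j *: e`_i | j < n].
Proof.
move=> be uS; rewrite basisEdim size_tuple (size_basis be) leqnn andbT.
set e' := [tuple _ | _ < n].
have nthe' (j : 'I_n) : e'`_j = \sum_i S i j *: e`_i :> V.
  by rewrite -(tnth_nth 0 e' j) tnth_mktuple.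
apply/subvP => v _; rewrite (coord_decomp be v) memv_suml // => i _.
apply: memvZ.
suff -> : e`_i = \sum_j invmx S j i *: e'`_j.
  by rewrite memv_suml // => j _; rewrite memvZ // memv_span // mem_nth // size_tuple.
under eq_bigr => j _ do rewrite nthe' scaler_sumr.
rewrite exchange_big /=.
transitivity (\sum_k (S *m invmx S) k i *: e`_k).
  rewrite mulmxV // (bigD1 i) //= mxE eqxx scale1r big1 ?addr0 // => k /negbTE ki.
  by rewrite mxE ki scale0r.
apply: eq_bigr => k _; rewrite mxE scaler_suml; apply: eq_bigr => j _.
by rewrite scalerA mulrC.
Qed.

Lemma end_mxP n (e : n.-tuple V) f (be : basis_of {:V} e) (j : 'I_n) :
  f e`_j = \sum_i end_mx e f i j *: e`_i.
Proof.
rewrite {1}(coord_decomp be (f e`_j)); apply: eq_bigr => i _; by rewrite mxE.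
Qed.

Lemma end_mx_uniq n (e : n.-tuple V) f (M : 'M[K]_n) : basis_of {:V} e ->
  (forall j : 'I_n, f e`_j = \sum_i M i j *: e`_i) -> end_mx e f = M.
Proof. by move=> be h; apply/matrixP=> i j; rewrite mxE h coord_comb. Qed.

Lemma end_mx_apply n (e : n.-tuple V) f v i : basis_of {:V} e ->
  coord e i (f v) = \sum_j end_mx e f i j * coord e j v.
Proof.
move=> be; rewrite {1}(coord_decomp be v) linear_sum linear_sum; apply: eq_bigr => j _.
by rewrite linearZ linearZ /= mxE mulrC.
Qed.

Lemma end_mx_comp n (e : n.-tuple V) f g : basis_of {:V} e ->
  end_mx e (f \o g)%VF = end_mx e f *m end_mx e g.
Proof.
move=> be; apply/matrixP=> i j; rewrite mxE lfunE /= end_mx_apply //.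
by rewrite [RHS]mxE; apply: eq_bigr => k _; rewrite [end_mx e g _ _]mxE.
Qed.

Lemma end_mx_id n (e : n.-tuple V) : basis_of {:V} e -> end_mx e \1%VF = 1%:M.
Proof. by move=> be; apply/matrixP=> i j; rewrite !mxE id_lfunE coord_eq. Qed.

Lemma end_mx_surj n (e : n.-tuple V) (M : 'M[K]_n) : basis_of {:V} e ->
  exists f, end_mx e f = M.
Proof.
move=> be; pose F := fun x : V => \sum_j coord e j x *: \sum_i M i j *: e`_i.
have Flin : linear F.
  move=> a x y; rewrite /F scaler_sumr -big_split; apply: eq_bigr => j _ /=.
  by rewrite linearP scalerDl scalerA.
pose F' : {linear V -> V} := HB.pack F (GRing.isLinear.Build _ _ _ _ F Flin).
exists (linfun F'); apply: end_mx_uniq => // j; rewrite lfunE /= /F.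
rewrite (bigD1 j) //= coord_eq // eqxx scale1r [X in _ + X]big1 ?addr0 // => k /negbTE kj.
by rewrite coord_eq // kj scale0r.
Qed.

Lemma end_mx_inj n (e : n.-tuple V) f g : basis_of {:V} e ->
  end_mx e f = end_mx e g -> f = g.
Proof.
move=> be h; apply/lfunP => v; rewrite (coord_decomp be (f v)) (coord_decomp be (g v)).
by apply: eq_bigr => i _; rewrite !end_mx_apply // h.
Qed.

(** The two bases may have lengths that are equal only propositionally, as happens
    with the standard basis of a space of known dimension. *)
Definition base_mx n m (e : n.-tuple V) (e' : m.-tuple V) : 'M[K]_(n, m) :=
  \matrix_(i, j) coord e i e'`_j.

Lemma base_mxK n m (e : n.-tuple V) (e' : m.-tuple V) : basis_of {:V} e ->
  basis_of {:V} e' -> base_mx e e' *m base_mx e' e = 1%:M.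
Proof.
move=> be be'; apply/matrixP=> i j; rewrite !mxE.
rewrite -(coord_eq be i j) [in RHS](coord_decomp be' e`_j) linear_sum.
by apply: eq_bigr => k _; rewrite linearZ !mxE mulrC.
Qed.

Lemma end_mx_base n m (e : n.-tuple V) (e' : m.-tuple V) f : basis_of {:V} e ->
  basis_of {:V} e' -> end_mx e f *m base_mx e e' = base_mx e e' *m end_mx e' f.
Proof.
move=> be be'; apply/matrixP=> i j; rewrite !mxE.
transitivity (coord e i (f e'`_j)).
  by rewrite end_mx_apply //; apply: eq_bigr => k _; rewrite !mxE.
rewrite (coord_decomp be' (f e'`_j)) linear_sum; apply: eq_bigr => k _.
by rewrite linearZ !mxE /= mulrC.
Qed.

(** The trace in the definition is taken in one chosen basis. *)
Lemma end_traceE n (e : n.-tuple V) f : basis_of {:V} e -> end_trace f = \tr (end_mx e f).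
Proof.
move=> be; have bv := vbasisP {:V}; rewrite /end_trace.
rewrite -[end_mx (vbasis _) f]mulmx1 -(base_mxK bv be) mulmxA (end_mx_base f bv be).
by rewrite mxtrace_mulC mulmxA (base_mxK be bv) mul1mx.
Qed.

End Bases.

Section SubspaceBases.
Variables (K : realType) (V : vectType K).

Lemma subvs_basis (U : {vspace V}) n : \dim U = n ->
  exists x : n.-tuple (subvs_of U), basis_of {:subvs_of U} x /\ basis_of U (map vsval x).
Proof.
move=> dU; have dS : \dim {:subvs_of U} = n by rewrite dimvf.
exists (tcast dS (vbasis {:subvs_of U})); rewrite val_tcast; split; first exact: vbasisP.
have -> : map vsval (vbasis {:subvs_of U}) = map (linfun vsval) (vbasis {:subvs_of U}).
  by apply: eq_map => x; rewrite lfunE.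
have E : (linfun (@vsval _ _ U) @: {:subvs_of U})%VS = U.
  apply/vspaceP => v; apply/memv_imgP/idP => [[x _ ->]|vU]; first by rewrite lfunE subvsP.
  by exists (vsproj U v); rewrite ?memvf // lfunE /= vsprojK.
have : basis_of (linfun (@vsval _ _ U) @: {:subvs_of U}) (map (linfun vsval) (vbasis {:subvs_of U})).
  apply: limg_basis_of; last exact: vbasisP.
  apply/eqP; rewrite -subv0; apply/subvP => x /memv_capP[_].
  rewrite memv_ker lfunE /= memv0 => /eqP h.
  by apply/eqP/val_inj; rewrite /= h.
by rewrite E.
Qed.

Lemma linear_comb n (T : lmodType K) (f : {linear V -> T}) (c : 'I_n -> K) (x : 'I_n -> V) :
  f (\sum_i c i *: x i) = \sum_i c i *: f (x i).
Proof. by rewrite linear_sum; apply: eq_bigr => i _; rewrite linearZ. Qed.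

End SubspaceBases.

(** * Two-forms and Gram matrices *)

Section TwoForm.
Variables (K : realType) (V : vectType K) (omega : kform V 2).
Hypothesis omega_form : alt_form omega.

Definition form2 (x y : V) := omega (pair_arg x y).

Lemma form2_linl a x x' y : form2 (a *: x + x') y = a * form2 x y + form2 x' y.
Proof.
have [ml _] := omega_form; have := ml (pair_arg x y) ord0 a x x'.
have E z : subst_at (pair_arg x y) ord0 z = pair_arg z y.
  by apply/ffunP=> i; rewrite !ffunE; case: eqP.
by rewrite !E.
Qed.

Lemma form2_linr a x y y' : form2 x (a *: y + y') = a * form2 x y + form2 x y'.
Proof.
have [ml _] := omega_form; have := ml (pair_arg x y) (Ordinal (isT : 1 < 2)%N) a y y'.
have E z : subst_at (pair_arg x y) (Ordinal (isT : 1 < 2)%N) z = pair_arg x z.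
  by apply/ffunP=> i; rewrite !ffunE; case: (i) => [[|[|//]] ?].
by rewrite !E.
Qed.

Lemma form2_xx x : form2 x x = 0.
Proof.
have [_ alt] := omega_form.
apply: (alt _ ord0 (Ordinal (isT : 1 < 2)%N)) => //.
by rewrite !ffunE.
Qed.

Lemma form20 y : form2 0 y = 0.
Proof. by have := form2_linl (-1) 0 0 y; rewrite scaleN1r oppr0 addr0 mulN1r addNr. Qed.

Lemma form2_0 y : form2 y 0 = 0.
Proof. by have := form2_linr (-1) y 0 0; rewrite scaleN1r oppr0 addr0 mulN1r addNr. Qed.

Lemma form2_suml I (r : seq I) (c : I -> K) (x : I -> V) y :
  form2 (\sum_(i <- r) c i *: x i) y = \sum_(i <- r) c i * form2 (x i) y.
Proof.
by elim: r => [|i r IH]; rewrite ?big_nil ?form20 // !big_cons form2_linl IH.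
Qed.

Lemma form2_sumr I (r : seq I) (c : I -> K) (x : I -> V) y :
  form2 y (\sum_(i <- r) c i *: x i) = \sum_(i <- r) c i * form2 y (x i).
Proof.
by elim: r => [|i r IH]; rewrite ?big_nil ?form2_0 // !big_cons form2_linr IH.
Qed.

Lemma form2C x y : form2 y x = - form2 x y.
Proof.
have := form2_xx (1 *: x + y); rewrite form2_linl !mul1r -[x in form2 x (_ + _)]scale1r.
rewrite !form2_linr !scale1r !mul1r !form2_xx addr0 add0r addrC => /eqP.
by rewrite addr_eq0 => /eqP.
Qed.

Definition gram n (x : n.-tuple V) : 'M[K]_n := \matrix_(i, j) form2 x`_i x`_j.

Lemma gram_unit n (x : n.-tuple V) : basis_of {:V} x ->
  nondegenerate2 form2 -> gram x \in unitmx.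
Proof.
move=> bx nd; rewrite -row_free_unit -kermx_eq0.
apply/eqP/row_matrixP => i; rewrite row0; apply/eqP.
set k := row i _; have kG : k *m gram x = 0.
  by rewrite /k -row_mul mulmx_ker row0.
have v0 : \sum_j k 0 j *: x`_j = 0.
  apply: nd => y; rewrite (coord_decomp bx y) form2_sumr big1 // => j _.
  rewrite form2_suml; have := congr1 (fun M : 'rV_n => M 0 j) kG.
  rewrite !mxE => h; rewrite [X in _ * X](_ : _ = 0) ?mulr0 //.
  by rewrite -[RHS]h; apply: eq_bigr => l _; rewrite [gram x _ _]mxE.
apply/eqP/matrixP => a j; rewrite [a]ord1 [RHS]mxE -[LHS](coord_comb bx (k 0)).
by rewrite v0 linear0.
Qed.

Lemma in_spP n (x : n.-tuple V) (f : 'End(V)) : basis_of {:V} x ->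
  in_sp omega f <-> (end_mx x f)^T *m gram x + gram x *m end_mx x f = 0.
Proof.
move=> bx; set a := end_mx x f.
have Ei (i j : 'I_n) : form2 (f x`_i) x`_j + form2 x`_i (f x`_j) = (a^T *m gram x + gram x *m a) i j.
  rewrite !(end_mxP f bx) -/a form2_suml form2_sumr [RHS]mxE; congr (_ + _).
    by rewrite mxE; apply: eq_bigr => k _; rewrite [a^T _ _]mxE [gram x _ _]mxE.
  by rewrite mxE; apply: eq_bigr => k _; rewrite [gram x _ _]mxE mulrC.
split=> [h|h].
  by apply/matrixP=> i j; rewrite -Ei mxE; apply: h.
move=> v w; change (form2 (f v) w + form2 v (f w) = 0).
rewrite (coord_decomp bx v) (coord_decomp bx w) !linear_comb.
rewrite !form2_suml -big_split big1 //= => i _.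
rewrite -mulrDr !form2_sumr -big_split big1 ?mulr0 //= => j _.
by rewrite -mulrDr Ei h mxE mulr0.
Qed.

End TwoForm.

(** * Endomorphisms of the split class *)

Section SplitClass.
Variables (K : realType) (V : vectType K) (V2 V4 : {vspace V}).
Variable omega : kform (subvs_of V4) 2.
Hypothesis omega_form : alt_form omega.
Hypothesis omega_nondeg : nondegenerate2 (fun x y => omega (pair_arg x y)).
Variables (x4 : 4.-tuple (subvs_of V4)) (x2 : 2.-tuple (subvs_of V2)).
Hypothesis bx4 : basis_of {:subvs_of V4} x4.
Hypothesis bx2 : basis_of {:subvs_of V2} x2.

Definition split_basis : (4 + 2).-tuple V := [tuple of map vsval x4 ++ map vsval x2].
Hypothesis bV : basis_of {:V} split_basis.

(** The bivector on V4 inverse to omega, as a bivector of the whole space. *)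
Definition split_biv : 'M[K]_(4 + 2) := block_mx (invmx (gram omega x4)) 0 0 0.

Let uG : gram omega x4 \in unitmx := gram_unit omega_form bx4 omega_nondeg.

Lemma split_basisl (i : 'I_4) : split_basis`_(lshift 2 i) = vsval x4`_i.
Proof.
rewrite nth_cat size_map size_tuple /= ltn_ord (nth_map 0) ?size_tuple //.
Qed.

Lemma split_basisr (i : 'I_2) : split_basis`_(rshift 4 i) = vsval x2`_i.
Proof.
rewrite nth_cat size_map size_tuple /= addKn (nth_map 0) ?size_tuple //.
Qed.

Lemma split_comb (c : 'I_(4 + 2) -> K) : \sum_i c i *: split_basis`_i =
  vsval (\sum_i c (lshift 2 i) *: x4`_i) + vsval (\sum_i c (rshift 4 i) *: x2`_i).
Proof.
rewrite big_split_ord !linear_comb; congr (_ + _).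
  by apply: eq_bigr => i _; rewrite split_basisl.
by apply: eq_bigr => i _; rewrite split_basisr.
Qed.

Lemma invariant_split_biv (M : 'M[K]_(4 + 2)) :
  @invariant_biv K (4 + 2) M split_biv <->
  [/\ dlsubmx M = 0 & (ulsubmx M)^T *m gram omega x4 + gram omega x4 *m ulsubmx M
                      = \tr M *: gram omega x4].
Proof.
rewrite -[M in invariant_biv M]submxK /invariant_biv /split_biv tr_block_mx !mulmx_block.
rewrite !(mulmx0, mul0mx, addr0, add0r) add_block_mx scale_block_mx !scaler0 !(addr0, add0r).
rewrite submxK; set A := ulsubmx M; set C := dlsubmx M; set G := gram omega x4.
have iff1 : A *m invmx G + invmx G *m A^T = \tr M *: invmx G <->
    A^T *m G + G *m A = \tr M *: G.
  split=> h.
    have := congr1 (fun X => G *m X *m G) h; rewrite mulmxDr mulmxDl -scalemxAr -scalemxAl.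
    by rewrite mulmxV // mul1mx !mulmxA mulmxV // mul1mx mulmxKV // addrC.
  have := congr1 (fun X => invmx G *m X *m invmx G) h.
  rewrite mulmxDr mulmxDl -scalemxAr -scalemxAl.
  by rewrite mulVmx // mul1mx !mulmxA mulVmx // mul1mx mulmxK // addrC.
split.
  move=> /eq_block_mx[h1 _ h2 _]; split; last exact/iff1.
  by rewrite -[C](mulmxKV uG) h2 mul0mx.
by move=> [h1 /iff1 h2]; rewrite h1 h2 mul0mx trmx0 mulmx0.
Qed.

Lemma end_mx_split (f : 'End(V)) (M : 'M[K]_(4 + 2)) :
  (forall j : 'I_4, f (vsval x4`_j) = vsval (\sum_i ulsubmx M i j *: x4`_i)
     + vsval (\sum_i dlsubmx M i j *: x2`_i)) ->
  (forall j : 'I_2, f (vsval x2`_j) = vsval (\sum_i ursubmx M i j *: x4`_i)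
     + vsval (\sum_i drsubmx M i j *: x2`_i)) -> end_mx split_basis f = M.
Proof.
move=> h4 h2; apply: end_mx_uniq => // j; rewrite split_comb -{1 2}[M]submxK.
case: (splitP (m := 4) (n := 2) j) => j' jj.
  have -> : j = lshift 2 j' by exact: val_inj.
  rewrite split_basisl h4; congr (_ + _); apply: congr1; apply: eq_bigr => i _.
    by rewrite block_mxEul.
  by rewrite block_mxEdl.
have -> : j = rshift 4 j' by exact: val_inj.
rewrite split_basisr h2; congr (_ + _); apply: congr1; apply: eq_bigr => i _.
  by rewrite block_mxEur.
by rewrite block_mxEdr.
Qed.

Lemma split_apply4 (f : 'End(V)) (j : 'I_4) (M := end_mx split_basis f) :
  f (vsval x4`_j) = vsval (\sum_i ulsubmx M i j *: x4`_i)
     + vsval (\sum_i dlsubmx M i j *: x2`_i).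
Proof.
rewrite -split_basisl (end_mxP f bV) split_comb -/M.
congr (_ + _); apply: congr1; apply: eq_bigr => i _; by rewrite [in RHS]mxE [in RHS]mxE.
Qed.

Lemma split_apply2 (f : 'End(V)) (j : 'I_2) (M := end_mx split_basis f) :
  f (vsval x2`_j) = vsval (\sum_i ursubmx M i j *: x4`_i)
     + vsval (\sum_i drsubmx M i j *: x2`_i).
Proof.
rewrite -split_basisr (end_mxP f bV) split_comb -/M.
congr (_ + _); apply: congr1; apply: eq_bigr => i _; by rewrite [in RHS]mxE [in RHS]mxE.
Qed.

Lemma mxtrace_split (M : 'M[K]_(4 + 2)) : \tr M = \tr (ulsubmx M) + \tr (drsubmx M).
Proof. by rewrite -{1}[M]submxK mxtrace_block. Qed.

(** Multiply by the inverse of G and take traces. *)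
Lemma tr_sp (G A : 'M[K]_4) c : G \in unitmx -> A^T *m G + G *m A = c *: G ->
  \tr A = 2 * c.
Proof.
move=> uG' h; have := congr1 (fun X => \tr (X *m invmx G)) h.
rewrite mulmxDl raddfD /= mulmxK // mxtrace_tr mxtrace_mulC mulmxA mulVmx // mul1mx.
by rewrite -scalemxAl mulmxV // mxtraceZ mxtrace1 => h'; lra.
Qed.

(** The block below the diagonal vanishes because the bivector spans V4.  The
    remaining equation says that the block on V4 is symplectic up to a multiple of
    the identity, and comparing traces identifies this multiple with - tr(f2) /
    2. *)
Lemma in_split_classP (f : 'End(V)) : in_split_class V2 omega f <->
  @invariant_biv K (4 + 2) (end_mx split_basis f) split_biv.
Proof.
set G := gram omega x4.
split=> [[f2 [h [f4 [sp4 e2 e4]]]]|].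
  set a := end_mx x4 f4; set t := end_trace f2.
  pose M : 'M[K]_(4 + 2) := block_mx ((- (t / 2))%:M + a)
     (\matrix_(i, j) coord x4 i (h x2`_j)) 0 (end_mx x2 f2).
  have -> : end_mx split_basis f = M.
    apply: end_mx_split => j.
      rewrite e4 block_mxKul block_mxKdl [X in _ + vsval X]big1 ?linear0 ?addr0; last first.
        by move=> i _; rewrite mxE scale0r.
      rewrite (end_mxP f4 bx4) -/a.
      under [in RHS]eq_bigr => i _ do rewrite mxE scalerDl.
      rewrite big_split linearD /=; congr (_ + _).
      rewrite (bigD1 j) //= mxE eqxx mulr1n big1 ?addr0 ?linearZ // => i /negbTE ij.
      by rewrite mxE ij mulr0n scale0r.
    rewrite e2 addrC block_mxKur block_mxKdr (end_mxP f2 bx2); congr (_ + _); apply: congr1.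
    by rewrite {1}(coord_decomp bx4 (h _)); apply: eq_bigr => i _; rewrite mxE.
  have spm := (in_spP omega_form f4 bx4).1 sp4; rewrite -/a -/G in spm.
  have tra : \tr a = 0 by rewrite (tr_sp (c := 0) uG) ?mulr0 // spm scale0r.
  apply/invariant_split_biv; split; first by rewrite block_mxKdl.
  rewrite mxtrace_split block_mxKul block_mxKdr -(end_traceE f2 bx2) -/t -/G.
  rewrite mxtraceD tra mxtrace_scalar addr0 [(_ + _)^T]raddfD /= mulmxDr mulmxDl.
  rewrite addrACA tr_scalar_mx mul_scalar_mx mul_mx_scalar spm addr0 -scalerDl.
  by congr (_ *: _); lra.
set M := end_mx split_basis f => /invariant_split_biv[C0 eA].
set A := ulsubmx M in eA; set D := drsubmx M; set t := \tr D.
have [f2 hf2] := end_mx_surj D bx2.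
have [f4 hf4] := end_mx_surj (A + (t / 2)%:M) bx4.
pose hF (x : subvs_of V2) := \sum_j coord x2 j x *: \sum_i ursubmx M i j *: x4`_i.
have hlin : linear hF.
  move=> c x y; rewrite /hF scaler_sumr -big_split; apply: eq_bigr => j _ /=.
  by rewrite linearP scalerDl scalerA.
pose hL : {linear subvs_of V2 -> subvs_of V4} := HB.pack hF (GRing.isLinear.Build _ _ _ _ hF hlin).
have [h hE] : exists h : 'Hom(subvs_of V2, subvs_of V4), forall x, h x = hF x.
  by exists (linfun hL) => x; rewrite lfunE.
have trf2 : end_trace f2 = t by rewrite (end_traceE f2 bx2) hf2.
exists f2, h, f4; split.
- apply/(in_spP omega_form f4 bx4); rewrite hf4 [(_ + _)^T]raddfD /= mulmxDl mulmxDr addrACA eA.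
  rewrite tr_scalar_mx mul_scalar_mx mul_mx_scalar -!scalerDl -[RHS](scale0r G).
  congr (_ *: _); have := tr_sp uG eA; rewrite mxtrace_split -/A -/D -/t; lra.
- move=> x; rewrite (coord_decomp bx2 x) !linear_comb -big_split; apply: eq_bigr => j _ /=.
  rewrite -!scalerDr; congr (_ *: _).
  rewrite split_apply2 -/M addrC (end_mxP f2 bx2) hf2 hE /hF.
  congr (_ + _); apply: congr1; rewrite [RHS](bigD1 j) //= coord_eq // eqxx scale1r.
  by rewrite [X in _ + X]big1 ?addr0 // => k /negbTE kj; rewrite coord_eq // kj scale0r.
move=> x; rewrite (coord_decomp bx4 x) !linear_comb -big_split; apply: eq_bigr => j _ /=.
rewrite -!scalerDr; congr (_ *: _).
rewrite split_apply4 -/M C0 [X in _ + vsval X]big1 ?linear0 ?addr0; last first.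
  by move=> i _; rewrite mxE scale0r.
rewrite (end_mxP f4 bx4) hf4 trf2 -linearZ -linearD; apply: congr1.
under [in RHS]eq_bigr => i _ do rewrite mxE scalerDl.
rewrite big_split /= addrCA [X in _ = _ + X](_ : _ = 0) ?addr0 //.
rewrite (bigD1 j) //= mxE eqxx mulr1n big1 ?addr0 ?scaleNr ?addNr //.
by move=> i /negbTE ij; rewrite mxE ij mulr0n scale0r.
Qed.

End SplitClass.

Section Similarity.
Variables (R : realType) (V : vectType R).

(** Similar endomorphisms are those with conjugate matrices, each taken in a basis
    of its own. *)
Lemma GL_similar_mx n (e b : n.-tuple V) (f f' : 'End(V)) :
  basis_of {:V} e -> basis_of {:V} b ->
  GL_similar f f' <-> exists2 W : 'M[R]_n, W \in unitmx & end_mx b f' *m W = W *m end_mx e f.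
Proof.
move=> be bb; pose S := base_mx b e; pose S' := base_mx e b.
have SS' : S *m S' = 1%:M by apply: base_mxK.
have S'S : S' *m S = 1%:M by apply: base_mxK.
have [uS _] := mulmx1_unit SS'.
have fS : end_mx b f *m S = S *m end_mx e f by apply: end_mx_base.
split=> [[P [kP ->]]|[W uW hW]].
  have PP : (P \o P^-1)%VF = \1%VF by rewrite lker0_compfV.
  have P'P : (P^-1 \o P)%VF = \1%VF by rewrite lker0_compVf.
  have := congr1 (end_mx b) P'P; rewrite end_mx_comp // end_mx_id // => h.
  have [_ uP] := mulmx1_unit h.
  exists (end_mx b P *m S); first by rewrite unitmx_mul uP uS.
  by rewrite !end_mx_comp // -!mulmxA -fS (mulmxA _ (end_mx b P)) h mul1mx.
have [P hP] := end_mx_surj (W *m S') bb.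
have [P' hP'] := end_mx_surj (S *m invmx W) bb.
have PP' : (P \o P')%VF = \1%VF.
  apply: (end_mx_inj bb); rewrite end_mx_comp // end_mx_id // hP hP'.
  by rewrite mulmxA -(mulmxA W) S'S mulmx1 mulmxV.
have P'P : (P' \o P)%VF = \1%VF.
  apply: (end_mx_inj bb); rewrite end_mx_comp // end_mx_id // hP hP'.
  by rewrite mulmxA -(mulmxA S) mulVmx // mulmx1.
have kP : lker P == 0%VS.
  apply/lker0P => x y h.
  by rewrite -[x]id_lfunE -[y]id_lfunE -P'P !lfunE /= h.
have invP : (P^-1)%VF = P'.
  by rewrite -[LHS]comp_lfun1r -PP' comp_lfunA lker0_compVf // comp_lfun1l.
exists P; split=> //; apply: (end_mx_inj bb).
rewrite invP !end_mx_comp // hP hP'.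
have -> : end_mx b f = S *m end_mx e f *m S' by rewrite -fS -mulmxA SS' mulmx1.
rewrite -!mulmxA (mulmxA S' S) S'S mul1mx (mulmxA S' S) S'S mul1mx.
by rewrite mulmxA -hW mulmxK.
Qed.

Section SplitBiv.
Variable G : 'M[R]_4.
Hypothesis uG : G \in unitmx.
Hypothesis altG : alt_mx G.

Lemma alt_invmx : alt_mx (invmx G).
Proof.
have -> : invmx G = invmx G *m (- G) *m (invmx G)^T *m 1%:M *m 1%:M.
  have -> : - G = G^T by case: altG => _ h; apply/matrixP=> i j; rewrite !mxE h opprK.
  by rewrite trmx_inv -!mulmxA !mulmx1 mulmxV ?unitmx_tr // mulmx1.
rewrite !mulmx1; apply: alt_congr; rewrite -scaleN1r; exact: alt_scale.
Qed.

(** The bivector of [split_biv] as a function of the Gram matrix alone. *)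
Definition pad_biv : 'M[R]_(4 + 2) := block_mx (invmx G) 0 0 0.

Let inj4 : 'M[R]_(4 + 2, 4) := col_mx 1%:M 0.

Lemma pad_bivE : pad_biv = inj4 *m invmx G *m inj4^T.
Proof.
by rewrite /inj4 tr_col_mx trmx1 trmx0 mul_col_mx mul1mx mul0mx mul_mx_row
  mulmx1 mulmx0 -[RHS]/(row_mx (col_mx _ _) 0) -col_mx0 -block_mxEh.
Qed.

Lemma alt_pad : alt_mx (pad_biv : 'M_6).
Proof. by rewrite pad_bivE; apply: alt_congr; apply: alt_invmx. Qed.

Lemma rank_biv n (p q : 'cV[R]_n) : (\rank (biv p q) <= 2)%N.
Proof.
rewrite /biv (leq_trans (mxrank_add _ _)) // -[2%N]/(1 + 1)%N mxrank_opp.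
by apply: leq_add; rewrite (leq_trans (mxrankM_maxl _ _)) // rank_leq_col.
Qed.

Lemma rank_pad : rank_ge4 (pad_biv : 'M_6).
Proof.
case: (boolP (rank_ge4 _)) => // h.
have [p [q E]] := rank_lt4_biv alt_pad h.
(* Otherwise the invertible block of size four would itself be decomposable, hence
   of rank at most two. *)
have E' : invmx G = biv (inj4^T *m p) (inj4^T *m q).
  have K : inj4^T *m inj4 = 1%:M.
    by rewrite /inj4 tr_col_mx mul_row_col trmx1 mulmx1 trmx0 mul0mx addr0.
  rewrite -(congr_biv _ p q) -E pad_bivE trmxK !mulmxA K mul1mx -mulmxA K mulmx1 //.
have := rank_biv (inj4^T *m p) (inj4^T *m q).
by rewrite -E' mxrank_unit ?unitmx_inv.
Qed.

Lemma two_biv_pad : two_biv (pad_biv : 'M_6).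
Proof.
apply: rank4_two_biv; first exact: rank_pad.
apply: pf6_std; first exact: alt_pad.
have z (x : 'I_(4 + 2)) (k : 'I_2) : pad_biv x (rshift 4 k) = 0.
  rewrite /pad_biv block_mxEh row_mxEr mxE.
  by case: splitP => j _; rewrite mxE.
have e4 : inord 4 = rshift 4 (inord 0) :> 'I_6 by apply: val_inj; rewrite /= !inordK.
have e5 : inord 5 = rshift 4 (inord 1) :> 'I_6 by apply: val_inj; rewrite /= !inordK.
by rewrite /pf6 /pf4 e4 e5 !z; ring.
Qed.

End SplitBiv.

End Similarity.

Section SplitClassJordan.
Variables (R : realType) (V : vectType R) (V2 V4 : {vspace V}).
Hypotheses (dim_V2 : \dim V2 = 2%N) (dim_V4 : \dim V4 = 4%N).
Hypotheses (sum_V2_V4 : (V2 + V4 = {:V})%VS) (dx_V2_V4 : directv (V2 + V4)).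
Variable omega : kform (subvs_of V4) 2.
Hypothesis omega_form : alt_form omega.
Hypothesis omega_nondeg : nondegenerate2 (fun x y => omega (pair_arg x y)).
Variables (f : 'End(V)) (lam : 'I_6 -> R[i]) (jb : 'I_6 -> nat).
Hypothesis jordan : complex_jordan_form f lam jb.

(** Every bivector of rank four is congruent to the one attached to V2, V4 and
    omega, so (b) only says that some invariant real bivector has rank four. *)
Lemma split_class_pattern :
  (exists2 f' : 'End(V), GL_similar f f' & in_split_class V2 omega f')
  <-> block_pattern lam jb.
Proof.
have [jd [e [P [be uP FP]]]] := jordan.
have [x4 [bx4 bv4]] := subvs_basis dim_V4.
have [x2 [bx2 bv2]] := subvs_basis dim_V2.
have bV : basis_of {:V} (split_basis x4 x2).
  rewrite -sum_V2_V4 addvC; apply: cat_basis => //.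
  by apply/directv_addP; rewrite capvC; apply/directv_addP.
have uG : gram omega x4 \in unitmx by apply: gram_unit.
have altG : alt_mx (gram omega x4).
  by split=> [i|i j]; rewrite !mxE; [apply: form2_xx|apply: form2C].
split.
  move=> [f' /(GL_similar_mx _ _ be bV)[W uW hW]].
  move=> /(in_split_classP omega_form omega_nondeg bx4 bx2 bV) inv.
  have uW' : invmx W \in unitmx by rewrite unitmx_inv.
  apply: (invariant_pattern jd uP FP (B := invmx W *m pad_biv (gram omega x4) *m (invmx W)^T)).
  - exact/alt_congr/alt_pad.
  - apply: (invariant_biv_congr (F' := end_mx (split_basis x4 x2) f')) => //.
    by rewrite -[end_mx e f](mulKmx uW) -hW -!mulmxA mulmxV // mulmx1.
  - by apply: rank_ge4_congr => //; [apply: alt_pad|apply: rank_pad].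
move=> /(pattern_normal_form jd uP FP)[T uT invT].
have [T0 uT0 hT0] := two_biv_normal (two_biv_pad uG altG) (rank_pad uG altG).
have [f' hf'] := end_mx_surj (T0 *m (invmx T *m end_mx e f *m T) *m invmx T0 : 'M_(4 + 2)) bV.
exists f'.
  apply/(GL_similar_mx _ _ be bV); exists (T0 *m invmx T).
    by rewrite unitmx_mul uT0 unitmx_inv uT.
  by rewrite hf' -!mulmxA mulKmx // mulmxV // mulmx1.
apply/(in_split_classP omega_form omega_nondeg bx4 bx2 bV).
rewrite hf' -[split_biv _ _]/(pad_biv (gram omega x4)) hT0.
apply: (invariant_biv_congr (F' := invmx T *m end_mx e f *m T)) => //.
by rewrite mulmxKV.
Qed.

End SplitClassJordan.

(** * Wedge products of determinants *)

Section WedgeOfDeterminants.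
Variable K : comPzRingType.

Definition split_fun p q (s : 'S_p) (t : 'S_q) (x : 'I_(p + q)) : 'I_(p + q) :=
  match split x with inl i => lshift q (s i) | inr j => rshift p (t j) end.

Lemma split_fun_inj p q (s : 'S_p) (t : 'S_q) : injective (split_fun s t).
Proof.
move=> x y; rewrite /split_fun.
case: (splitP x) => i xi; case: (splitP y) => j yj /eqP.
- rewrite eq_lshift => /eqP/perm_inj ij; apply: val_inj; rewrite /= xi yj ij //.
- by rewrite eq_lrshift.
- by rewrite eq_rlshift.
- rewrite eq_rshift => /eqP/perm_inj ij; apply: val_inj; rewrite /= xi yj ij //.
Qed.

(** The permutation acting by s on the first p and by t on the last q elements. *)
Definition split_perm p q (s : 'S_p) (t : 'S_q) : 'S_(p + q) := perm (@split_fun_inj p q s t).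

Lemma split_perml p q (s : 'S_p) (t : 'S_q) i : split_perm s t (lshift q i) = lshift q (s i).
Proof. by rewrite permE /split_fun (unsplitK (inl _ i)). Qed.

Lemma split_permr p q (s : 'S_p) (t : 'S_q) j : split_perm s t (rshift p j) = rshift p (t j).
Proof. by rewrite permE /split_fun (unsplitK (inr _ j)). Qed.

Lemma sign_split_perm p q (s : 'S_p) (t : 'S_q) :
  (-1) ^+ split_perm s t = (-1) ^+ s * (-1) ^+ t :> K.
Proof.
rewrite -!det_perm -(det_lblock _ 0); congr (\det _); apply/matrixP=> x y.
case: (splitP x) => i xi.
  have -> : x = lshift q i by exact: val_inj.
  case: (splitP y) => j yj.
    have -> : y = lshift q j by exact: val_inj.
    by rewrite block_mxEul !mxE split_perml eq_lshift.
  have -> : y = rshift p j by exact: val_inj.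
  by rewrite block_mxEur !mxE split_perml eq_lrshift.
have -> : x = rshift p i by exact: val_inj.
case: (splitP y) => j yj.
  have -> : y = lshift q j by exact: val_inj.
  by rewrite block_mxEdl !mxE split_permr eq_rlshift.
have -> : y = rshift p j by exact: val_inj.
by rewrite block_mxEdr !mxE split_permr eq_rshift.
Qed.

(** Generalised Laplace expansion.  Expanding both minors and absorbing their
    permutations into s turns every one of the p! q! summands into the full
    determinant. *)
Lemma sum_perm_dets p q (M : 'M[K]_(p + q)) :
  \sum_(s : 'S_(p + q)) (-1) ^+ s *
    (\det (\matrix_(i < p, j < p) M (s (lshift q i)) (lshift q j)) *
     \det (\matrix_(i < q, j < q) M (s (rshift p i)) (rshift p j))) =
  (p`! * q`!)%N%:R * \det M.
Proof.
transitivity (\sum_(a : 'S_p) \sum_(b : 'S_q) \det M); last first.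
  by rewrite !sumr_const !card_Sn -mulrnA mulr_natl mulnC.
transitivity (\sum_(s : 'S_(p + q)) \sum_(a : 'S_p) \sum_(b : 'S_q)
    (-1) ^+ (s^-1 * split_perm a b)%g * \prod_x M x ((s^-1 * split_perm a b)%g x)).
  apply: eq_bigr => s _; rewrite big_distrlr mulr_sumr; apply: eq_bigr => a _.
  rewrite mulr_sumr; apply: eq_bigr => b _.
  rewrite odd_permM odd_permV signr_addb sign_split_perm.
  rewrite [X in _ = _ * X](reindex_inj (@perm_inj _ s)) big_split_ord /=.
  have -> : \prod_i (\matrix_(i < p, j < p) M (s (lshift q i)) (lshift q j)) i (a i)
      = \prod_(i < p) M (s (lshift q i)) ((s^-1 * split_perm a b)%g (s (lshift q i))).
    by apply: eq_bigr => i _; rewrite mxE permM permK split_perml.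
  have -> : \prod_i (\matrix_(i < q, j < q) M (s (rshift p i)) (rshift p j)) i (b i)
      = \prod_(i < q) M (s (rshift p i)) ((s^-1 * split_perm a b)%g (s (rshift p i))).
    by apply: eq_bigr => i _; rewrite mxE permM permK split_permr.
  have ac (x y z u v : K) : x * ((y * u) * (z * v)) = x * (y * z) * (u * v) by ring.
  exact: ac.
rewrite exchange_big; apply: eq_bigr => a _ /=.
rewrite exchange_big; apply: eq_bigr => b _ /=.
have inj : injective (fun s : 'S_(p + q) => (s^-1 * split_perm a b)%g).
  by move=> x y /mulIg /invg_inj.
by rewrite /determinant [RHS](reindex_inj inj).
Qed.

End WedgeOfDeterminants.

(** Laplace expansion over the integers that skips zero entries, which makes it fast
    on the matrices of coordinates of basis vectors. *)
Fixpoint zdet n (M : nat -> nat -> int) : int :=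
  if n is n'.+1 then
    foldr (fun i s => if M i 0%N == 0 then s else
        (-1) ^+ i * M i 0%N * zdet n' (fun a b => M (bump i a) b.+1) + s)
      0 (iota 0 n)
  else 1.

Lemma zdetE n M : zdet n M = \det (\matrix_(i < n, j < n) M i j).
Proof.
rewrite det_laplace; elim: n M => [//|n IH] M.
have foldrE (f g : nat -> int -> int) s : (forall i x, f i x = g i x) ->
    foldr f 0 s = foldr g 0 s by move=> h; elim: s => //= a s ->.
rewrite /zdet /laplace -/(zdet n) -/(@laplace _ n); apply: foldrE => i x.
by rewrite IH; case: eqP => [->|//]; rewrite mulr0 mul0r add0r.
Qed.

Section DeterminantForms.
Variables (R : realType) (V : vectType R) (e : 7.-tuple V).

(** Coordinates are numbered from zero: [coframe i] is the covector e^(i+1). *)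
Definition coframe (i : nat) (v : V) : R := coord e (inord i) v.

(** The wedge product of the covectors listed in l. *)
Definition det_form k (l : seq nat) : kform V k :=
  fun v => \det (\matrix_(i < k, j < k) coframe (nth 0%N l j) (v i)).
Arguments det_form : clear implicits.

Lemma wedge_det_form p q l m (v : {ffun 'I_(p + q) -> V}) : size l = p ->
  wedge (det_form p l) (det_form q m) v = det_form (p + q) (l ++ m) v.
Proof.
move=> sl; pose M : 'M[R]_(p + q) := \matrix_(i, j) coframe (nth 0%N (l ++ m) j) (v i).
have := sum_perm_dets M; rewrite /wedge => h.
rewrite -[det_form (p + q) _ _]/(\det M).
have nz : ((p`! * q`!)%N%:R : R) != 0 by rewrite pnatr_eq0 -lt0n muln_gt0 !fact_gt0.
apply: (mulfI nz); rewrite mulVKf // -h; apply: eq_bigr => s _; congr (_ * (_ * _)).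
  congr (\det _); apply/matrixP=> i j; rewrite !mxE !ffunE nth_cat sl.
  by rewrite (ltn_ord j).
congr (\det _); apply/matrixP=> i j; rewrite !mxE !ffunE nth_cat sl.
by rewrite ltnNge leq_addr addKn.
Qed.

Lemma alt_form_det_form k l : alt_form (det_form k l).
Proof.
split=> [v i c x y|v i j ij vij].
  rewrite -[det_form k l (subst_at v i y)]mul1r.
  apply: (determinant_multilinear (i0 := i)).
  - apply/rowP => j; rewrite !mxE !ffunE !eqxx mul1r /coframe linearP //.
  - apply/matrixP => a b; rewrite !mxE !ffunE.
    by rewrite eq_sym (negbTE (neq_lift _ _)).
  - apply/matrixP => a b; rewrite !mxE !ffunE.
    by rewrite eq_sym (negbTE (neq_lift _ _)).
by apply: (determinant_alternate ij) => b; rewrite !mxE vij.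
Qed.

(** A formal integer combination of products of basis covectors, as a form.  On such
    lists the exterior operations below are computable. *)
Definition eval_form k (F : seq (int * seq nat)) : kform V k :=
  fun v => \sum_(t <- F) t.1%:~R * det_form k t.2 v.
Arguments eval_form : clear implicits.

Lemma alt_form_sum k I (r : seq I) (c : I -> R) (a : I -> kform V k) :
  (forall i, alt_form (a i)) -> alt_form (fun v => \sum_(i <- r) c i * a i v).
Proof.
move=> ha; split=> [v i d x y|v i j ij vij].
  rewrite mulr_sumr -big_split; apply: eq_bigr => t _ /=.
  by have [-> _] := ha t; ring.
by rewrite big1 // => t _; have [_ h] := ha t; rewrite (h v i j ij vij) mulr0.
Qed.

Lemma alt_form_eval_form k F : alt_form (eval_form k F).
Proof. by apply: alt_form_sum => t; apply: alt_form_det_form. Qed.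

Lemma wedge_suml p q I (r : seq I) (c : I -> R) (a : I -> kform V p) (b : kform V q) v :
  wedge (fun v => \sum_(i <- r) c i * a i v) b v = \sum_(i <- r) c i * wedge (a i) b v.
Proof.
rewrite /wedge; under [RHS]eq_bigr => i _ do rewrite mulrCA.
rewrite -mulr_sumr; congr (_ * _).
under [RHS]eq_bigr => i _ do rewrite mulr_sumr.
rewrite exchange_big /=; apply: eq_bigr => s _.
by rewrite mulr_suml mulr_sumr; apply: eq_bigr => i _; rewrite -!mulrA mulrCA.
Qed.

Lemma wedge_sumr p q I (r : seq I) (c : I -> R) (a : kform V p) (b : I -> kform V q) v :
  wedge a (fun v => \sum_(i <- r) c i * b i v) v = \sum_(i <- r) c i * wedge a (b i) v.
Proof.
rewrite /wedge; under [RHS]eq_bigr => i _ do rewrite mulrCA.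
rewrite -mulr_sumr; congr (_ * _).
under [RHS]eq_bigr => i _ do rewrite mulr_sumr.
rewrite exchange_big /=; apply: eq_bigr => s _.
rewrite !mulr_sumr; apply: eq_bigr => i _.
have ac (x y z t : R) : x * (y * (z * t)) = z * (x * (y * t)) by ring.
exact: ac.
Qed.

Lemma eq_wedge p q (a a' : kform V p) (b b' : kform V q) v :
  a =1 a' -> b =1 b' -> wedge a b v = wedge a' b' v.
Proof.
by move=> ha hb; rewrite /wedge; congr (_ * _); apply: eq_bigr => s _; rewrite ha hb.
Qed.

Definition formal_wedge (F G : seq (int * seq nat)) : seq (int * seq nat) :=
  [seq (t.1 * u.1, t.2 ++ u.2) | t <- F, u <- G].

Lemma wedge_eval_form p q F G (v : {ffun 'I_(p + q) -> V}) : all (fun t => size t.2 == p) F ->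
  wedge (eval_form p F) (eval_form q G) v = eval_form (p + q) (formal_wedge F G) v.
Proof.
move=> hF; rewrite wedge_suml /eval_form big_allpairs_dep.
rewrite big_seq_cond [RHS]big_seq_cond; apply: eq_bigr => t; rewrite andbT => tF.
rewrite wedge_sumr mulr_sumr; apply: eq_bigr => u _.
rewrite wedge_det_form; last by apply/eqP/(allP hF).
by rewrite rmorphM mulrA.
Qed.

Hypothesis be : basis_of {:V} e.

Lemma coframe_basis i j : (i < 7)%N -> (j < 7)%N -> coframe i e`_j = (i == j)%:R.
Proof.
move=> i7 j7; have -> : e`_j = e`_(Ordinal j7) by [].
by rewrite /coframe coord_eq // -(inj_eq val_inj) /= inordK.
Qed.

(** Contraction with the i-th basis vector: the sign counts the covectors to the
    left of the one removed. *)
Definition formal_contract (i : nat) (F : seq (int * seq nat)) : seq (int * seq nat) :=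
  flatten [seq [seq (t.1 * (-1) ^+ j, take j t.2 ++ drop j.+1 t.2)
               | j <- iota 0 (size t.2) & nth 0%N t.2 j == i] | t <- F].

Lemma nth_remove (l : seq nat) j b : (j < size l)%N ->
  nth 0%N (take j l ++ drop j.+1 l) b = nth 0%N l (bump j b).
Proof.
move=> jl; rewrite nth_cat size_take jl /bump (leqNgt j b).
case: ltnP => h /=; first by rewrite nth_take // add0n.
by rewrite nth_drop; congr nth; lia.
Qed.

(** Expansion of the determinant along its first row, on which the covectors are
    evaluated at the basis vector. *)
Lemma contract_eval_form k F i v : (i < 7)%N ->
  all (fun t => (size t.2 == k.+1) && all (fun j => j < 7)%N t.2) F ->
  contract e`_i (eval_form k.+1 F) v = eval_form k (formal_contract i F) v.
Proof.
move=> i7 hF; rewrite /contract /eval_form big_flatten big_map.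
rewrite big_seq_cond [RHS]big_seq_cond; apply: eq_bigr => t; rewrite andbT => tF.
have /andP[/eqP st lt] := allP hF t tF.
rewrite big_map big_filter [RHS]big_mkcond /= st.
rewrite -[iota 0 k.+1]/(index_iota 0 k.+1) big_mkord /det_form (expand_det_row _ ord0) mulr_sumr.
apply: eq_bigr => j _; rewrite mxE ffunE unlift_none /=.
have lj : (nth 0%N t.2 j < 7)%N by apply: (allP lt); rewrite mem_nth // st.
rewrite coframe_basis //; case: eqP => _; last by rewrite mul0r mulr0.
rewrite mul1r /cofactor add0n rmorphM rmorphXn rmorphN1 mulrA; congr (_ * \det _).
apply/matrixP=> a b; rewrite !mxE ffunE /= liftK /= nth_remove // st //.
Qed.

Definition det_value k (l I : seq nat) : int :=
  zdet k (fun i j => (nth 0%N l j == nth 0%N I i)%:R).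

(** The value on the basis vectors with indices I. *)
Definition formal_value k F (I : seq nat) : int :=
  foldr (fun t s => t.1 * det_value k t.2 I + s) 0 F.

Lemma eval_form_basis k F (I : seq nat) (f : {ffun 'I_k -> V}) :
  (forall t, f t = e`_(nth 0%N I t)) -> size I = k -> all (fun j => j < 7)%N I ->
  all (fun t => (size t.2 == k) && all (fun j => j < 7)%N t.2) F ->
  eval_form k F f = (formal_value k F I)%:~R.
Proof.
move=> hf sI lI hF; rewrite /eval_form /formal_value.
rewrite (_ : foldr _ _ _ = \sum_(t <- F) t.1 * det_value k t.2 I); last first.
  by elim: F {hF} => [|t F IH]; rewrite ?big_nil // big_cons -IH.
rewrite rmorph_sum /= big_seq_cond [RHS]big_seq_cond; apply: eq_bigr => t; rewrite andbT => tF.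
have /andP[/eqP st lt] := allP hF t tF.
rewrite rmorphM /= /det_value zdetE -det_map_mx; congr (_ * \det _).
apply/matrixP=> a b; rewrite !mxE hf coframe_basis ?rmorph_nat //.
  by apply: (allP lt); rewrite mem_nth // st.
by apply: (allP lI); rewrite mem_nth // sI.
Qed.

(** The coefficient of the volume form in a formal form of top degree. *)
Definition top_coef (F : seq (int * seq nat)) : int := formal_value 7 F (iota 0 7).

Definition volume_form : kform V 7 := det_form 7 (iota 0 7).

Lemma eval_form_top F v : all (fun t => (size t.2 == 7) && all (fun j => j < 7)%N t.2) F ->
  eval_form 7 F v = (top_coef F)%:~R * volume_form v.
Proof.
move=> hF; rewrite /eval_form /top_coef /formal_value.
rewrite (_ : foldr _ _ _ = \sum_(t <- F) t.1 * det_value 7 t.2 (iota 0 7)); last first.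
  by elim: F {hF} => [|t F IH]; rewrite ?big_nil // big_cons -IH.
rewrite rmorph_sum mulr_suml big_seq_cond [RHS]big_seq_cond; apply: eq_bigr => t; rewrite andbT => tF.
have /andP[/eqP st lt] := allP hF t tF.
rewrite rmorphM -mulrA; congr (_ * _).
rewrite /det_value zdetE -det_map_mx mulrC -det_mulmx; congr (\det _).
apply/matrixP=> a b; rewrite !mxE.
have lb : (nth 0%N t.2 b < 7)%N by apply: (allP lt); rewrite mem_nth // st.
rewrite (bigD1 (Ordinal lb)) // !mxE !nth_iota // !add0n eqxx rmorph_nat mulr1.
rewrite big1 => [|j jb]; first exact: (esym (addr0 _)).
rewrite !mxE !nth_iota // !add0n.
case: eqP => [h|_]; last by rewrite rmorph0 mulr0.
by case/eqP: jb; apply: val_inj.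
Qed.

End DeterminantForms.

Arguments det_form {R V} e k l v.
Arguments eval_form {R V} e k F v.

(** * The model three-form and its dual *)

Definition metric_sign (i : nat) : int := if (i < 4)%N then -1 else 1.

Definition phi0 : seq (int * seq nat) :=
  [:: (-1, [:: 0; 1; 6]%N); (-1, [:: 2; 3; 6]%N); (1, [:: 4; 5; 6]%N); (1, [:: 0; 2; 4]%N);
      (-1, [:: 0; 3; 5]%N); (-1, [:: 1; 2; 5]%N); (-1, [:: 1; 3; 4]%N)].

Definition psi0 : seq (int * seq nat) :=
  [:: (-1, [:: 0; 1; 4; 5]%N); (-1, [:: 2; 3; 4; 5]%N); (1, [:: 0; 1; 2; 3]%N);
      (-1, [:: 1; 3; 5; 6]%N); (1, [:: 1; 2; 4; 6]%N); (1, [:: 0; 3; 4; 6]%N);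
      (1, [:: 0; 2; 5; 6]%N)].

(** Six times the product which determines the metric, at a pair of basis
    vectors. *)
Definition formal_cube (i j : nat) : seq (int * seq nat) :=
  formal_wedge (formal_wedge (formal_contract i phi0) (formal_contract j phi0)) phi0.

Definition of_degree k (F : seq (int * seq nat)) : bool :=
  all (fun t => (size t.2 == k) && all (fun j => j < 7)%N t.2) F.

(** In an adapted basis the metric equation holds with the diagonal metric and the
    volume form of the basis. *)
Lemma formal_cube_val : all (fun i => all (fun j => of_degree 7 (formal_cube i j) &&
    (top_coef (formal_cube i j) == 6%:Z * metric_sign i * (i == j)%:R)) (iota 0 7)) (iota 0 7).
Proof. by vm_compute. Qed.

Definition index_lists4 : seq (seq nat) :=
  [seq x ++ y | x <- [seq [:: i; j] | i <- iota 0 7, j <- iota 0 7], y <- [seq [:: i; j] | i <- iota 0 7, j <- iota 0 7]].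

(** At the basis covectors with indices I, the defining equation of the Hodge star:
    the left side is the induced inner product, the right side the wedge product. *)
Lemma hodge_val : all (fun I => formal_value 4 psi0 I * \prod_(i <- I) metric_sign i
    == top_coef [seq (t.1, t.2 ++ I) | t <- phi0]) index_lists4.
Proof.
by rewrite unlock; vm_compute.
Qed.

(** * Multilinear and alternating forms in a basis *)

Section Multilinear.
Variables (R : realType) (V : vectType R).

Definition vcons k (x : V) (v : {ffun 'I_k -> V}) : {ffun 'I_k.+1 -> V} :=
  [ffun i => oapp v x (unlift ord0 i)].

Lemma vcons_eta k (v : {ffun 'I_k.+1 -> V}) :
  v = vcons (v ord0) [ffun i => v (lift ord0 i)].
Proof.
by apply/ffunP=> i; rewrite ffunE; case: unliftP => [j ->|->] //=; rewrite ffunE.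
Qed.

Lemma subst_vcons0 k (x y : V) (v : {ffun 'I_k -> V}) : subst_at (vcons x v) ord0 y = vcons y v.
Proof.
by apply/ffunP=> i; rewrite !ffunE; case: unliftP => [j ->|->] //=; rewrite eq_sym (negbTE (neq_lift _ _)).
Qed.

Lemma subst_vconsS k (x y : V) (v : {ffun 'I_k -> V}) i :
  subst_at (vcons x v) (lift ord0 i) y = vcons x (subst_at v i y).
Proof.
apply/ffunP=> j; rewrite !ffunE; case: unliftP => [j' ->|->] /=.
  by rewrite ffunE (inj_eq lift_inj).
by [].
Qed.

Lemma multilinear_contract k (a : kform V k.+1) x : multilinear a -> multilinear (contract x a).
Proof.
move=> ma v i c y z; rewrite /contract -/(vcons x _) -/(vcons x (subst_at v i y)) -/(vcons x (subst_at v i z)).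
by rewrite -!subst_vconsS.
Qed.

Lemma contract_linear k (a : kform V k.+1) c x y v : multilinear a ->
  contract (c *: x + y) a v = c * contract x a v + contract y a v.
Proof.
move=> ma; rewrite /contract -/(vcons _ v) -/(vcons x v) -/(vcons y v).
by rewrite -(subst_vcons0 0 _ v) ma !subst_vcons0.
Qed.

Lemma contract_sum k (a : kform V k.+1) n (c : 'I_n -> R) (x : 'I_n -> V) v : multilinear a ->
  contract (\sum_i c i *: x i) a v = \sum_i c i * contract (x i) a v.
Proof.
move=> ma; have z : contract 0 a v = 0.
  by have := contract_linear (-1) 0 0 v ma; rewrite scaleN1r oppr0 addr0 mulN1r addNr.
elim/big_rec2: _ => [//|i y1 y2 _ IH]; by rewrite contract_linear // IH.
Qed.

Variables (n : nat) (e : n.-tuple V).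
Hypothesis be : basis_of {:V} e.

Definition etuple k (P : 'I_k -> 'I_n) : {ffun 'I_k -> V} := [ffun t => e`_(P t)].

Definition fcons (T : finType) k (xP : T * {ffun 'I_k -> T}) : {ffun 'I_k.+1 -> T} :=
  [ffun i => oapp xP.2 xP.1 (unlift ord0 i)].

(** Index maps on k + 1 elements are pairs of a value at zero and an index map on k
    elements. *)
Lemma sum_fcons (T : finType) k (F : {ffun 'I_k.+1 -> T} -> R) :
  \sum_P F P = \sum_x \sum_P F (fcons (x, P)).
Proof.
rewrite pair_bigA /=.
pose g (P : {ffun 'I_k.+1 -> T}) : T * {ffun 'I_k -> T} := (P ord0, [ffun i => P (lift ord0 i)]).
rewrite (reindex (@fcons T k)) /=; first by apply: eq_bigr => -[].
exists g => [[x P] _|P _].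
  rewrite /g /fcons /= ffunE unlift_none /=; congr (_, _).
  by apply/ffunP=> i; rewrite !ffunE liftK.
by apply/ffunP=> i; rewrite ffunE /=; case: unliftP => [j ->|->] //=; rewrite ffunE.
Qed.

(** Induction on the degree: contraction with the first argument is again
    multilinear. *)
Lemma multilinear_expand k (a : kform V k) v : multilinear a ->
  a v = \sum_(P : {ffun 'I_k -> 'I_n}) (\prod_t coord e (P t) (v t)) * a (etuple P).
Proof.
elim: k a v => [|k IH] a v ma.
  rewrite (bigD1 (ffun0 (card_ord 0))) //=.
  rewrite big_ord0 mul1r big1 ?addr0 => [|P /eqP[]]; last by apply/ffunP=> -[].
  by congr a; apply/ffunP=> -[].
rewrite sum_fcons {1}(vcons_eta v) -/(contract (v ord0) a _).
rewrite {1}(coord_decomp be (v ord0)) contract_sum //; apply: eq_bigr => i _.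
rewrite (IH _ _ (multilinear_contract _ ma)) mulr_sumr; apply: eq_bigr => P _.
rewrite mulrA big_ord_recl /= ffunE unlift_none /=; congr (_ * _ * _).
  by apply: eq_bigr => t _; rewrite !ffunE liftK.
congr a; apply/ffunP=> t; rewrite !ffunE.
by case: unliftP => [j _|_] //=; rewrite !ffunE.
Qed.

Lemma multilinear_scale k (a : kform V k) (d : 'I_k -> R) (w : 'I_k -> V) : multilinear a ->
  a [ffun t => d t *: w t] = (\prod_t d t) * a [ffun t => w t].
Proof.
move=> ma; rewrite (multilinear_expand _ ma) [in RHS](multilinear_expand _ ma) mulr_sumr.
apply: eq_bigr => P _; rewrite mulrA -big_split; congr (_ * _).
by apply: eq_bigr => t _; rewrite !ffunE linearZ.
Qed.

End Multilinear.

Section Alternating.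
Variables (R : realType) (V : vectType R).

(** Evaluate the form with v i + v j in both places. *)
Lemma alt_form_tperm k (a : kform V k) (v : {ffun 'I_k -> V}) i j : alt_form a -> i != j ->
  a [ffun t => v (tperm i j t)] = - a v.
Proof.
move=> [ma aa] ij; have ji : j != i by rewrite eq_sym.
pose w x y := subst_at (subst_at v i x) j y.
have wl c x y z : a (w (c *: x + y) z) = c * a (w x z) + a (w y z).
  have sw x' : w x' z = subst_at (subst_at v j z) i x'.
    by apply/ffunP=> t; rewrite !ffunE; case: (eqVneq t j) => [->|//]; rewrite (negbTE ji).
  by rewrite !sw ma.
have wr c x y z : a (w z (c *: x + y)) = c * a (w z x) + a (w z y) by rewrite /w ma.
have w0 x : a (w x x) = 0.
  by apply: (aa _ i j ij); rewrite /w !ffunE !eqxx ?(negbTE ij) ?eqxx.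
have wlD x y z : a (w (x + y) z) = a (w x z) + a (w y z).
  by have := wl 1 x y z; rewrite scale1r mul1r.
have wrD x y z : a (w z (x + y)) = a (w z x) + a (w z y).
  by have := wr 1 x y z; rewrite scale1r mul1r.
have := w0 (v i + v j); rewrite wlD !wrD !w0 addr0 add0r => /eqP.
have -> : w (v i) (v j) = v.
  by apply/ffunP=> t; rewrite !ffunE; case: (eqVneq t j) => [->//|_]; case: eqP => [->|].
have -> : w (v j) (v i) = [ffun t => v (tperm i j t)].
  by apply/ffunP=> t; rewrite !ffunE; case: tpermP => [->|->|/eqP/negbTE-> /eqP/negbTE->];
    rewrite ?eqxx ?(negbTE ij).
by rewrite addrC addr_eq0 => /eqP.
Qed.

Lemma alt_form_perm k (a : kform V k) (v : {ffun 'I_k -> V}) (s : 'S_k) : alt_form a ->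
  a [ffun t => v (s t)] = (-1) ^+ s * a v.
Proof.
move=> aa; have [ts -> dts] := prod_tpermP s.
elim: ts v dts => [|[i j] ts IH] v.
  rewrite big_nil odd_perm1 mul1r => _; congr a.
  by apply/ffunP=> t; rewrite ffunE perm1.
move=> /= /andP[ij dts]; rewrite big_cons odd_permM odd_tperm ij signr_addb expr1 mulN1r.
rewrite mulNr -IH // -(alt_form_tperm _ aa ij); congr a.
by apply/ffunP=> t; rewrite !ffunE permM.
Qed.

End Alternating.

(** * The metric and the Hodge star of the model *)

Section OrthonormalBasis.
Variables (R : realType) (V : vectType R) (e : 7.-tuple V).
Hypothesis be : basis_of {:V} e.

Definition metric_signR (i : 'I_7) : R := (metric_sign i)%:~R.

Lemma metric_signRE i : metric_signR i = if (i < 4)%N then -1 else 1.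
Proof. by rewrite /metric_signR /metric_sign; case: ifP. Qed.

Lemma metric_signR_sq i : metric_signR i * metric_signR i = 1.
Proof. by rewrite metric_signRE; case: ifP => _; rewrite ?mulrNN mulr1. Qed.

Variable h : V -> V -> R.
Hypothesis hb : bilinear_for *%R *%R h.
Hypothesis ho : forall i j : 'I_7, h e`_i e`_j =
  if i == j then (if (i < 4)%N then -1 else 1) else 0.

Lemma bilinear_suml n (c : 'I_n -> R) (x : 'I_n -> V) y :
  h (\sum_i c i *: x i) y = \sum_i c i * h (x i) y.
Proof.
have hl a u v : h (a *: u + v) y = a * h u y + h v y by have [+ _] := hb; apply.
have h0 : h 0 y = 0 by have := hl (-1) 0 0; rewrite scaleN1r oppr0 addr0 mulN1r addNr.
by elim/big_rec2: _ => [//|i y1 y2 _ IH]; rewrite hl IH.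
Qed.

Lemma bilinear_sumr n (c : 'I_n -> R) (x : 'I_n -> V) y :
  h y (\sum_i c i *: x i) = \sum_i c i * h y (x i).
Proof.
have hl a u v : h y (a *: u + v) = a * h y u + h y v by have [_ +] := hb; apply.
have h0 : h y 0 = 0 by have := hl (-1) 0 0; rewrite scaleN1r oppr0 addr0 mulN1r addNr.
by elim/big_rec2: _ => [//|i y1 y2 _ IH]; rewrite hl IH.
Qed.

Let D : 'M[R]_7 := diag_mx (\row_i metric_signR i).

Let DE i j : D i j = h e`_i e`_j.
Proof. by rewrite ho mxE mxE metric_signRE; case: eqP => _; rewrite ?mulr1n ?mulr0n. Qed.

Lemma orthonormal_gram n (x : n.-tuple V) :
  (\matrix_(i, j) h x`_i x`_j) = (base_mx e x)^T *m D *m base_mx e x.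
Proof.
apply/matrixP=> i j; rewrite mxE (coord_decomp be x`_i) (coord_decomp be x`_j).
rewrite bilinear_suml mxE.
under [RHS]eq_bigr => k _ do rewrite mxE mulr_suml.
rewrite [RHS]exchange_big; apply: eq_bigr => k _ /=.
rewrite bilinear_sumr mulr_sumr; apply: eq_bigr => l _.
by rewrite DE !mxE; ring.
Qed.

(** The inverse Gram matrix of any basis, transported to an orthonormal basis, is
    the diagonal matrix of the signs. *)
Lemma gram_invE :
  base_mx e (vbasis {:V}) *m gram_inv h *m (base_mx e (vbasis {:V}))^T = D.
Proof.
have bv := vbasisP {:V}.
set A := base_mx _ _; pose A' := base_mx (vbasis {:V}) e.
have AA' : A *m A' = 1%:M by apply: base_mxK.
have A'A : A' *m A = 1%:M by apply: base_mxK.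
have DD : D *m D = 1%:M.
  rewrite /D mulmx_diag; apply/matrixP=> i j; rewrite !mxE metric_signR_sq.
  by [].
have AT : A^T *m A'^T = 1%:M by rewrite -trmx_mul A'A trmx1.
have A'T : A'^T *m A^T = 1%:M by rewrite -trmx_mul AA' trmx1.
have inv : gram_inv h = A' *m D *m A'^T.
  rewrite /gram_inv orthonormal_gram -/A.
  have K : (A^T *m D *m A) *m (A' *m D *m A'^T) = 1%:M.
    by rewrite -!mulmxA (mulmxA A A') AA' mul1mx (mulmxA D D) DD mul1mx AT.
  have [uG _] := mulmx1_unit K.
  by rewrite -[LHS]mulmx1 -K mulKmx.
by rewrite inv -!mulmxA A'T mulmx1 mulmxA AA' mul1mx.
Qed.

(** The induced inner product can be computed in an orthonormal basis: expanding
    both forms in it, the sums over the original basis factor into the entries of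
    the transported inverse Gram matrix. *)
Lemma form_metricE k (a b : kform V k) : multilinear a -> multilinear b ->
  form_metric h a b = (k`!%:R)^-1 *
    \sum_(P : {ffun 'I_k -> 'I_7}) (\prod_t metric_signR (P t)) * a (etuple e P) * b (etuple e P).
Proof.
move=> ma mb; congr (_ * _).
pose A := base_mx e (vbasis {:V}).
pose G := gram_inv h.
have aE (c : kform V k) (I : {ffun 'I_k -> 'I_(\dim {:V})}) : multilinear c ->
    c [ffun t => (vbasis {:V})`_(I t)] =
    \sum_(P : {ffun 'I_k -> 'I_7}) (\prod_t A (P t) (I t)) * c (etuple e P).
  move=> mc; rewrite (multilinear_expand be _ mc); apply: eq_bigr => P _.
  by congr (_ * _); apply: eq_bigr => t _; rewrite ffunE mxE.
transitivity (\sum_(P : {ffun 'I_k -> 'I_7}) \sum_(Q : {ffun 'I_k -> 'I_7})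
   (\prod_t D (P t) (Q t)) * (a (etuple e P) * b (etuple e Q))).
  transitivity (\sum_(I : {ffun 'I_k -> 'I_(\dim {:V})}) \sum_(J : {ffun 'I_k -> 'I_(\dim {:V})})
    \sum_(P : {ffun 'I_k -> 'I_7}) \sum_(Q : {ffun 'I_k -> 'I_7})
     (\prod_t (A (P t) (I t) * G (I t) (J t) * A (Q t) (J t))) * (a (etuple e P) * b (etuple e Q))).
    apply: eq_bigr => I _; apply: eq_bigr => J _.
    rewrite (aE _ I ma) (aE _ J mb) -mulrA big_distrlr mulr_sumr.
    apply: eq_bigr => P _; rewrite mulr_sumr; apply: eq_bigr => Q _.
    rewrite !big_split /=.
    have ac (x y z u v : R) : x * (y * z * (u * v)) = y * x * u * (z * v) by ring.
    exact: ac.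
  under eq_bigr => I _ do rewrite exchange_big /=.
  rewrite exchange_big /=; apply: eq_bigr => P _.
  under eq_bigr => I _ do rewrite exchange_big /=.
  rewrite exchange_big /=; apply: eq_bigr => Q _.
  under eq_bigr => I _ do rewrite -mulr_suml.
  rewrite -mulr_suml; congr (_ * _).
  under [LHS]eq_bigr => I _ do rewrite -(bigA_distr_bigA (fun t j => A (P t) (I t) * G (I t) j * A (Q t) j)).
  rewrite -(bigA_distr_bigA (fun t i => \sum_j A (P t) i * G i j * A (Q t) j)) /=.
  apply: eq_bigr => t _; rewrite -gram_invE -/A -/G mxE exchange_big /=.
  apply: eq_bigr => j _; rewrite !mxE mulr_suml; apply: eq_bigr => i _.
  by rewrite !mxE.
apply: eq_bigr => P _; rewrite (bigD1 P) //= [X in _ + X]big1.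
  rewrite addr0 -[RHS]mulrA; congr (_ * _); apply: eq_bigr => t _.
  by rewrite mxE mxE eqxx.
move=> Q QP; have [t tQ] : exists t, P t != Q t.
  apply/existsP; apply: contraNT QP; rewrite negb_exists => /forallP H.
  by apply/eqP/ffunP => t; move: (H t); rewrite negbK => /eqP.
by rewrite (bigD1 t) //= !mxE (negbTE tQ) mulr0n !mul0r.
Qed.

End OrthonormalBasis.

(** The index map as a list, the form in which the covectors of [det_form] are
    given. *)
Definition index_list k (P : {ffun 'I_k -> 'I_7}) : seq nat := [seq val (P t) | t <- enum 'I_k].

Lemma size_index_list k (P : {ffun 'I_k -> 'I_7}) : size (index_list P) = k.
Proof. by rewrite size_map size_enum_ord. Qed.

Lemma nth_index_list k (P : {ffun 'I_k -> 'I_7}) (t : 'I_k) : nth 0%N (index_list P) t = P t.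
Proof. by rewrite (nth_map t) ?size_enum_ord // nth_ord_enum. Qed.

Lemma index_list_lt k (P : {ffun 'I_k -> 'I_7}) : all (fun j => j < 7)%N (index_list P).
Proof. by apply/allP => _ /mapP[t _ ->]; apply: ltn_ord. Qed.

Lemma index_list4 (P : {ffun 'I_4 -> 'I_7}) : index_list P \in index_lists4.
Proof.
have h (t : 'I_4) : val (P t) \in iota 0 7 by rewrite mem_iota ltn_ord.
rewrite /index_list enum_ordSl enum_ordSl enum_ordSl enum_ordSl enum_ord0 /=.
set a := nat_of_ord _; set b := nat_of_ord _; set c := nat_of_ord _; set d := nat_of_ord _.
apply: (allpairs_f cat (x := [:: a; b]) (y := [:: c; d]));
  by apply: (allpairs_f (fun i j => [:: i; j])); apply: h.
Qed.

Section CocalibratedModel.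
Variables (R : realType) (V : vectType R) (e : 7.-tuple V).
Hypothesis be : basis_of {:V} e.

Lemma det_form_index k (P : {ffun 'I_k -> 'I_7}) v :
  det_form e k (index_list P) v = \det (\matrix_(i, j) coord e (P j) (v i)).
Proof.
congr (\det _); apply/matrixP=> i j; rewrite !mxE nth_index_list /coframe; congr (coord _ _ _).
by apply: val_inj; rewrite /= inordK.
Qed.

(** Expand in the basis and average over all permutations of the arguments. *)
Lemma alt_form_expand k (a : kform V k) v : alt_form a ->
  a v = \sum_(P : {ffun 'I_k -> 'I_7}) (a (etuple e P) / k`!%:R) * det_form e k (index_list P) v.
Proof.
move=> aa; have [ma _] := aa.
have nz : (k`!%:R : R) != 0 by rewrite pnatr_eq0 -lt0n fact_gt0.
apply: (mulfI nz); rewrite mulr_sumr.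
transitivity (\sum_(s : 'S_k) a v); first by rewrite sumr_const card_Sn mulr_natl.
transitivity (\sum_(s : 'S_k) \sum_(P : {ffun 'I_k -> 'I_7})
   a (etuple e P) * ((-1) ^+ s * \prod_i coord e (P (s i)) (v i))).
  apply: eq_bigr => s _.
  pose g (P : {ffun 'I_k -> 'I_7}) : {ffun 'I_k -> 'I_7} := [ffun t => P (s t)].
  have gi : injective g.
    move=> P Q /ffunP h; apply/ffunP => t; have := h ((s^-1)%g t).
    by rewrite !ffunE permKV.
  rewrite (multilinear_expand be v ma) (reindex_inj gi); apply: eq_bigr => P _.
  have -> : etuple e (g P) = [ffun t => (etuple e P) (s t)].
    by apply/ffunP=> t; rewrite !ffunE.
  have ac (x y z : R) : x * (y * z) = z * (y * x) by ring.
  rewrite (alt_form_perm _ _ aa) ac; congr (_ * (_ * _)).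
  by apply: eq_bigr => t _; rewrite ffunE.
rewrite exchange_big; apply: eq_bigr => P _ /=.
rewrite det_form_index mulrA mulrCA divff // mulr1 -mulr_sumr; congr (_ * _).
apply: eq_bigr => s _; congr (_ * _).
by apply: eq_bigr => i _; rewrite !mxE.
Qed.

Definition metric7 (x y : V) : R := \sum_i metric_signR R i * coord e i x * coord e i y.

Lemma volume_form_basis : volume_form e (etuple e id) = 1.
Proof.
rewrite /volume_form /det_form -[RHS](det1 R 7); congr (\det _); apply/matrixP=> i j.
rewrite !mxE nth_iota // add0n ffunE coframe_basis ?ltn_ord // -(inj_eq val_inj) /=.
by rewrite eq_sym.
Qed.

Variable phi : kform V 3.
Hypothesis phiE : forall v, phi v = eval_form e 3 phi0 v.

Lemma contract_phi x v : contract x phi v = \sum_(i : 'I_7) coord e i x * eval_form e 2 (formal_contract i phi0) v.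
Proof.
have [m0 _] := alt_form_eval_form e 3 phi0.
transitivity (contract x (eval_form e 3 phi0) v); first by rewrite /contract phiE.
rewrite {1}(coord_decomp be x) contract_sum //; apply: eq_bigr => i _.
by rewrite (contract_eval_form be).
Qed.

(** Both sides are bilinear in x and y and of top degree, which reduces the equation
    to [formal_cube_val]. *)
Lemma metric_identity x y v :
  6^-1 * wedge (wedge (contract x phi) (contract y phi)) phi v = metric7 x y * volume_form e v.
Proof.
have E : wedge (wedge (contract x phi) (contract y phi)) phi v =
  \sum_(i : 'I_7) coord e i x * \sum_(j : 'I_7) coord e j y *
     ((top_coef (formal_cube i j))%:~R * volume_form e v).
  transitivity (wedge (fun w => \sum_(i : 'I_7) coord e i x *
      (fun w' => \sum_(j : 'I_7) coord e j y *
          wedge (eval_form e 2 (formal_contract i phi0)) (eval_form e 2 (formal_contract j phi0)) w') w) (eval_form e 3 phi0) v).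
    apply: eq_wedge => // w.
    rewrite (eq_wedge _ (contract_phi x) (contract_phi y)) wedge_suml.
    by apply: eq_bigr => i _; rewrite wedge_sumr.
  rewrite wedge_suml; apply: eq_bigr => i _; congr (_ * _).
  rewrite wedge_suml; apply: eq_bigr => j _; congr (_ * _).
  have := allP formal_cube_val i; rewrite mem_iota => /(_ (ltn_ord i)) /allP/(_ (val j)).
  rewrite mem_iota => /(_ (ltn_ord j)) /andP[wf _].
  rewrite -(eval_form_top e v wf).
  have <- : wedge (eval_form e 4 (formal_wedge (formal_contract i phi0) (formal_contract j phi0))) (eval_form e 3 phi0) v
      = eval_form e 7 (formal_cube i j) v.
    apply: (@wedge_eval_form _ _ e 4 3).
    have : all (fun i => all (fun j => all (fun t => size t.2 == 4%N)
       (formal_wedge (formal_contract i phi0) (formal_contract j phi0))) (iota 0 7)) (iota 0 7) by vm_compute.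
    move=> /allP/(_ (val i)); rewrite mem_iota => /(_ (ltn_ord i)) /allP/(_ (val j)).
    by rewrite mem_iota => /(_ (ltn_ord j)).
  apply: eq_wedge => // w; apply: wedge_eval_form.
  have : all (fun i => all (fun t => size t.2 == 2%N) (formal_contract i phi0)) (iota 0 7) by vm_compute.
  by move=> /allP/(_ (val i)); rewrite mem_iota => /(_ (ltn_ord i)).
rewrite E /metric7 mulr_suml mulr_sumr; apply: eq_bigr => i _.
rewrite (bigD1 i) //= big1 ?addr0 => [|j ji].
  have := allP formal_cube_val i; rewrite mem_iota => /(_ (ltn_ord i)) /allP/(_ (val i)).
  rewrite mem_iota => /(_ (ltn_ord i)) /andP[_ /eqP->]; rewrite eqxx mulr1 rmorphM /= /metric_signR.
  by field.
have := allP formal_cube_val i; rewrite mem_iota => /(_ (ltn_ord i)) /allP/(_ (val j)).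
rewrite mem_iota => /(_ (ltn_ord j)) /andP[_ /eqP->].
by rewrite [_ == _](_ : _ = false) ?mulr0 ?rmorph0 ?mul0r ?mulr0 //; apply/negbTE; rewrite eq_sym.
Qed.

Definition star_phi0 : kform V 4 := eval_form e 4 psi0.

(** By linearity in chi it is enough to compare products of basis covectors, where
    it is [hodge_val]. *)
Lemma hodge_identity (h : V -> V -> R) (chi : kform V 4) v :
  bilinear_for *%R *%R h ->
  (forall i j : 'I_7, h e`_i e`_j = if i == j then (if (i < 4)%N then -1 else 1) else 0) ->
  alt_form chi ->
  wedge phi chi v = form_metric h star_phi0 chi * volume_form e v.
Proof.
move=> hb ho ac; have [mc _] := ac; have [ms _] := alt_form_eval_form e 4 psi0.
rewrite (form_metricE be hb ho ms mc); have [W EW] : exists W, W = volume_form e v by eexists.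
rewrite -EW mulr_sumr mulr_suml.
rewrite (eq_wedge (a' := eval_form e 3 phi0) (b' := fun w => \sum_(P : {ffun 'I_4 -> 'I_7})
   (chi (etuple e P) / 4`!%:R) * det_form e 4 (index_list P) w)) => [||w]; last 2 first.
- exact: phiE.
- exact: alt_form_expand.
rewrite wedge_sumr; apply: eq_bigr => P _.
have -> : wedge (eval_form e 3 phi0) (det_form e 4 (index_list P)) v
    = eval_form e 7 [seq (t.1, t.2 ++ index_list P) | t <- phi0] v.
  rewrite (eq_wedge (a' := eval_form e 3 phi0) (b' := eval_form e 4 [:: (1, index_list P)])) //; last first.
    by move=> w; rewrite /eval_form big_seq1 mul1r.
  by rewrite wedge_eval_form.
rewrite eval_form_top -?EW; last first.
  rewrite all_map; apply/allP => t tp /=; rewrite size_cat size_index_list all_cat index_list_lt andbT.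
  by have /allP/(_ t tp) : all (fun t => (size t.2 + 4 == 7)%N && all (fun j => j < 7)%N t.2) phi0.
rewrite -(eqP (allP hodge_val _ (index_list4 P))).
rewrite (eval_form_basis be (I := index_list P)) ?size_index_list ?index_list_lt //; last first.
  by move=> t; rewrite ffunE nth_index_list.
rewrite rmorphM /= rmorph_prod /= big_map big_enum /=.
have acR (t x y z w : R) : z * t * (y * x * w) = t * (x * y * z) * w by ring.
exact: acR.
Qed.

End CocalibratedModel.

Section AdaptedBases.
Variables (R : realType) (V : vectType R).

Lemma covE (e : 7.-tuple V) i v : cov e i v = det_form e 1 [:: i.-1] v.
Proof. by rewrite /det_form det_mx11 mxE. Qed.

Lemma cov3E (e : 7.-tuple V) i j k v : cov3 e i j k v = det_form e 3 [:: i.-1; j.-1; k.-1] v.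
Proof.
rewrite -(@wedge_det_form _ _ e 2 1 [:: i.-1; j.-1] [:: k.-1] v) //.
apply: eq_wedge => w; last exact: covE.
rewrite -(@wedge_det_form _ _ e 1 1 [:: i.-1] [:: j.-1] w) //.
by apply: eq_wedge => w'; apply: covE.
Qed.

Lemma adapted_basisE (phi : kform V 3) (e : 7.-tuple V) :
  adapted_basis phi e <-> basis_of {:V} e /\ forall v, phi v = eval_form e 3 phi0 v.
Proof.
have E v : eval_form e 3 phi0 v = - cov3 e 1 2 7 v - cov3 e 3 4 7 v + cov3 e 5 6 7 v + cov3 e 1 3 5 v
    - cov3 e 1 4 6 v - cov3 e 2 3 6 v - cov3 e 2 4 5 v.
  by rewrite /eval_form !cov3E !big_cons big_nil /=; ring.
by split=> -[be h]; split=> // v; rewrite h E.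
Qed.

Lemma metric7_bilinear (e : 7.-tuple V) : bilinear_for *%R *%R (metric7 e).
Proof.
split=> [y|x] a u v; rewrite /metric7 /= mulr_sumr -big_split; apply: eq_bigr => i _ /=;
  by rewrite linearP /=; ring.
Qed.

Lemma metric7_sym (e : 7.-tuple V) x y : metric7 e x y = metric7 e y x.
Proof. by apply: eq_bigr => i _; ring. Qed.

Lemma metric7_basis (e : 7.-tuple V) (be : basis_of {:V} e) (i j : 'I_7) :
  metric7 e e`_i e`_j = if i == j then (if (i < 4)%N then -1 else 1) else 0.
Proof.
rewrite /metric7 (bigD1 i) //= big1 ?addr0 => [|k ki].
  by rewrite !coord_eq // eqxx mulr1 metric_signRE; case: eqP; rewrite ?mulr1 ?mulr0.
by rewrite coord_eq // (negbTE ki) mulr0 mul0r.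
Qed.

Lemma metric7_nondeg (e : 7.-tuple V) (be : basis_of {:V} e) : nondegenerate2 (metric7 e).
Proof.
move=> x h; rewrite (coord_decomp be x) big1 // => i _.
have := h e`_i; rewrite /metric7 (bigD1 i) //= big1 ?addr0 => [|k ki]; last first.
  by rewrite coord_eq // (negbTE ki) mulr0.
rewrite coord_eq // eqxx mulr1 => /(congr1 (fun z => metric_signR R i * z)).
by rewrite mulrA metric_signR_sq mul1r mulr0 => ->; rewrite scale0r.
Qed.

Lemma volume_form_det (e e' : 7.-tuple V) : volume_form e (etuple e' id) = \det (base_mx e e').
Proof.
rewrite /volume_form /det_form -det_tr; congr (\det _); apply/matrixP=> i j; rewrite !mxE ffunE /coframe nth_iota // add0n.
by congr (coord _ _ _); apply: val_inj; rewrite /= inordK.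
Qed.

Lemma pow9_eq1 (c : R) : c ^+ 9 = 1 -> c = 1.
Proof.
move=> h; have c0 : 0 < c.
  have : 0 < c * (c ^+ 4) ^+ 2 by rewrite -exprM -exprS h.
  have [//|cn|<-] := ltgtP 0 c; last by rewrite mul0r ltxx.
  by rewrite ltNge => /negP[]; rewrite mulr_le0_ge0 ?sqr_ge0 // ltW.
by apply/eqP; rewrite -(@pexpr_eq1 _ c 9) ?ltW // h.
Qed.

(** For a second adapted basis let c be the determinant of the change of basis.  The
    metric equation in both bases gives Gram matrices proportional by c, hence c^7
    c^2 = 1 and c = 1. *)
Lemma model_metric (e : 7.-tuple V) (be : basis_of {:V} e) :
  G2star_metric (eval_form e 3 phi0) (metric7 e) (volume_form e).
Proof.
split.
- by split; [apply: metric7_bilinear|apply: metric7_sym|apply: metric7_nondeg].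
- exact: alt_form_det_form.
- by move=> x y v; rewrite (metric_identity be).
move=> e' /adapted_basisE[be' h].
rewrite -/(etuple e' id).
set c := volume_form e _.
have E x y : metric7 e' x y = metric7 e x y * c.
  have := metric_identity be' h x y (etuple e' id).
  rewrite volume_form_basis // mulr1 => <-.
  by rewrite (metric_identity be (fun v => erefl)).
have c9 : c ^+ 9 = 1.
  pose D : 'M[R]_7 := diag_mx (\row_i metric_signR R i).
  have gE : \matrix_(i, j) metric7 e e'`_i e'`_j = (base_mx e e')^T *m D *m base_mx e e'.
    by apply: (orthonormal_gram be); [apply: metric7_bilinear|apply: metric7_basis].
  have DE : D = c *: ((base_mx e e')^T *m D *m base_mx e e').
    rewrite -gE; apply/matrixP=> i j; rewrite !mxE mulrC -E metric7_basis // metric_signRE.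
    by case: eqP; rewrite ?mulr1n ?mulr0n.
  have D0 : \det D != 0.
    rewrite det_diag; apply/prodf_neq0 => i _; rewrite mxE metric_signRE.
    by case: ifP; rewrite ?oppr_eq0 oner_eq0.
  apply: (mulIf D0); rewrite mul1r {2}DE detZ !det_mulmx det_tr -volume_form_det -/c; ring.
have c1 := pow9_eq1 c9; split; last exact: c1.
by move=> i j; rewrite -(metric7_basis be') E c1 mulr1.
Qed.

(** Let D be the difference to the model dual form.  The inner product of D with
    every four-form is zero; with the form obtained from D by inserting the signs of
    the metric into all arguments this inner product is a sum of squares of the
    components of D. *)
Lemma hodge_star_unique (phi : kform V 3) (e : 7.-tuple V) h vol star_phi :
  adapted_basis phi e -> G2star_metric phi h vol ->
  @is_hodge_star R V h 3 4 vol phi star_phi ->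
  forall v, star_phi v = eval_form e 4 psi0 v.
Proof.
move=> ad [[hb _ _] _ _ hn] [as_ hs]; have [ho vol1] := hn e ad.
have [be phiE] := (adapted_basisE phi e).1 ad.
have [ms _] := as_; have [m0 _] := alt_form_eval_form e 4 psi0.
pose D (v : {ffun 'I_4 -> V}) := star_phi v - eval_form e 4 psi0 v.
have aD : alt_form D.
  have [ms' ass] := as_; have [m0' a0] := alt_form_eval_form e 4 psi0.
  split=> [v i c x y|v i j ij vij]; rewrite /D; first by rewrite ms' m0'; ring.
  by rewrite (ass v i j ij vij) (a0 v i j ij vij) subr0.
have [mD _] := aD.
(* The endomorphism of V that multiplies each basis vector by its square norm. *)
pose tw (x : V) : V := \sum_(i : 'I_7) coord e i x *: (metric_signR R i *: e`_i).
have twl c x y : tw (c *: x + y) = c *: tw x + tw y.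
  rewrite /tw scaler_sumr -big_split; apply: eq_bigr => i _ /=.
  by rewrite linearP scalerDl !scalerA.
have twe (i : 'I_7) : tw e`_i = metric_signR R i *: e`_i.
  rewrite /tw (bigD1 i) //= [X in _ + X]big1 ?addr0 => [|k ki].
    by rewrite coord_eq // eqxx scale1r.
  by rewrite coord_eq // (negbTE ki) scale0r.
pose chi : kform V 4 := fun v => D [ffun i => tw (v i)].
have achi : alt_form chi.
  have sub v i x : [ffun t => tw (subst_at v i x t)] = subst_at [ffun t => tw (v t)] i (tw x).
    by apply/ffunP=> t; rewrite !ffunE; case: ifP.
  split=> [v i c x y|v i j ij vij]; rewrite /chi; first by rewrite !sub twl mD.
  by have [_ h'] := aD; apply: (h' _ i j ij); rewrite !ffunE vij.
have [mchi _] := achi.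
have chiE (P : {ffun 'I_4 -> 'I_7}) : chi (etuple e P) = (\prod_t metric_signR R (P t)) * D (etuple e P).
  rewrite /chi -(multilinear_scale be (fun t => metric_signR R (P t)) (fun t => e`_(P t)) mD).
  by congr D; apply/ffunP=> t; rewrite !ffunE twe.
have z : \sum_(P : {ffun 'I_4 -> 'I_7}) D (etuple e P) ^+ 2 = 0.
  have e1 := hs chi achi (etuple e id).
  rewrite vol1 mulr1 (hodge_identity be phiE _ hb ho achi) volume_form_basis // mulr1 in e1.
  rewrite /star_phi0 !(form_metricE be hb ho) // in e1.
  have nz : ((4`!%:R)^-1 : R) != 0 by rewrite invr_eq0 pnatr_eq0.
  move: (mulfI nz e1) => /esym/eqP; rewrite -subr_eq0 -sumrB => /eqP eq0; rewrite -[RHS]eq0.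
  apply: eq_bigr => P _; rewrite chiE.
  have s2 : (\prod_t metric_signR R (P t)) * (\prod_t metric_signR R (P t)) = 1.
    by rewrite -big_split big1 // => t _; apply: metric_signR_sq.
  move: s2; rewrite /D; set X := \prod_t _; set Y := star_phi _; set Z := eval_form _ _ _ _ => s2.
  transitivity ((X * X) * (Y - Z) ^+ 2); first by rewrite s2 mul1r.
  by ring.
move=> v; apply/eqP; rewrite -subr_eq0; apply/eqP.
rewrite -[LHS]/(D v) (multilinear_expand be _ mD) big1 // => P _.
have /eqP : D (etuple e P) ^+ 2 = 0.
  by apply: (psumr_eq0P _ z) => // Q _; apply: sqr_ge0.
by rewrite sqrf_eq0 => /eqP->; rewrite mulr0.
Qed.

End AdaptedBases.

(** * Closed four-forms and the restriction to the ideal *)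

Section FourForms.
Variables (R : realType) (V : vectType R) (psi : kform V 4).

Definition eval4 (a b c d : V) : R := psi [ffun i : 'I_4 => nth 0 [:: a; b; c; d] i].

Lemma eval4_fun (f : nat -> V) : psi [ffun t : 'I_4 => f t] = eval4 (f 0) (f 1) (f 2) (f 3).
Proof.
congr psi; apply/ffunP=> -[[|[|[|[|//]]]] ?]; by rewrite !ffunE.
Qed.

Hypothesis apsi : alt_form psi.

Lemma eval4_lin1 k a a' b c d : eval4 (k *: a + a') b c d = k * eval4 a b c d + eval4 a' b c d.
Proof.
have [m _] := apsi; pose v := [ffun i : 'I_4 => nth 0 [:: a; b; c; d] i].
have E x : [ffun i : 'I_4 => nth 0 [:: x; b; c; d] i] = subst_at v (Ordinal (isT : 0 < 4)%N) x.
  by apply/ffunP=> -[[|[|[|[|//]]]] ?]; rewrite !ffunE.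
by rewrite /eval4 !E m.
Qed.

Lemma eval4_lin2 k a b b' c d : eval4 a (k *: b + b') c d = k * eval4 a b c d + eval4 a b' c d.
Proof.
have [m _] := apsi; pose v := [ffun i : 'I_4 => nth 0 [:: a; b; c; d] i].
have E x : [ffun i : 'I_4 => nth 0 [:: a; x; c; d] i] = subst_at v (Ordinal (isT : 1 < 4)%N) x.
  by apply/ffunP=> -[[|[|[|[|//]]]] ?]; rewrite !ffunE.
by rewrite /eval4 !E m.
Qed.

Lemma eval4_lin3 k a b c c' d : eval4 a b (k *: c + c') d = k * eval4 a b c d + eval4 a b c' d.
Proof.
have [m _] := apsi; pose v := [ffun i : 'I_4 => nth 0 [:: a; b; c; d] i].
have E x : [ffun i : 'I_4 => nth 0 [:: a; b; x; d] i] = subst_at v (Ordinal (isT : 2 < 4)%N) x.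
  by apply/ffunP=> -[[|[|[|[|//]]]] ?]; rewrite !ffunE.
by rewrite /eval4 !E m.
Qed.

Lemma eval4_lin4 k a b c d d' : eval4 a b c (k *: d + d') = k * eval4 a b c d + eval4 a b c d'.
Proof.
have [m _] := apsi; pose v := [ffun i : 'I_4 => nth 0 [:: a; b; c; d] i].
have E x : [ffun i : 'I_4 => nth 0 [:: a; b; c; x] i] = subst_at v (Ordinal (isT : 3 < 4)%N) x.
  by apply/ffunP=> -[[|[|[|[|//]]]] ?]; rewrite !ffunE.
by rewrite /eval4 !E m.
Qed.

Lemma eval4_aa12 a c d : eval4 a a c d = 0.
Proof.
have [_ h] := apsi; apply: (h _ (Ordinal (isT : 0 < 4)%N) (Ordinal (isT : 1 < 4)%N)) => //.
by rewrite !ffunE.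
Qed.

Lemma eval4_aa23 a b d : eval4 a b b d = 0.
Proof.
have [_ h] := apsi; apply: (h _ (Ordinal (isT : 1 < 4)%N) (Ordinal (isT : 2 < 4)%N)) => //.
by rewrite !ffunE.
Qed.

Lemma eval4_aa34 a b c : eval4 a b c c = 0.
Proof.
have [_ h] := apsi; apply: (h _ (Ordinal (isT : 2 < 4)%N) (Ordinal (isT : 3 < 4)%N)) => //.
by rewrite !ffunE.
Qed.

Lemma eval4_swap12 a b c d : eval4 b a c d = - eval4 a b c d.
Proof.
have := eval4_aa12 (1 *: a + b) c d.
rewrite eval4_lin1 !eval4_lin2 !eval4_aa12 !mul1r add0r addr0 addrC.
by move/eqP; rewrite addr_eq0 => /eqP.
Qed.

Lemma eval4_swap23 a b c d : eval4 a c b d = - eval4 a b c d.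
Proof.
have := eval4_aa23 a (1 *: b + c) d.
rewrite eval4_lin2 !eval4_lin3 !eval4_aa23 !mul1r add0r addr0 addrC.
by move/eqP; rewrite addr_eq0 => /eqP.
Qed.

Lemma eval4_swap34 a b c d : eval4 a b d c = - eval4 a b c d.
Proof.
have := eval4_aa34 a b (1 *: c + d).
rewrite eval4_lin3 !eval4_lin4 !eval4_aa34 !mul1r add0r addr0 addrC.
by move/eqP; rewrite addr_eq0 => /eqP.
Qed.

Lemma eval4_0 b c d : eval4 0 b c d = 0.
Proof. by have := eval4_lin1 (-1) 0 0 b c d; rewrite scaleN1r oppr0 addr0 mulN1r addNr. Qed.

End FourForms.

Section Closed.
Variables (R : realType) (g : vectType R) (br : g -> g -> g).
Hypothesis g_lie : lie_bracket br.
Variable u : {vspace g}.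
Hypothesis u_ideal : abelian_ideal br u.
Variable z : g.
Variable psi : kform g 4.
Hypothesis apsi : alt_form psi.

Local Notation q := (eval4 psi).

(** The ten terms of the differential, in terms of the values of psi. *)
Lemma ext_deriv4E (v : {ffun 'I_5 -> g}) (x := fun i => v (inord i)) :
  ext_deriv br psi v =
  - q (br (x 0) (x 1)) (x 2) (x 3) (x 4) + q (br (x 0) (x 2)) (x 1) (x 3) (x 4)
  - q (br (x 0) (x 3)) (x 1) (x 2) (x 4) + q (br (x 0) (x 4)) (x 1) (x 2) (x 3)
  - q (br (x 1) (x 2)) (x 0) (x 3) (x 4) + q (br (x 1) (x 3)) (x 0) (x 2) (x 4)
  - q (br (x 1) (x 4)) (x 0) (x 2) (x 3) - q (br (x 2) (x 3)) (x 0) (x 1) (x 4)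
  + q (br (x 2) (x 4)) (x 0) (x 1) (x 3) - q (br (x 3) (x 4)) (x 0) (x 1) (x 2).
Proof.
pose T (i j : nat) := if (i < j)%N then (-1) ^+ (i + j) *
  q (br (x i) (x j)) (x (bump j (bump i 0))) (x (bump j (bump i 1))) (x (bump j (bump i 2))) else 0.
transitivity (\sum_(i < 5) \sum_(j < 5) T i j).
  apply: eq_bigr => i _; rewrite big_mkcond; apply: eq_bigr => j _; rewrite /T /x !inord_val.
  case: ifP => // _; congr (_ * _).
  by rewrite -(eval4_fun psi (fun t => if t == 0%N then br (v i) (v j) else v (inord (bump j (bump i t.-1))))).
by rewrite !big_ord_recr !big_ord0 /= /T /=; ring.
Qed.

Lemma closed_restrict w0 w1 w2 w3 : (forall v, ext_deriv br psi v = 0) ->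
  w0 \in u -> w1 \in u -> w2 \in u -> w3 \in u ->
  q (br z w0) w1 w2 w3 + q w0 (br z w1) w2 w3 + q w0 w1 (br z w2) w3
  + q w0 w1 w2 (br z w3) = 0.
Proof.
move=> dpsi u0 u1 u2 u3; have [_ ab] := u_ideal.
have := dpsi [ffun i : 'I_5 => nth 0 [:: z; w0; w1; w2; w3] i].
rewrite ext_deriv4E !ffunE !inordK //=.
rewrite (ab _ _ u0 u1) (ab _ _ u0 u2) (ab _ _ u0 u3) (ab _ _ u1 u2) (ab _ _ u1 u3) (ab _ _ u2 u3).
rewrite !eval4_0 // => h.
rewrite (eval4_swap12 apsi (br z w1)) (eval4_swap23 apsi w0 (br z w2)) (eval4_swap12 apsi (br z w2)).
rewrite (eval4_swap34 apsi w0 w1 (br z w3)) (eval4_swap23 apsi w0 (br z w3)) (eval4_swap12 apsi (br z w3)).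
by rewrite -[RHS]oppr0 -[in RHS]h; ring.
Qed.

Lemma bracket_decomp c w c' w' : w \in u -> w' \in u ->
  br (c *: z + w) (c' *: z + w') = c *: br z w' + (- c') *: br z w.
Proof.
move=> wu wu'; have [[bl bra] bxx _] := g_lie; have [_ ab] := u_ideal.
have lin1 a x y t : br (a *: x + y) t = a *: br x t + br y t by apply: bl.
have lin2 a x y t : br t (a *: x + y) = a *: br t x + br t y by apply: bra.
have brC x y : br y x = - br x y.
  have := bxx (1 *: x + y); rewrite lin1 !lin2 !bxx !scale1r add0r addr0 addrC => /eqP.
  by rewrite addr_eq0 => /eqP.
by rewrite lin1 !lin2 bxx scaler0 add0r (ab _ _ wu wu') addr0 (brC z w) scalerN scaleNr.
Qed.

(** Decompose every argument as c z + w with w in u.  Terms in which z occurs twice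
    vanish or cancel in pairs; those in which z occurs only in the bracket combine,
    argument by argument, to the derivation applied to the restriction. *)
Lemma restrict_closed : (forall x, exists c, exists2 w, w \in u & x = c *: z + w) ->
  (forall w0 w1 w2 w3, w0 \in u -> w1 \in u -> w2 \in u -> w3 \in u ->
    q (br z w0) w1 w2 w3 + q w0 (br z w1) w2 w3 + q w0 w1 (br z w2) w3
    + q w0 w1 w2 (br z w3) = 0) ->
  forall v, ext_deriv br psi v = 0.
Proof.
move=> dec h v; rewrite ext_deriv4E.
have [c0 [w0 u0 ->]] := dec (v (inord 0)); have [c1 [w1 u1 ->]] := dec (v (inord 1)).
have [c2 [w2 u2 ->]] := dec (v (inord 2)); have [c3 [w3 u3 ->]] := dec (v (inord 3)).
have [c4 [w4 u4 ->]] := dec (v (inord 4)).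
rewrite !bracket_decomp //.
have h0 := h _ _ _ _ u1 u2 u3 u4; have h1 := h _ _ _ _ u0 u2 u3 u4.
have h2 := h _ _ _ _ u0 u1 u3 u4; have h3 := h _ _ _ _ u0 u1 u2 u4.
have h4 := h _ _ _ _ u0 u1 u2 u3.
move: h0 h1 h2 h3 h4; move: (br z w0) (br z w1) (br z w2) (br z w3) (br z w4) => f0 f1 f2 f3 f4.
have eval4_Z1 k a b c d : q (k *: a) b c d = k * q a b c d.
  by rewrite -[k *: a]addr0 eval4_lin1 // eval4_0 // addr0.
have m2 f a b c : q a f b c = - q f a b c by rewrite eval4_swap12.
have m3 f a b c : q a b f c = q f a b c by rewrite eval4_swap23 // m2 opprK.
have m4 f a b c : q a b c f = - q f a b c by rewrite eval4_swap34 // m3.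
have zz1 f c : q f z z c = 0 by rewrite eval4_aa23.
have zz2 f c : q f z c z = 0 by rewrite eval4_swap34 // eval4_aa23 // oppr0.
have zz3 f c : q f c z z = 0 by rewrite eval4_aa34.
have z2 f a b : q f a z b = - q f z a b by rewrite eval4_swap23.
have z3 f a b : q f a b z = q f z a b by rewrite eval4_swap34 // z2 opprK.
rewrite !(m2 f0, m2 f1, m2 f2, m2 f3, m3 f1, m3 f2, m3 f3, m4 f2, m4 f3, m4 f4, m3 f4, m2 f4).
move=> h0 h1 h2 h3 h4.
rewrite !(eval4_lin1 apsi, eval4_Z1, eval4_lin2 apsi, eval4_lin3 apsi, eval4_lin4 apsi).
rewrite !(zz1, zz2, zz3, z2, z3).
(* These are the left sides of the hypothesis for the arguments other than w0, ...,
   w4 in turn. *)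
pose L0 := q f1 w2 w3 w4 - q f2 w1 w3 w4 + q f3 w1 w2 w4 - q f4 w1 w2 w3.
pose L1 := q f0 w2 w3 w4 - q f2 w0 w3 w4 + q f3 w0 w2 w4 - q f4 w0 w2 w3.
pose L2 := q f0 w1 w3 w4 - q f1 w0 w3 w4 + q f3 w0 w1 w4 - q f4 w0 w1 w3.
pose L3 := q f0 w1 w2 w4 - q f1 w0 w2 w4 + q f2 w0 w1 w4 - q f4 w0 w1 w2.
pose L4 := q f0 w1 w2 w3 - q f1 w0 w2 w3 + q f2 w0 w1 w3 - q f3 w0 w1 w2.
transitivity (- c0 * L0 + c1 * L1 - c2 * L2 + c3 * L3 - c4 * L4).
  by rewrite /L0 /L1 /L2 /L3 /L4; ring.
by rewrite /L0 /L1 /L2 /L3 /L4 h0 h1 h2 h3 h4; ring.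
Qed.

End Closed.

Section DualBivector.
Variables (R : realType) (V : vectType R) (psi : kform V 4).
Hypothesis apsi : alt_form psi.
Variable b : nat -> V.

(** The values of psi on the vectors b are handled as a function of their indices,
    so that index lists can be sorted by [sort_eval4]. *)
Definition eval4_at i j k l : R := eval4 psi (b i) (b j) (b k) (b l).

Definition complement2 (m n : nat) : seq nat := [seq i <- iota 0 6 | (i != m) && (i != n)].

Definition eval4_list (s : seq nat) : R := eval4_at (nth 0 s 0) (nth 0 s 1) (nth 0 s 2) (nth 0 s 3).

(** The entry at (m, n) of the bivector dual to the restriction of psi: up to sign,
    the value of psi on the four other vectors. *)
Definition dual_entry (m n : nat) : R :=
  if m == n then 0
  else if (m < n)%N then (-1) ^+ (m + n).+1 * eval4_list (complement2 m n)
  else - ((-1) ^+ (n + m).+1 * eval4_list (complement2 n m)).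

Definition dual_biv : 'M[R]_6 := \matrix_(i, j) dual_entry i j.

Lemma dual_entryC m n : dual_entry n m = - dual_entry m n.
Proof.
rewrite /dual_entry eq_sym; case: eqP => [_|/eqP mn]; first by rewrite oppr0.
by case: ltngtP mn => //; rewrite ?opprK.
Qed.

Lemma alt_dual_biv : alt_mx dual_biv.
Proof.
split=> [i|i j]; rewrite !mxE; first by rewrite /dual_entry eqxx.
exact: dual_entryC.
Qed.

Variables (f : V -> V) (M : 'M[R]_6).
Let Mn i j := M (inord i) (inord j).
Hypothesis fb : forall j, (j < 6)%N -> f (b j) = \sum_(i < 6) Mn i j *: b i.
Hypothesis fr : forall i j k l, (i < 6)%N -> (j < 6)%N -> (k < 6)%N -> (l < 6)%N ->
  eval4 psi (f (b i)) (b j) (b k) (b l) + eval4 psi (b i) (f (b j)) (b k) (b l)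
  + eval4 psi (b i) (b j) (f (b k)) (b l) + eval4 psi (b i) (b j) (b k) (f (b l)) = 0.

Let eval4_sum1 j k l (F : 'I_6 -> R) (x : 'I_6 -> V) : eval4 psi (\sum_i F i *: x i) j k l =
  \sum_i F i * eval4 psi (x i) j k l.
Proof.
by elim/big_rec2: _ => [|i y1 y2 _ IH]; rewrite ?eval4_0 // eval4_lin1 // IH.
Qed.

Let eval4_sum2 i k l (F : 'I_6 -> R) (x : 'I_6 -> V) : eval4 psi i (\sum_i F i *: x i) k l =
  \sum_m F m * eval4 psi i (x m) k l.
Proof.
elim/big_rec2: _ => [|m y1 y2 _ IH]; last by rewrite eval4_lin2 // IH.
by rewrite eval4_swap12 // eval4_0 // oppr0.
Qed.

Let eval4_sum3 i j l (F : 'I_6 -> R) (x : 'I_6 -> V) : eval4 psi i j (\sum_i F i *: x i) l =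
  \sum_m F m * eval4 psi i j (x m) l.
Proof.
elim/big_rec2: _ => [|m y1 y2 _ IH]; last by rewrite eval4_lin3 // IH.
by rewrite eval4_swap23 // eval4_swap12 // eval4_0 // oppr0 oppr0.
Qed.

Let eval4_sum4 i j k (F : 'I_6 -> R) (x : 'I_6 -> V) : eval4 psi i j k (\sum_i F i *: x i) =
  \sum_m F m * eval4 psi i j k (x m).
Proof.
elim/big_rec2: _ => [|m y1 y2 _ IH]; last by rewrite eval4_lin4 // IH.
by rewrite eval4_swap34 // eval4_swap23 // eval4_swap12 // eval4_0 // !oppr0.
Qed.

Let eval4_at_12 i j k l : eval4_at j i k l = - eval4_at i j k l. Proof. exact: eval4_swap12. Qed.
Let eval4_at_23 i j k l : eval4_at i k j l = - eval4_at i j k l. Proof. exact: eval4_swap23. Qed.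
Let eval4_at_34 i j k l : eval4_at i j l k = - eval4_at i j k l. Proof. exact: eval4_swap34. Qed.
Let eval4_at_e12 i k l : eval4_at i i k l = 0. Proof. exact: eval4_aa12. Qed.
Let eval4_at_e23 i k l : eval4_at i k k l = 0. Proof. exact: eval4_aa23. Qed.
Let eval4_at_e34 i k l : eval4_at i k l l = 0. Proof. exact: eval4_aa34. Qed.

(** The invariance of the restriction, expanded in the matrix of the derivation. *)
Lemma derivation_eval4 i j k l : (i < 6)%N -> (j < 6)%N -> (k < 6)%N -> (l < 6)%N ->
  \sum_(m < 6) Mn m i * eval4_at m j k l + \sum_(m < 6) Mn m j * eval4_at i m k l
  + \sum_(m < 6) Mn m k * eval4_at i j m l + \sum_(m < 6) Mn m l * eval4_at i j k m = 0.
Proof.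
move=> hi hj hk hl; rewrite -[RHS](fr hi hj hk hl) !fb //.
by rewrite eval4_sum1 eval4_sum2 eval4_sum3 eval4_sum4.
Qed.

(** Brings the index lists into increasing order, so that only the independent
    components of psi remain. *)
Ltac sort_eval4 := repeat match goal with
  | |- context [eval4_at ?i ?j ?k ?l] =>
    first [ constr_eq i j; rewrite (eval4_at_e12 i k l)
          | constr_eq j k; rewrite (eval4_at_e23 i k l)
          | constr_eq k l; rewrite (eval4_at_e34 i j l)
          | let t := eval compute in (Nat.ltb j i) in
            match t with true => rewrite (eval4_at_12 j i k l) end
          | let t := eval compute in (Nat.ltb k j) in
            match t with true => rewrite (eval4_at_23 i k j l) end
          | let t := eval compute in (Nat.ltb l k) in
            match t with true => rewrite (eval4_at_34 i j l k) end ]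
  end.

Ltac close_entry H := have := H;
  rewrite !big_ord_recr !big_ord0 /= /dual_entry /= /eval4_list /=; sort_eval4; lra.

(** The equation for the entry (m, n) is, up to sign, the invariance of the
    restriction on the four vectors other than b m and b n. *)
Lemma invariant_dual_entry m n : (m < n)%N -> (n < 6)%N ->
  \sum_(k < 6) Mn m k * dual_entry k n + \sum_(k < 6) dual_entry m k * Mn n k
  = (\sum_(k < 6) Mn k k) * dual_entry m n.
Proof.
case: m => [|[|[|[|[|[|//]]]]]]; case: n => [|[|[|[|[|[|//]]]]]] // _ _.
- by close_entry (@derivation_eval4 2 3 4 5 isT isT isT isT).
- by close_entry (@derivation_eval4 1 3 4 5 isT isT isT isT).
- by close_entry (@derivation_eval4 1 2 4 5 isT isT isT isT).
- by close_entry (@derivation_eval4 1 2 3 5 isT isT isT isT).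
- by close_entry (@derivation_eval4 1 2 3 4 isT isT isT isT).
- by close_entry (@derivation_eval4 0 3 4 5 isT isT isT isT).
- by close_entry (@derivation_eval4 0 2 4 5 isT isT isT isT).
- by close_entry (@derivation_eval4 0 2 3 5 isT isT isT isT).
- by close_entry (@derivation_eval4 0 2 3 4 isT isT isT isT).
- by close_entry (@derivation_eval4 0 1 4 5 isT isT isT isT).
- by close_entry (@derivation_eval4 0 1 3 5 isT isT isT isT).
- by close_entry (@derivation_eval4 0 1 3 4 isT isT isT isT).
- by close_entry (@derivation_eval4 0 1 2 5 isT isT isT isT).
- by close_entry (@derivation_eval4 0 1 2 4 isT isT isT isT).
- by close_entry (@derivation_eval4 0 1 2 3 isT isT isT isT).
Qed.

Lemma invariant_dual_biv : invariant_biv M dual_biv.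
Proof.
have S m n : (m < 6)%N -> (n < 6)%N ->
  \sum_(k < 6) Mn m k * dual_entry k n + \sum_(k < 6) dual_entry m k * Mn n k
  = (\sum_(k < 6) Mn k k) * dual_entry m n.
  move=> hm hn; case: (ltngtP m n) => mn; first exact: invariant_dual_entry.
    rewrite (dual_entryC n m) mulrN -invariant_dual_entry // opprD addrC -!sumrN.
    by congr (_ + _); apply: eq_bigr => k _; rewrite dual_entryC; ring.
  have e0 : dual_entry n n = 0 by rewrite /dual_entry eqxx.
  rewrite mn e0 mulr0 -big_split big1 //= => k _.
  by rewrite (dual_entryC n k); ring.
apply/matrixP=> i j; rewrite !mxE.
have := S i j (ltn_ord i) (ltn_ord j); rewrite /Mn !inord_val => E.
transitivity (\sum_(k < 6) M i (inord k) * dual_entry k j + \sum_(k < 6) dual_entry i k * M j (inord k)).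
  by congr (_ + _); apply: eq_bigr => k _; rewrite !mxE inord_val.
rewrite E; congr (_ * _); apply: eq_bigr => k _.
by rewrite inord_val.
Qed.

End DualBivector.

(** * The Hodge dual on a hyperplane *)

Section HyperplaneRank.
Variables (R : realType) (V : vectType R) (e : 7.-tuple V).
Hypothesis be : basis_of {:V} e.

(** If e_r lies outside a hyperplane, projecting the other basis vectors to it along
    e_r gives a basis of the hyperplane of this shape. *)
Definition hyperplane_vec (r : nat) (c : nat -> R) (k : nat) : V := (- c (bump r k)) *: e`_r + e`_(bump r k).

Let psi := eval_form e 4 psi0.
Let apsi : alt_form psi := alt_form_eval_form e 4 psi0.
Let P i j k l : int := formal_value 4 psi0 [:: i; j; k; l].

Let PE i j k l : (i < 7)%N -> (j < 7)%N -> (k < 7)%N -> (l < 7)%N ->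
  eval4 psi e`_i e`_j e`_k e`_l = (P i j k l)%:~R.
Proof.
move=> hi hj hk hl; rewrite /eval4 /psi (eval_form_basis be (I := [:: i; j; k; l])) //=; last by rewrite hi hj hk hl.
by move=> -[[|[|[|[|//]]]] ?]; rewrite ffunE.
Qed.

Lemma eval4_hyperplane r c i j k l : (r < 7)%N -> (i < 6)%N -> (j < 6)%N -> (k < 6)%N -> (l < 6)%N ->
  eval4_at psi (hyperplane_vec r c) i j k l =
  (P (bump r i) (bump r j) (bump r k) (bump r l))%:~R
  - c (bump r i) * (P r (bump r j) (bump r k) (bump r l))%:~R
  - c (bump r j) * (P (bump r i) r (bump r k) (bump r l))%:~R
  - c (bump r k) * (P (bump r i) (bump r j) r (bump r l))%:~R
  - c (bump r l) * (P (bump r i) (bump r j) (bump r k) r)%:~R.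
Proof.
have b7 m : (m < 6)%N -> (bump r m < 7)%N by rewrite /bump; lia.
move=> r7 /b7 hi /b7 hj /b7 hk /b7 hl.
transitivity (eval4 psi e`_(bump r i) e`_(bump r j) e`_(bump r k) e`_(bump r l)
  - c (bump r i) * eval4 psi e`_r e`_(bump r j) e`_(bump r k) e`_(bump r l)
  - c (bump r j) * eval4 psi e`_(bump r i) e`_r e`_(bump r k) e`_(bump r l)
  - c (bump r k) * eval4 psi e`_(bump r i) e`_(bump r j) e`_r e`_(bump r l)
  - c (bump r l) * eval4 psi e`_(bump r i) e`_(bump r j) e`_(bump r k) e`_r); last by rewrite !PE.
rewrite /eval4_at /hyperplane_vec.
have z12 := eval4_aa12 apsi; have z23 := eval4_aa23 apsi; have z34 := eval4_aa34 apsi.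
have z13 x y w : eval4 psi x y x w = 0 by rewrite eval4_swap12 // eval4_aa23 // oppr0.
have z24 x y w : eval4 psi w x y x = 0 by rewrite eval4_swap23 // eval4_aa34 // oppr0.
have z14 x y w : eval4 psi x y w x = 0 by rewrite eval4_swap34 // z13 oppr0.
rewrite !(eval4_lin1 apsi, eval4_lin2 apsi, eval4_lin3 apsi, eval4_lin4 apsi) !(z12, z23, z34, z13, z24, z14).
by ring.
Qed.

Let pfv r c i j k l : R := let D := dual_entry psi (hyperplane_vec r c) in
  D i j * D k l - D i k * D j l + D i l * D j k.

Let int0 : (Posz 0)%:~R = 0 :> R. Proof. by []. Qed.
Let int1 : (Posz 1)%:~R = 1 :> R. Proof. by []. Qed.
Let intN1 : (Negz 0)%:~R = -1 :> R. Proof. by []. Qed.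

(** The tactic [ring] expects numerals in place of the integers P i j k l. *)
Ltac eval_psi0 := repeat match goal with
  | |- context [P ?i ?j ?k ?l] =>
    let v := eval vm_compute in (formal_value 4 psi0 [:: i; j; k; l]) in
    have -> : P i j k l = v by vm_compute
  end.

Ltac eval_entries := rewrite /pfv /dual_entry /= /eval4_list /= !eval4_hyperplane //= /bump /=;
  eval_psi0; rewrite ?(int0, int1, intN1).

(** Certificates found by linear algebra: in each case the constant 2 is a
    combination of six sub-Pfaffians with coefficients 1, -1 or a single c m up to
    sign.  So the sub-Pfaffians have no common zero. *)
Lemma pfv_certificate r c : (r < 7)%N ->
  ~ (forall i j k l, (i < 6)%N -> (j < 6)%N -> (k < 6)%N -> (l < 6)%N -> pfv r c i j k l = 0).
Proof.
move=> r7 H; have two : (2 : R) != 0 by rewrite pnatr_eq0.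
move/eqP: two; apply.
case: r r7 H => [|[|[|[|[|[|[|//]]]]]]] _ H.
- transitivity (c 4 * pfv 0 c 0 1 2 3 + c 5 * pfv 0 c 0 1 2 4 - c 2 * pfv 0 c 0 1 3 4 - pfv 0 c 0 1 3 5 - c 3 * pfv 0 c 0 2 3 4 + pfv 0 c 0 2 4 5).
    by eval_entries; ring.
  by rewrite !H //; ring.
- transitivity (- c 4 * pfv 1 c 0 1 2 3 - c 5 * pfv 1 c 0 1 2 4 + c 2 * pfv 1 c 0 1 3 4 - pfv 1 c 0 1 4 5 + c 3 * pfv 1 c 0 2 3 4 - pfv 1 c 0 2 3 5).
    by eval_entries; ring.
  by rewrite !H //; ring.
- transitivity (c 5 * pfv 2 c 0 1 2 4 + c 6 * pfv 2 c 0 1 2 5 + pfv 2 c 0 1 3 4 - c 1 * pfv 2 c 0 1 4 5 - pfv 2 c 0 2 3 5 - c 3 * pfv 2 c 0 2 4 5).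
    by eval_entries; ring.
  by rewrite !H //; ring.
- transitivity (- c 4 * pfv 3 c 0 1 2 3 - c 6 * pfv 3 c 0 1 2 5 + pfv 3 c 0 1 3 4 - c 1 * pfv 3 c 0 1 3 5 - c 2 * pfv 3 c 0 2 3 5 - pfv 3 c 0 2 4 5).
    by eval_entries; ring.
  by rewrite !H //; ring.
- transitivity (pfv 4 c 0 1 2 3 - c 3 * pfv 4 c 0 1 3 4 - c 1 * pfv 4 c 0 1 3 5 + c 6 * pfv 4 c 0 1 4 5 + pfv 4 c 0 2 4 5 + c 5 * pfv 4 c 0 3 4 5).
    by eval_entries; ring.
  by rewrite !H //; ring.
- transitivity (pfv 5 c 0 1 2 3 + c 2 * pfv 5 c 0 1 2 4 - c 1 * pfv 5 c 0 1 2 5 - c 6 * pfv 5 c 0 1 4 5 + c 4 * pfv 5 c 0 2 4 5 + pfv 5 c 0 3 4 5).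
    by eval_entries; ring.
  by rewrite !H //; ring.
- transitivity (pfv 6 c 0 1 2 3 - pfv 6 c 0 1 4 5 + c 2 * pfv 6 c 0 2 3 4 - c 3 * pfv 6 c 0 2 3 5 - c 4 * pfv 6 c 0 2 4 5 + c 5 * pfv 6 c 0 3 4 5).
    by eval_entries; ring.
  by rewrite !H //; ring.
Qed.

(** Geometrically the bivector is the contraction of the G2*-form with a normal
    vector of the hyperplane, which has rank four for null vectors and rank six
    otherwise. *)
Lemma rank_hyperplane r c : (r < 7)%N -> rank_ge4 (dual_biv psi (hyperplane_vec r c)).
Proof.
move=> r7; case: (boolP (rank_ge4 _)) => // h; case: (@pfv_certificate r c r7) => i j k l hi hj hk hl.
have := rank_lt4P (Ordinal hi) (Ordinal hj) (Ordinal hk) (Ordinal hl) h.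
by rewrite /pf4 !mxE.
Qed.

End HyperplaneRank.

Section CodimOneIdeal.
Variables (R : realType) (g : vectType R) (br : g -> g -> g).
Hypothesis g_lie : lie_bracket br.
Hypothesis dim_g : \dim {:g} = 7%N.
Variable u : {vspace g}.
Hypothesis dim_u : \dim u = 6%N.
Hypothesis u_ideal : abelian_ideal br u.
Variable z : g.
Hypothesis z_notin_u : z \notin u.

Lemma transversal_coord : exists alpha : g -> R,
  [/\ forall a x y, alpha (a *: x + y) = a * alpha x + alpha y,
      forall x, x - alpha x *: z \in u & forall x, (alpha x == 0) = (x \in u)].
Proof.
have z0 : z != 0 by apply: contraNneq z_notin_u => ->; rewrite mem0v.
pose alpha := coord [tuple z] ord0.
pose pr := daddv_pi <[z]> u.
have cap : (<[z]> :&: u = 0)%VS.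
  apply/eqP; rewrite -subv0; apply/subvP => x /memv_capP[/vlineP[k ->] ku].
  case: (eqVneq k 0) => [->|k0]; first by rewrite scale0r mem0v.
  by move: z_notin_u; rewrite -[z](scalerK k0) memvZ.
have full : (<[z]> + u = {:g})%VS.
  apply/eqP; rewrite eqEdim subvf dim_g dimv_disjoint_sum // dim_u.
  by rewrite dim_vline z0.
have prz x : exists k, pr x = k *: z by apply/vlineP/memv_pi.
have lin a x y : alpha (pr (a *: x + y)) = a * alpha (pr x) + alpha (pr y) by rewrite /alpha linearP linearP.
have aE k : alpha (k *: z) = k.
  have bz : basis_of <[z]> [tuple z] by apply: seq1_basis.
  have e1 : coord [tuple z] ord0 z = 1.
    by rewrite -[X in coord _ _ X]/([tuple z]`_(ord0 : 'I_1)) coord_free // (basis_free bz).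
  by rewrite /alpha linearZ /= e1 mulr1.
have prE x : pr x = alpha (pr x) *: z by have [k ->] := prz x; rewrite aE.
have compl x : x - pr x \in u.
  rewrite -{1}(daddv_pi_add (w := x) cap) ?full ?memvf //.
  by rewrite -/pr addrC addKr memv_pi.
exists (fun x => alpha (pr x)); split.
- by move=> a x y; rewrite lin.
- by move=> x; rewrite -prE.
move=> x; apply/eqP/idP => [h|xu].
  by have := compl x; rewrite prE h scale0r subr0.
have : alpha (pr x) *: z \in u by rewrite -prE -[pr x](subKr x) memvB.
case: (eqVneq (alpha (pr x)) 0) => // k0 /(memvZ (alpha (pr x))^-1).
by rewrite scalerK // (negbTE z_notin_u).
Qed.

Lemma bracket_linear c x y : br z (c *: x + y) = c *: br z x + br z y.
Proof. by have [[_ h] _ _] := g_lie; apply: h. Qed.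

Lemma vsval_ad_on (x : subvs_of u) : vsval (ad_on br u z x) = br z (vsval x).
Proof.
pose F := fun y : subvs_of u => vsproj u (br z (vsval y)).
have lin : linear F by move=> a y y'; rewrite /F linearP bracket_linear linearP.
pose F' : {linear subvs_of u -> subvs_of u} := HB.pack F (GRing.isLinear.Build _ _ _ _ F lin).
have -> : ad_on br u z x = F' x by apply: (lfunE F').
rewrite /= /F vsprojK //; have [h _] := u_ideal; apply: h; exact: subvsP.
Qed.

Lemma hyperplane_basis (e : 7.-tuple g) : basis_of {:g} e ->
  exists r c (b : 6.-tuple (subvs_of u)),
  [/\ (r < 7)%N, basis_of {:subvs_of u} b &
      forall k : 'I_6, vsval b`_k = hyperplane_vec e r c k].
Proof.
move=> be; have [alpha [alin aproj au]] := transversal_coord.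
have [r ar] : exists r : 'I_7, alpha e`_r != 0.
  apply/existsP; apply: contraNT z_notin_u; rewrite negb_exists => /forallP h.
  rewrite (coord_decomp be z) memv_suml // => i _; rewrite memvZ // -au.
  by move: (h i); rewrite negbK.
(* With this choice alpha vanishes on each [hyperplane_vec]. *)
pose c (m : nat) := alpha e`_m / alpha e`_r.
have bu (k : 'I_6) : hyperplane_vec e r c k \in u.
  rewrite -au /hyperplane_vec alin /c; apply/eqP; by field.
pose b := [tuple vsproj u (hyperplane_vec e r c k) | k < 6].
have bE (k : 'I_6) : vsval b`_k = hyperplane_vec e r c k.
  by rewrite -(tnth_nth 0 b k) tnth_mktuple vsprojK.
exists r, c, b; split=> //.
have dS : \dim {:subvs_of u} = 6%N by rewrite dimvf.
rewrite basisEdim size_tuple dS leqnn andbT; apply/subvP => x _.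
suff -> : x = \sum_(k < 6) coord e (lift r k) (vsval x) *: b`_k.
  by rewrite memv_suml // => k _; rewrite memvZ // memv_span // mem_nth // size_tuple.
apply: val_inj; rewrite -[LHS]/(vsval x) -[RHS]/(vsval _) linear_comb.
transitivity (\sum_(k < 6) coord e (lift r k) (vsval x) *: hyperplane_vec e r c k); last first.
  by apply: eq_bigr => k _; apply: congr1; apply: (esym (bE k)).
set S := \sum_(k < 6) _.
have [t St] : exists t, vsval x - S = t *: e`_r.
  exists (coord e r (vsval x) + \sum_(k < 6) coord e (lift r k) (vsval x) * c (bump r k)).
  rewrite {1}(coord_decomp be (vsval x)) (bigD1_ord r) //= /S -addrA -sumrB scalerDl; congr (_ + _).
  rewrite scaler_suml; apply: eq_bigr => k _.
  by rewrite scalerDr opprD addrCA subrr addr0 scaleNr scalerN opprK scalerA.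
have : t *: e`_r \in u.
  rewrite -St memvB ?subvsP // /S memv_suml // => k _; apply: memvZ.
  by have := bu k.
case: (eqVneq t 0) => [t0 _|t0 /(memvZ t^-1)].
  by apply/eqP; rewrite -subr_eq0 St t0 scale0r.
by rewrite scalerK // -au (negbTE ar).
Qed.

(** The hyperplane u has a basis of the shape [hyperplane_vec]; in it the dual
    bivector of the restricted Hodge dual has rank at least four and is invariant
    because the Hodge dual is closed. *)
Lemma cocalibrated_bivector (phi : kform g 3) : cocalibrated br phi ->
  exists (b : 6.-tuple (subvs_of u)) (B : 'M[R]_6), [/\ basis_of {:subvs_of u} b,
    alt_mx B, invariant_biv (end_mx b (ad_on br u z)) B & rank_ge4 B].
Proof.
move=> [[e ad] [h [vol [star [met hod closed]]]]].
have starE := hodge_star_unique ad met hod.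
have [be _] := (adapted_basisE phi e).1 ad.
have [r [c [b [r7 bb bE]]]] := hyperplane_basis be.
pose psi := eval_form e 4 psi0.
have apsi : alt_form psi := alt_form_eval_form e 4 psi0.
have closed' v : ext_deriv br psi v = 0.
  rewrite -(closed v); apply: eq_bigr => i _; apply: eq_bigr => j _; congr (_ * _).
  by rewrite starE.
pose bv k := hyperplane_vec e r c k.
have bu k : (k < 6)%N -> bv k \in u.
  by move=> k6; have := bE (Ordinal k6); rewrite /bv /= => <-; apply: subvsP.
exists b, (dual_biv psi bv); split=> //.
- exact: alt_dual_biv.
- apply: (invariant_dual_biv apsi (f := br z)) => [j j6|i j k l i6 j6 k6 l6]; last first.
    by apply: (closed_restrict u_ideal z apsi closed'); apply: bu.
  have bvE (k : 'I_6) : bv k = vsval b`_k by rewrite bE.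
  rewrite (bvE (Ordinal j6)) -vsval_ad_on (end_mxP _ bb) linear_sum.
  apply: eq_bigr => i _; rewrite (bvE i) linearZ; congr (_ *: _).
  by rewrite inord_val; congr (end_mx _ _ _ _); apply: val_inj; rewrite /= inordK.
- exact: rank_hyperplane.
Qed.

End CodimOneIdeal.

(** * The model on an ideal in normal form *)

Lemma sum6 (K : nmodType) (F : nat -> K) :
  \sum_(k < 6) F k = F 0 + F 1 + F 2 + F 3 + F 4 + F 5.
Proof. by rewrite !big_ord_recr big_ord0 /= add0r. Qed.

Section VolumeFormPairing.
Variable K : comPzRingType.

(** The four-form (x^1 ^ x^2 + x^3 ^ x^4) ^ x^5 ^ x^6 on u, dual to the bivector x1
    ^ x2 + x3 ^ x4. *)
Definition nu_omega (a b c d : nat -> K) : K :=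
  laplace 4 (fun i j => nth (fun=> 0) [:: a; b; c; d] i (nth 0%N [:: 0; 1; 4; 5]%N j))
  + laplace 4 (fun i j => nth (fun=> 0) [:: a; b; c; d] i (nth 0%N [:: 2; 3; 4; 5]%N j)).

Lemma nu_omega_invariant (m : nat -> nat -> K) (a b c d fa fb fc fd : nat -> K)
  (f := fun (x : nat -> K) k => m k 0 * x 0 + m k 1 * x 1 + m k 2 * x 2 + m k 3 * x 3
                     + m k 4 * x 4 + m k 5 * x 5) :
  [/\ m 2 1 = m 0 3, m 3 1 = - m 0 2, m 2 0 = - m 1 3 & m 3 0 = m 1 2] ->
  [/\ m 4 0 = 0, m 4 1 = 0, m 4 2 = 0 & m 4 3 = 0] ->
  [/\ m 5 0 = 0, m 5 1 = 0, m 5 2 = 0 & m 5 3 = 0] ->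
  m 3 3 = m 0 0 + m 1 1 - m 2 2 -> m 5 5 = - (m 0 0 + m 1 1) - m 4 4 ->
  fa =1 f a -> fb =1 f b -> fc =1 f c -> fd =1 f d ->
  nu_omega fa b c d + nu_omega a fb c d + nu_omega a b fc d + nu_omega a b c fd = 0.
Proof.
move=> [h21 h31 h20 h30] [h40 h41 h42 h43] [h50 h51 h52 h53] h33 h55 ha hb hc hd.
rewrite /nu_omega /= !(ha, hb, hc, hd) /f.
rewrite h21 h31 h20 h30 h40 h41 h42 h43 h50 h51 h52 h53 h33 h55.
by ring.
Qed.

End VolumeFormPairing.

Section NormalFormEntries.
Variables (R : realType) (M : 'M[R]_6).
Hypothesis inv : invariant_biv M (omega4 R).
Let Mn i j := M (inord i) (inord j).

Definition omega4_fun (a b : nat) : R := ((a == 0%N) && (b == 1%N))%:R - ((a == 1%N) && (b == 0%N))%:R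
  + ((a == 2%N) && (b == 3%N))%:R - ((a == 3%N) && (b == 2%N))%:R.

Lemma omega4E (i j : 'I_6) : omega4 R i j = omega4_fun i j.
Proof.
rewrite /omega4_fun !mxE !big_ord1 !mxE !eqxx !andbT -!(inj_eq val_inj) /= !inordK //.
by rewrite -!natrM !mulnb addrA.
Qed.

Lemma omega4_entries a b : (a < 6)%N -> (b < 6)%N ->
  \sum_(k < 6) Mn a k * omega4_fun k b + \sum_(k < 6) omega4_fun a k * Mn b k = (\sum_(k < 6) Mn k k) * omega4_fun a b.
Proof.
move=> ha hb; have := congr1 (fun X : 'M[R]_6 => X (inord a) (inord b)) inv.
rewrite [RHS]mxE omega4E !inordK // => E.
have -> : \sum_(k < 6) Mn k k = \tr M by apply: eq_bigr => k _; rewrite /Mn inord_val.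
rewrite -E mxE; congr (_ + _); rewrite mxE; apply: eq_bigr => k _.
  by rewrite omega4E inordK // /Mn inord_val.
by rewrite omega4E mxE inordK // /Mn inord_val.
Qed.

Lemma omega4_entries6 a b : (a < 6)%N -> (b < 6)%N ->
  (Mn a 0 * omega4_fun 0 b + Mn a 1 * omega4_fun 1 b + Mn a 2 * omega4_fun 2 b + Mn a 3 * omega4_fun 3 b + Mn a 4 * omega4_fun 4 b
   + Mn a 5 * omega4_fun 5 b) + (omega4_fun a 0 * Mn b 0 + omega4_fun a 1 * Mn b 1 + omega4_fun a 2 * Mn b 2 + omega4_fun a 3 * Mn b 3
   + omega4_fun a 4 * Mn b 4 + omega4_fun a 5 * Mn b 5)
  = (Mn 0 0 + Mn 1 1 + Mn 2 2 + Mn 3 3 + Mn 4 4 + Mn 5 5) * omega4_fun a b.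
Proof.
move=> ha hb; have := omega4_entries ha hb.
by rewrite (sum6 (fun k => Mn a k * omega4_fun k b)) (sum6 (fun k => omega4_fun a k * Mn b k)) (sum6 (fun k => Mn k k)).
Qed.

(** The invariance equation solved for part of the entries: M preserves the span of
    the first four basis vectors, where it is symplectic up to a scalar, and this
    scalar is minus half the trace of the quotient. *)
Lemma omega4_constraints :
  [/\ [/\ Mn 2 1 = Mn 0 3, Mn 3 1 = - Mn 0 2, Mn 2 0 = - Mn 1 3 & Mn 3 0 = Mn 1 2],
      [/\ Mn 4 0 = 0, Mn 4 1 = 0, Mn 4 2 = 0 & Mn 4 3 = 0],
      [/\ Mn 5 0 = 0, Mn 5 1 = 0, Mn 5 2 = 0 & Mn 5 3 = 0] &
      Mn 3 3 = Mn 0 0 + Mn 1 1 - Mn 2 2 /\ Mn 5 5 = - (Mn 0 0 + Mn 1 1) - Mn 4 4].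
Proof.
have h01 := @omega4_entries6 0 1 isT isT; have h23 := @omega4_entries6 2 3 isT isT.
have h02 := @omega4_entries6 0 2 isT isT; have h03 := @omega4_entries6 0 3 isT isT.
have h12 := @omega4_entries6 1 2 isT isT; have h13 := @omega4_entries6 1 3 isT isT.
have h40 := @omega4_entries6 4 0 isT isT; have h41 := @omega4_entries6 4 1 isT isT.
have h42 := @omega4_entries6 4 2 isT isT; have h43 := @omega4_entries6 4 3 isT isT.
have h50 := @omega4_entries6 5 0 isT isT; have h51 := @omega4_entries6 5 1 isT isT.
have h52 := @omega4_entries6 5 2 isT isT; have h53 := @omega4_entries6 5 3 isT isT.
move: h01 h23 h02 h03 h12 h13 h40 h41 h42 h43 h50 h51 h52 h53.
rewrite /omega4_fun /= !(mulr0, mul0r, mulr1, mul1r, addr0, add0r, subr0, sub0r, mulrN, mulNr, oppr0).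
move=> h01 h23 h02 h03 h12 h13 h40 h41 h42 h43 h50 h51 h52 h53.
by split; [split|split|split|split]; lra.
Qed.

End NormalFormEntries.

Section ModelOnIdeal.
Variables (R : realType) (g : vectType R) (br : g -> g -> g).
Hypothesis g_lie : lie_bracket br.
Hypothesis dim_g : \dim {:g} = 7%N.
Variable u : {vspace g}.
Hypothesis dim_u : \dim u = 6%N.
Hypothesis u_ideal : abelian_ideal br u.
Variable z : g.
Hypothesis z_notin_u : z \notin u.
Variable b : 6.-tuple (subvs_of u).
Hypothesis bb : basis_of {:subvs_of u} b.

Let B (k : nat) : g := vsval b`_k.

(** With x1, ..., x4, y1, y2 the given basis of u, these are z, x3 + y2, x2, x4 -
    y1, x1 + z, y2, y1.  The covector vanishing on u is e^1 + e^5, so u is a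
    degenerate hyperplane for the metric which has this basis as an adapted one. *)
Definition adapted_tuple : 7.-tuple g :=
  [tuple z; B 2 + B 5; B 1; B 3 - B 4; B 0 + z; B 5; B 4].
Let e := adapted_tuple.

Definition ucoord (y : subvs_of u) (k : nat) : R := coord b (inord k) y.

(** The coordinates of c z + y in the adapted basis. *)
Definition adapted_coord (c : R) (y : subvs_of u) (k : nat) : R :=
  nth 0 [:: c - ucoord y 0; ucoord y 2; ucoord y 1; ucoord y 3; ucoord y 0;
            ucoord y 5 - ucoord y 2; ucoord y 3 + ucoord y 4] k.

Lemma vsval_coord y : vsval y = \sum_(k < 6) ucoord y k *: B k.
Proof.
rewrite {1}(coord_decomp bb y) linear_comb; apply: eq_bigr => k _.
by rewrite /ucoord inord_val.
Qed.

Let zE : z = e`_0. Proof. by []. Qed.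
Let B0E : B 0 = e`_4 - e`_0. Proof. by rewrite /= addrK. Qed.
Let B1E : B 1 = e`_2. Proof. by []. Qed.
Let B2E : B 2 = e`_1 - e`_5. Proof. by rewrite /= addrK. Qed.
Let B3E : B 3 = e`_3 + e`_6. Proof. by rewrite /= subrK. Qed.
Let B4E : B 4 = e`_6. Proof. by []. Qed.
Let B5E : B 5 = e`_5. Proof. by []. Qed.

Lemma adapted_tuple_basis : basis_of {:g} e.
Proof.
rewrite basisEdim size_tuple dim_g leqnn andbT; apply/subvP => x _.
have [alpha [_ aproj _]] := transversal_coord dim_g dim_u z_notin_u.
have me k : (k < 7)%N -> e`_k \in <<e>>%VS by move=> k7; rewrite memv_span // mem_nth.
rewrite -[x](subrK (alpha x *: z)) -[x - _](vsprojK (aproj x)) vsval_coord.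
rewrite memvD // ?memvZ ?zE ?me // memv_suml // => k _; apply: memvZ.
case: k => [[|[|[|[|[|[|//]]]]]] ?]; rewrite ?(B0E, B1E, B2E, B3E, B4E, B5E);
  by first [apply: memvB; apply: me | apply: me | apply: memvD; apply: me].
Qed.

Let be := adapted_tuple_basis.

Lemma coframe_adapted c y k : (k < 7)%N -> coframe e k (c *: z + vsval y) = adapted_coord c y k.
Proof.
move=> k7; have L j (j7 : (j < 7)%N) : coord e (inord k) e`_j = (k == j)%:R := coframe_basis be k7 j7.
have lz : coord e (inord k) z = (k == 0%N)%:R by apply: (L 0%N).
have l0 : coord e (inord k) (B 0) = (k == 4%N)%:R - (k == 0%N)%:R by rewrite B0E linearB; congr (_ - _); [apply: (L 4%N)|apply: (L 0%N)].
have l1 : coord e (inord k) (B 1) = (k == 2%N)%:R by apply: (L 2%N).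
have l2 : coord e (inord k) (B 2) = (k == 1%N)%:R - (k == 5%N)%:R by rewrite B2E linearB; congr (_ - _); [apply: (L 1%N)|apply: (L 5%N)].
have l3 : coord e (inord k) (B 3) = (k == 3%N)%:R + (k == 6%N)%:R by rewrite B3E linearD; congr (_ + _); [apply: (L 3%N)|apply: (L 6%N)].
have l4 : coord e (inord k) (B 4) = (k == 6%N)%:R by apply: (L 6%N).
have l5 : coord e (inord k) (B 5) = (k == 5%N)%:R by apply: (L 5%N).
clear L; rewrite /coframe vsval_coord !big_ord_recr big_ord0.
rewrite !(linearD, linearZ, linear0) /= lz l0 l1 l2 l3 l4 l5 {lz l0 l1 l2 l3 l4 l5}.
by case: k k7 => [|[|[|[|[|[|[|//]]]]]]] _; rewrite /adapted_coord /=; ring.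
Qed.

Let psi := eval_form e 4 psi0.

(** On u one has e^1 = - e^5, and the seven terms of the dual form collapse to the
    two terms of [nu_omega]. *)
Lemma star_on_ideal (y0 y1 y2 y3 : subvs_of u) :
  eval4 psi (vsval y0) (vsval y1) (vsval y2) (vsval y3) =
  nu_omega (ucoord y0) (ucoord y1) (ucoord y2) (ucoord y3).
Proof.
pose y i := nth 0 [:: y0; y1; y2; y3] i.
have coframeu k v : (k < 7)%N -> coframe e k (vsval v) = adapted_coord 0 v k.
  by move=> k7; rewrite -(coframe_adapted 0 v k7) scale0r add0r.
have detE l : all (fun j => j < 7)%N l -> size l = 4%N ->
  det_form e 4 l [ffun i : 'I_4 => nth 0 [:: vsval y0; vsval y1; vsval y2; vsval y3] i] =
  laplace 4 (fun i j => adapted_coord 0 (y i) (nth 0%N l j)).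
  move=> /allP l7 l4; rewrite -det_laplace; congr (\det _); apply/matrixP=> i j.
  rewrite !mxE ffunE -coframeu; last by apply: l7; rewrite mem_nth // l4.
  by rewrite /y; case: i => [[|[|[|[|//]]]] ?].
rewrite /eval4 /psi /eval_form !big_cons big_nil !detE // /nu_omega /y /= /adapted_coord /=.
move: (ucoord y0) (ucoord y1) (ucoord y2) (ucoord y3) => c0 c1 c2 c3.
by ring.
Qed.

Lemma star_invariant (M := end_mx b (ad_on br u z)) : invariant_biv M (omega4 R) ->
  forall w0 w1 w2 w3, w0 \in u -> w1 \in u -> w2 \in u -> w3 \in u ->
    eval4 psi (br z w0) w1 w2 w3 + eval4 psi w0 (br z w1) w2 w3 + eval4 psi w0 w1 (br z w2) w3
    + eval4 psi w0 w1 w2 (br z w3) = 0.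
Proof.
move=> inv w0 w1 w2 w3 u0 u1 u2 u3.
rewrite -(vsprojK u0) -(vsprojK u1) -(vsprojK u2) -(vsprojK u3).
move: (vsproj u w0) (vsproj u w1) (vsproj u w2) (vsproj u w3) => y0 y1 y2 y3.
rewrite -!(vsval_ad_on g_lie u_ideal) !star_on_ideal.
have aE y k : ucoord (ad_on br u z y) k =
    M (inord k) (inord 0) * ucoord y 0 + M (inord k) (inord 1) * ucoord y 1
    + M (inord k) (inord 2) * ucoord y 2 + M (inord k) (inord 3) * ucoord y 3
    + M (inord k) (inord 4) * ucoord y 4 + M (inord k) (inord 5) * ucoord y 5.
  rewrite /ucoord (end_mx_apply _ _ _ bb) -(sum6 (fun m => M (inord k) (inord m) * ucoord y m)).
  by apply: eq_bigr => m _; rewrite /ucoord inord_val.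
have [h2 h4 h5 [h33 h55]] := omega4_constraints inv.
by apply: (nu_omega_invariant (m := fun i j => M (inord i) (inord j))).
Qed.

Lemma normal_form_cocalibrated : invariant_biv (end_mx b (ad_on br u z)) (omega4 R) ->
  exists phi : kform g 3, cocalibrated br phi.
Proof.
move=> inv; exists (eval_form e 3 phi0).
have [alpha [_ aproj _]] := transversal_coord dim_g dim_u z_notin_u.
split; first by exists e; apply/adapted_basisE.
exists (metric7 e), (volume_form e), psi; split.
- exact: model_metric.
- split=> [|chi achi v]; first exact: alt_form_eval_form.
  by apply: (hodge_identity be) => //; [apply: metric7_bilinear|apply: metric7_basis].
- apply: (restrict_closed g_lie u_ideal (z := z)); first exact: alt_form_eval_form.
    by move=> x; exists (alpha x), (x - alpha x *: z); rewrite ?aproj // addrC subrK.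
  exact: star_invariant.
Qed.

End ModelOnIdeal.

Theorem theorem1p3 (R : realType) (g : vectType R) (br : g -> g -> g)
    (g_lie : lie_bracket br) (dim_g : \dim {:g} = 7%N)
    (u : {vspace g}) (dim_u : \dim u = 6%N) (u_ideal : abelian_ideal br u)
    (e7 : g) (e7_notin_u : e7 \notin u)
    (V2 V4 : {vspace subvs_of u}) (dim_V2 : \dim V2 = 2%N) (dim_V4 : \dim V4 = 4%N)
    (sum_V2_V4 : (V2 + V4 = {:subvs_of u})%VS) (dx_V2_V4 : directv (V2 + V4))
    (omega : kform (subvs_of V4) 2) (omega_form : alt_form omega)
    (omega_nondeg : nondegenerate2 (fun x y => omega (pair_arg x y)))
    (lam : 'I_6 -> R[i]) (JB : 'I_6 -> nat)
    (jordan : complex_jordan_form (ad_on br u e7) lam JB) :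
  [<-> (exists phi : kform g 3, cocalibrated br phi);
       (exists2 f : 'End(subvs_of u),
          GL_similar (ad_on br u e7) f & in_split_class V2 omega f);
       (exists I1 I2 I3 : {set 'I_6},
          [/\ partition [set I1; I2; I3] [set: 'I_6],
              [/\ #|I1| = 2%N, #|I2| = 2%N & #|I3| = 2%N] &
              jordan_partition lam JB I1 I2 I3])].
Proof.
have [jd [e [P [be uP FP]]]] := jordan.
have partP := jordan_partition_pattern jd (complex_two_neq0 R).
have splitP := split_class_pattern dim_V2 dim_V4 sum_V2_V4 dx_V2_V4 omega_form omega_nondeg jordan.
tfae.
- move=> [phi cphi]; apply/splitP.
  have [b [B [bb altB invB rB]]] := cocalibrated_bivector g_lie dim_g dim_u u_ideal e7_notin_u cphi.
  have uS : base_mx e b \in unitmx by have [] := mulmx1_unit (base_mxK be bb).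
  apply: (invariant_pattern jd uP FP (B := base_mx e b *m B *m (base_mx e b)^T)).
  + exact: alt_congr.
  + by apply: (invariant_biv_congr uS _ invB); apply: end_mx_base.
  + exact: rank_ge4_congr.
- by move=> /splitP /partP.
move=> /partP /(pattern_normal_form jd uP FP)[T uT invT].
have bb := basis_change be uT.
apply: (normal_form_cocalibrated g_lie dim_g dim_u u_ideal e7_notin_u bb).
have ST : base_mx e [tuple \sum_i T i j *: e`_i | j < 6] = T.
  apply/matrixP=> i j; rewrite mxE -(tnth_nth 0 _ j) tnth_mktuple coord_comb //.
have := end_mx_base (ad_on br u e7) be bb; rewrite ST => E.
by rewrite -[end_mx [tuple _ | _ < 6] _](mulKmx uT) -E mulmxA.
Qed.
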